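(* Let $a,b>0$ and $\xi\in(0,1)$. The beam system described in the context (with $\alpha>0$) is exponentially stable. Moreover, for any $\epsilon>0$ (small enough that $\omega_0(\epsilon)$ below is negative), there exists $\alpha_0>0$ such that for any $0<\alpha<\alpha_0$ and for any solution $U=(u,u_t)$ of $U_t=\mathcal A U$, $U(0)=U_0$, with initial data $U_0\in D(\mathcal A)$, there exist constants $C>0$ and $\omega_0(\epsilon)<0$ depending on $a$, $b$ and $\alpha$ such that $$E(t)\le C\,e^{2\omega_0(\epsilon)t}\,\|U_0\|^2_{D(\mathcal A)},\qquad\forall t>0,$$ where $E(t)=\frac12\int_0^1\left(|u_t(x,t)|^2+a|u_{xx}(x,t)|^2\right)dx$ and $$\omega_0(\epsilon)=-\frac b2+\epsilon\ \text{ if } b\le2\sqrt a\,\pi^2,\qquad \omega_0(\epsilon)=\frac12\left(-b+\sqrt{b^2-4a\pi^4}\right)+\epsilon\ \text{ if } b>2\sqrt a\,\pi^2.$$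
   Context: The beam system is $u_{tt}+a u_{xxxx}+b u_t+\alpha u_t(\xi,t)\delta_\xi=0$ for $(x,t)\in(0,1)\times(0,\infty)$, $u(0,t)=u(1,t)=u_{xx}(0,t)=u_{xx}(1,t)=0$ for $t>0$, $u(x,0)=u_0(x)$, $u_t(x,0)=u_1(x)$, where $a,b,\alpha>0$, $\xi\in(0,1)$ and $\delta_\xi$ is the Dirac mass at $\xi$. It is written as $U_t=\mathcal A U$, $U(0)=U_0$, with $U=(u,u_t)$, as follows. The energy space is $\mathcal H=[H^2(0,1)\cap H^1_0(0,1)]\times L^2(0,1)$ with inner product $(U_1,U_2)_{\mathcal H}=\int_0^1(a\,u_{1,xx}\overline{u_{2,xx}}+v_1\overline{v_2})\,dx$ for $U_i=(u_i,v_i)$. The domain $D(\mathcal A)$ is the set of $(u,v)\in[H^4(0,\xi)\cap H^4(\xi,1)\cap H^2(0,1)]\times H^2(0,1)$ such that $u(0)=v(0)=u(1)=v(1)=0$, $u_{xx}(0)=u_{xx}(1)=0$, $u_{xx}(\xi^-)=u_{xx}(\xi^+)$ and $u_{xxx}(\xi^+)-u_{xxx}(\xi^-)=-\frac{\alpha}{a}v(\xi)$. The operator is $\mathcal A(u,v)=(v,\,-a\,u_{xxxx}-b\,v-\alpha v(\xi)\delta_\xi)$, derivatives being taken in the sense of distributions on $(0,1)$ (the domain condition on the jump of $u_{xxx}$ makes the second component an $L^2(0,1)$ function). $\|\cdot\|_{D(\mathcal A)}$ is the graph norm of $\mathcal A$. *)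

(* Defs.v *)
From HB Require Import structures.
From mathcomp Require Import all_boot all_order all_algebra.
From mathcomp Require Import complex.
From mathcomp Require Import all_classical all_reals all_analysis.

Set Implicit Arguments.
Unset Strict Implicit.
Unset Printing Implicit Defensive.

Import Order.TTheory GRing.Theory Num.Theory.
Import numFieldNormedType.Exports.

Local Open Scope classical_set_scope.
Local Open Scope complex_scope.
Local Open Scope ring_scope.

(* Elements of L^2 and of the Sobolev spaces are represented by functions
   R -> R[i] of which only the almost-everywhere class on the interval at hand
   matters.  R[i]^o makes them a vector space over R[i] (R[i] alone also
   carries an R-module structure). *)
Notation cfun R := (R -> R[i]^o).
Notation state R := ((R -> R[i]^o) * (R -> R[i]^o))%type.

Section Sobolev.
Variable R : realType.
Local Notation mu := (@lebesgue_measure R).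
Implicit Types (l r : R) (f g u v : cfun R) (phi : R -> R).

Definition cintegral l r f : R[i] :=
  (\int[mu]_(x in `]l, r[) complex.Re (f x)) +i*
  (\int[mu]_(x in `]l, r[) complex.Im (f x)).

Definition L2 l r f : Prop :=
  [/\ measurable_fun `]l, r[ (fun x => complex.Re (f x)),
      measurable_fun `]l, r[ (fun x => complex.Im (f x)) &
      (\int[mu]_(x in `]l, r[) (Normc.normc (f x) ^+ 2)%:E < +oo)%E].

(* C_c^oo(l, r).  Real-valued test functions suffice, as the distributions
   considered are complex-linear. *)
Definition test_function l r phi : Prop :=
  (forall n x, derivable (phi^`(n))%classic x 1) /\
  exists c d, [/\ l < c, d < r & forall x, x \notin `[c, d] -> phi x = 0].

Definition pairing l r f phi : R[i] :=
  cintegral l r (fun x => f x * (phi x)%:C).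

Definition is_weak_derivative l r (k : nat) f g : Prop :=
  forall phi, test_function l r phi ->
    pairing l r f (phi^`(k))%classic = (-1) ^+ k * pairing l r g phi.

(* H^k(l, r) *)
Definition Sobolev l r (k : nat) f : Prop :=
  L2 l r f /\
  forall j, (j <= k)%N -> exists2 g, L2 l r g & is_weak_derivative l r j f g.

(* A representative of the k-th weak derivative (0 if there is none). *)
Definition weakD l r (k : nat) f : cfun R :=
  xget (fun=> 0) [set g | L2 l r g /\ is_weak_derivative l r k f g].

(* The representative of f that is continuous up to the boundary of ]l, r[;
   for f in H^1(l, r) it exists and is unique on [l, r], and its values at l
   and r are the traces of f (one-sided limits). *)
Definition crep l r f : cfun R :=
  xget (fun=> 0) [set g : cfun R |
    [/\ {within `[l, r], continuous (fun x => complex.Re (g x))},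
        {within `[l, r], continuous (fun x => complex.Im (g x))} &
        f = g %[ae mu in `]l, r[%classic]]].

End Sobolev.

Section Beam.
Variable R : realType.
Local Notation mu := (@lebesgue_measure R).
Implicit Types (a b alpha xi eps t : R) (U V W : state R).

(* The energy space [H^2(0,1) cap H^1_0(0,1)] x L^2(0,1), H^1_0(0,1) being given
   by zero traces. *)
Definition inH U : Prop :=
  [/\ Sobolev 0 1 2 U.1, crep 0 1 U.1 0 = 0, crep 0 1 U.1 1 = 0 & L2 0 1 U.2].

Definition eqH U V : Prop :=
  U.1 = V.1 %[ae mu in `]0, 1[%classic] /\ U.2 = V.2 %[ae mu in `]0, 1[%classic].

Definition innerH a U V : R[i] :=
  cintegral 0 1 (fun x => a%:C * weakD 0 1 2 U.1 x * conjc (weakD 0 1 2 V.1 x)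
                          + U.2 x * conjc (V.2 x)).

Definition normH a U : R := Num.sqrt (complex.Re (innerH a U U)).

Definition energy a U : R :=
  2^-1 * \int[mu]_(x in `]0, 1[)
           (Normc.normc (U.2 x) ^+ 2 + a * Normc.normc (weakD 0 1 2 U.1 x) ^+ 2).

Definition domA a alpha xi U : Prop :=
  let u := U.1 in let v := U.2 in
  [/\ [/\ Sobolev 0 xi 4 u, Sobolev xi 1 4 u, Sobolev 0 1 2 u &
          Sobolev 0 1 2 v],
      [/\ crep 0 1 u 0 = 0, crep 0 1 v 0 = 0, crep 0 1 u 1 = 0 &
          crep 0 1 v 1 = 0],
      crep 0 xi (weakD 0 xi 2 u) 0 = 0 /\ crep xi 1 (weakD xi 1 2 u) 1 = 0,
      crep 0 xi (weakD 0 xi 2 u) xi = crep xi 1 (weakD xi 1 2 u) xi &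
      crep xi 1 (weakD xi 1 3 u) xi - crep 0 xi (weakD 0 xi 3 u) xi
        = - (alpha / a)%:C * crep 0 1 v xi].

(* The L^2(0,1) function w equal to -a u_xxxx - b v - alpha v(xi) delta_xi as
   a distribution on (0,1). *)
Definition is_opA2 a b alpha xi U (w : cfun R) : Prop :=
  forall phi, test_function 0 1 phi ->
    pairing 0 1 w phi =
      - a%:C * pairing 0 1 U.1 (phi^`(4))%classic - b%:C * pairing 0 1 U.2 phi
      - alpha%:C * crep 0 1 U.2 xi * (phi xi)%:C.

Definition opA a b alpha xi U : state R :=
  (U.2, xget (fun=> 0) [set w | L2 0 1 w /\ is_opA2 a b alpha xi U w]).

Definition graph_norm a b alpha xi U : R :=
  normH a U + normH a (opA a b alpha xi U).

(* Classical solution of U_t = A U, U(0) = U0 (in the sense of Pazy). *)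
Definition is_solution a b alpha xi (U0 : state R) (U : R -> state R) : Prop :=
  let A := opA a b alpha xi in
  [/\ eqH (U 0) U0,
      forall t, 0 <= t ->
        normH a (U s - U t) @[s --> within `[0, +oo[ (nbhs t)] --> (0 : R),
      forall t, 0 < t -> domA a alpha xi (U t),
      forall t, 0 < t ->
        normH a ((h^-1)%:C *: (U (t + h) - U t) - A (U t)) @[h --> 0^']
          --> (0 : R) &
      forall t, 0 < t ->
        normH a (A (U s) - A (U t)) @[s --> t] --> (0 : R)].

(* Strongly continuous semigroup of bounded linear operators on H, indexed by
   t >= 0; equalities in H are up to eqH. *)
Definition C0_semigroup a (S : R -> state R -> state R) : Prop :=
  [/\ forall t U, 0 <= t -> inH U -> inH (S t U),
      forall t (c : R[i]) U V, 0 <= t -> inH U -> inH V ->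
        eqH (S t (c *: U + V)) (c *: S t U + S t V),
      forall t, 0 <= t -> exists M : R, forall U, inH U ->
        normH a (S t U) <= M * normH a U,
      (forall U, inH U -> eqH (S 0 U) U) /\
      (forall s t U, 0 <= s -> 0 <= t -> inH U ->
        eqH (S (s + t) U) (S s (S t U))) &
      forall U, inH U -> normH a (S h U - U) @[h --> 0^'+] --> (0 : R)].

(* The infinitesimal generator of S is A, domain included. *)
Definition generated_by a b alpha xi (S : R -> state R -> state R) : Prop :=
  forall U W, inH U -> inH W ->
    (normH a ((h^-1)%:C *: (S h U - U) - W) @[h --> 0^'+] --> (0 : R)) <->
    (domA a alpha xi U /\ eqH W (opA a b alpha xi U)).

(* The semigroup generated by A is unique; its existence is the well-posedness
   of the system, which is not part of its stability. *)
Definition exponentially_stable a b alpha xi : Prop :=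
  forall S, C0_semigroup a S -> generated_by a b alpha xi S ->
    exists M omega : R, [/\ 0 < M, 0 < omega &
      forall U t, inH U -> 0 <= t ->
        normH a (S t U) <= M * expR (- omega * t) * normH a U].

Definition omega0 a b eps : R :=
  if b <= 2 * Num.sqrt a * pi ^+ 2 then - (b / 2) + eps
  else 2^-1 * (- b + Num.sqrt (b ^+ 2 - 4 * a * pi ^+ 4)) + eps.

End Beam.

(* Main.v *)
(* For 0 < beta <= b/2 consider the form
     Phi(u,v) = int |v + beta u|^2 + a |u_xx|^2 + (beta^2 - b beta) |u|^2 ,
   which by pi^4 int |u|^2 <= int |u_xx|^2 is equivalent to the energy if b beta - beta^2 < a pi^4.
   Along a solution
     Phi' + 2 beta Phi = 2 (2 beta - b) int |v + beta u|^2
                         - 2 alpha |v(xi)|^2 - 2 alpha beta Re (v(xi) conj(u(xi)))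
   is at most alpha beta^2 |u(xi)|^2 / 2, and pi^2 |u(xi)|^2 <= int |u_xx|^2, so that Phi decays at
   the rate 2 beta - O(alpha beta^2). For the quantitative bound take beta = - omega_0 + eps / 2 and
   alpha small; for stability at a given alpha take beta small. Orbits of the semigroup starting in
   D(A) satisfy the differential inequality for right derivatives only; this suffices for continuous
   functions, and the orbits are continuous because the semigroup is bounded near t = 0 (uniform
   boundedness). The decay extends to the energy space by the density of D(A). *)

Require Import Defs.
From mathcomp Require Import all_boot all_order all_algebra.
From mathcomp Require Import complex measurable_realfun ring lra.
From mathcomp Require Import all_classical all_reals all_analysis.

Import Order.TTheory GRing.Theory Num.Theory.
Import numFieldNormedType.Exports.

Local Open Scope ring_scope.

Set Implicit Arguments.
Unset Strict Implicit.
Unset Printing Implicit Defensive.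

(** The polynomial [x^2 - b x + a pi^4] is, up to [x -> -x], the characteristic polynomial of the
    mode [sin (pi x)] without pointwise damping. For [beta <= b/2] the condition
    [b beta - beta^2 < a pi^4] keeps [beta] below its smaller root when the roots are real. This is
    where [omega0] comes from, and why the Poincare constant must be exactly [pi^4]. The point
    damping enters only through [v(xi)] and [u(xi)]. Completing the square in [v(xi)] leaves a
    multiple of [|u(xi)|^2]; to pay for it, a part [c |u_xx|^2] of [a |u_xx|^2] is withheld from the
    Poincare estimate. The obstacle is that weak derivatives, traces and [A U] are chosen
    representatives. They are traded for absolutely continuous functions, separately for real and
    imaginary parts, which is possible because the coefficients are real. Moreover [u] and [v] are
    not test functions, so [A U] has to be characterised by its pairings with the whole of [H^2]
    with zero traces. *)

Section IntervalIntegral.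
Local Open Scope classical_set_scope.
Context {R : realType}.
Local Notation mu := (@lebesgue_measure R).
Implicit Types (l r m c : R) (f g : R -> R).

(** * Real integrals and square integrability on open intervals *)

Definition rint l r f : R := \int[mu]_(x in `]l, r[) f x.
Definition rintegrable l r f : Prop := mu.-integrable `]l, r[ (EFin \o f).
(** Measurability of [f] is a separate clause because it does not follow from integrability of the
    square. *)
Definition rL2 l r f : Prop :=
  measurable_fun `]l, r[ f /\ rintegrable l r (fun x => f x ^+ 2).

Lemma rintegrable_meas l r f : rintegrable l r f -> measurable_fun `]l, r[ f.
Proof. by move=> /integrableP[+ _]; exact: (measurable_EFinP _ _).1. Qed.

Lemma rintegrableD l r f g : rintegrable l r f -> rintegrable l r g ->
  rintegrable l r (fun x => f x + g x).
Proof. by move=> hf hg; exact: (integrableD _ hf hg). Qed.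

Lemma rintegrableZ l r c f : rintegrable l r f -> rintegrable l r (fun x => c * f x).
Proof. by move=> hf; exact: (integrableZl _ _ hf). Qed.

Lemma rintD l r f g : rintegrable l r f -> rintegrable l r g ->
  rint l r (fun x => f x + g x) = rint l r f + rint l r g.
Proof. by move=> hf hg; exact: RintegralD. Qed.

Lemma rintB l r f g : rintegrable l r f -> rintegrable l r g ->
  rint l r (fun x => f x - g x) = rint l r f - rint l r g.
Proof. by move=> hf hg; exact: RintegralB. Qed.

Lemma rintZ l r c f : rintegrable l r f ->
  rint l r (fun x => c * f x) = c * rint l r f.
Proof. by move=> hf; exact: RintegralZl. Qed.

Lemma rint_ge0 l r f : (forall x, l < x < r -> 0 <= f x) -> 0 <= rint l r f.
Proof. by move=> h; apply: Rintegral_ge0 => x /=; rewrite in_itv/=; exact: h. Qed.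

Lemma le_rint l r f g : rintegrable l r f -> rintegrable l r g ->
  (forall x, l < x < r -> f x <= g x) -> rint l r f <= rint l r g.
Proof.
by move=> hf hg h; apply: le_Rintegral => // x /=; rewrite in_itv/=; exact: h.
Qed.

Lemma eq_rint l r f g : (forall x, l < x < r -> f x = g x) -> rint l r f = rint l r g.
Proof. by move=> h; apply: eq_Rintegral => x; rewrite inE/= in_itv/=; exact: h. Qed.

Lemma eq_rintegrable l r f g : (forall x, l < x < r -> f x = g x) ->
  rintegrable l r f -> rintegrable l r g.
Proof.
move=> h; apply: eq_integrable => // x; rewrite inE/= in_itv/= => /h/=.
by move=> ->.
Qed.

Lemma rintegrable_cst l r c : rintegrable l r (fun=> c).
Proof.
apply: measurable_bounded_integrable => //=.
- by rewrite lebesgue_measure_itv/=; case: ifP => // _; rewrite -EFinB ltry.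
- by exists `|c|; split; rewrite ?num_real// => y cy x _; exact: ltW.
Qed.

Lemma rint_cst l r c : l <= r -> rint l r (fun=> c) = c * (r - l).
Proof.
move=> lr; rewrite /rint Rintegral_cst//= lebesgue_measure_itv/= lte_fin.
by move: lr; rewrite le_eqVlt => /orP[/eqP->|->//]; rewrite ltxx subrr.
Qed.

Lemma sub_itvoo l r l' r' : l <= l' -> r' <= r -> `]l', r'[ `<=` `]l, r[.
Proof.
move=> ll rr x /=; rewrite !in_itv/= => /andP[h1 h2].
by rewrite (le_lt_trans ll h1) (lt_le_trans h2 rr).
Qed.

Lemma rintegrable_sub l r l' r' f : l <= l' -> r' <= r ->
  rintegrable l r f -> rintegrable l' r' f.
Proof. by move=> ll rr; apply: integrableS => //; exact: sub_itvoo. Qed.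

Lemma rint_split l m r f : l <= m -> m <= r -> rintegrable l r f ->
  rint l r f = rint l m f + rint m r f.
Proof.
move=> lm mr hf.
have := @Rintegral_itvB _ f (BRight l) (BLeft r) m hf.
rewrite /rint bnd_simp => /(_ lm).
move: mr; rewrite le_eqVlt => /orP[/eqP mr _|mr /(_ mr) <-].
  by rewrite mr [X in _ + X](_ : _ = 0) ?addr0 1?set_itvoo0 ?Rintegral_set0.
rewrite (Rintegral_itv_bndo_bndc (r := m)); first by rewrite addrC subrK.
by apply: rintegrable_sub hf => //; exact: ltW.
Qed.

Lemma rintegrable_le l r f g : measurable_fun `]l, r[ f ->
  (forall x, l < x < r -> `|f x| <= g x) -> rintegrable l r g -> rintegrable l r f.
Proof.
move=> mf fg hg; apply: le_integrable hg => //=; first exact/measurable_EFinP.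
move=> x /=; rewrite in_itv/= => /fg; rewrite lee_fin => h.
exact: le_trans h (ler_norm _).
Qed.

Lemma rL2_meas l r f : rL2 l r f -> measurable_fun `]l, r[ f.
Proof. by case. Qed.

Lemma rL2_sq l r f : rL2 l r f -> rintegrable l r (fun x => f x ^+ 2).
Proof. by case. Qed.

Lemma rL2_mul l r f g : rL2 l r f -> rL2 l r g -> rintegrable l r (fun x => f x * g x).
Proof.
move=> [mf hf] [mg hg].
apply: (@rintegrable_le _ _ _ (fun x => f x ^+ 2 + g x ^+ 2)).
- exact: measurable_funM.
- move=> x _; rewrite ler_norml; apply/andP; split.
    by rewrite -subr_ge0; have := sqr_ge0 (f x + g x); have := sqr_ge0 (f x);
       have := sqr_ge0 (g x); lra.
  by have := sqr_ge0 (f x - g x); have := sqr_ge0 (f x); have := sqr_ge0 (g x); lra.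
- exact: rintegrableD.
Qed.

Lemma rL2_cst l r c : rL2 l r (fun=> c).
Proof. by split; [exact: measurable_cst|exact: rintegrable_cst]. Qed.

Lemma rL2_int l r f : rL2 l r f -> rintegrable l r f.
Proof.
move=> hf; have := rL2_mul hf (@rL2_cst l r 1).
by apply: eq_rintegrable => x _; rewrite mulr1.
Qed.

Lemma rL2Z l r c f : rL2 l r f -> rL2 l r (fun x => c * f x).
Proof.
move=> [mf hf]; split; first exact: measurable_funM.
by have := rintegrableZ (c ^+ 2) hf; apply: eq_rintegrable => x _; rewrite exprMn.
Qed.

Lemma rL2D l r f g : rL2 l r f -> rL2 l r g -> rL2 l r (fun x => f x + g x).
Proof.
move=> hf hg; split; first exact: measurable_funD hf.1 hg.1.
have := rintegrableD (rintegrableD hf.2 hg.2) (rintegrableZ 2 (rL2_mul hf hg)).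
by apply: eq_rintegrable => x _; ring.
Qed.

Lemma rL2N l r f : rL2 l r f -> rL2 l r (fun x => - f x).
Proof.
move=> hf; have := rL2Z (-1) hf.
by under eq_fun do rewrite mulN1r.
Qed.

Lemma rL2B l r f g : rL2 l r f -> rL2 l r g -> rL2 l r (fun x => f x - g x).
Proof. by move=> hf hg; exact: rL2D hf (rL2N hg). Qed.

Lemma rL2_sub l r l' r' f : l <= l' -> r' <= r -> rL2 l r f -> rL2 l' r' f.
Proof.
move=> ll rr [mf hf]; split; last exact: rintegrable_sub hf.
by apply: measurable_funS mf => //; exact: sub_itvoo.
Qed.

Lemma eq_rL2 l r f g : (forall x, l < x < r -> f x = g x) -> rL2 l r f -> rL2 l r g.
Proof.
move=> fg [mf hf]; split.
  by apply: eq_measurable_fun mf => x; rewrite inE/= in_itv/=; exact: fg.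
by apply: eq_rintegrable hf => x /fg ->.
Qed.

Lemma rL2_cont l r f : {within `[l, r], continuous f} -> rL2 l r f.
Proof.
move=> cf.
have ci : rintegrable l r (fun x => f x ^+ 2).
  apply: (@integrableS _ _ _ mu `[l, r]%classic) => //.
    exact: subset_itv_oo_cc.
  apply: continuous_compact_integrable; first exact: segment_compact.
  by move=> x; apply: cvgM; exact: cf.
split => //.
apply: (@measurable_funS _ _ _ _ `[l, r]%classic) => //.
  exact: subset_itv_oo_cc.
exact: subspace_continuous_measurable_fun.
Qed.

Definition aeq l r f g := f = g %[ae mu in `]l, r[%classic].

#[global] Instance lebesgue_ae_filter : Filter (nbhs (almost_everywhere mu)).
Proof. exact: ae_filter_ringOfSetsType. Qed.

Lemma aeq_refl l r f : aeq l r f f.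
Proof. exact: ae_eq_refl. Qed.

Lemma aeq_sym l r f g : aeq l r f g -> aeq l r g f.
Proof. exact: ae_eq_sym. Qed.

Lemma aeq_trans l r f g h : aeq l r f g -> aeq l r g h -> aeq l r f h.
Proof. exact: ae_eq_trans. Qed.

Lemma aeq_sub l r l' r' f g : l <= l' -> r' <= r -> aeq l r f g -> aeq l' r' f g.
Proof.
by move=> ll rr; apply: filterS => x h /(sub_itvoo ll rr).
Qed.

Lemma aeq_fun2 l r f f' g g' (op : R -> R -> R) : aeq l r f f' -> aeq l r g g' ->
  aeq l r (fun x => op (f x) (g x)) (fun x => op (f' x) (g' x)).
Proof. by apply: filterS2 => x h1 h2 /[dup] /h1 -> /h2 ->. Qed.

Lemma aeq_fun1 l r f f' (op : R -> R) : aeq l r f f' ->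
  aeq l r (fun x => op (f x)) (fun x => op (f' x)).
Proof. by apply: filterS => x h1 /h1 ->. Qed.

Lemma aeq_imp l r f g f' g' : (forall x, l < x < r -> f x = g x -> f' x = g' x) ->
  aeq l r f g -> aeq l r f' g'.
Proof.
by move=> h; apply: filterS => x h1 /[dup] /h1 E; rewrite /= in_itv/= => /h; exact.
Qed.

Lemma aeq_rint l r f g : measurable_fun `]l, r[ f -> measurable_fun `]l, r[ g ->
  aeq l r f g -> rint l r f = rint l r g.
Proof.
move=> mf mg fg; congr fine; apply: ae_eq_integral => //.
- exact/measurable_EFinP.
- exact/measurable_EFinP.
- by apply: filterS fg => x /= h /h ->.
Qed.

Lemma aeq_rintegrable l r f g : measurable_fun `]l, r[ g ->
  aeq l r f g -> rintegrable l r f -> rintegrable l r g.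
Proof.
move=> mg fg /integrableP[mf hf]; apply/integrableP; split; first exact/measurable_EFinP.
rewrite -(_ : (\int[mu]_(x in `]l, r[) `|(f x)%:E| = \int[mu]_(x in `]l, r[) `|(g x)%:E|)%E) //.
apply: ae_eq_integral => //.
- exact: (measurableT_comp _ mf).
- by apply: (@measurableT_comp _ _ _ _ _ _ abse) => //; exact/measurable_EFinP.
- by apply: filterS fg => x /= h /h ->.
Qed.

Lemma aeq_rL2 l r f g : measurable_fun `]l, r[ g -> aeq l r f g -> rL2 l r f -> rL2 l r g.
Proof.
move=> mg fg [mf hf]; split => //.
apply: aeq_rintegrable hf; first exact: measurable_funX.
exact: (aeq_fun1 (fun y => y ^+ 2)).
Qed.

(** The integral of [(s f + t g)^2] is a nonnegative quadratic form in [(s, t)], so its discriminant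
    has a sign. *)
Lemma rint_cauchy_schwarz l r f g : rL2 l r f -> rL2 l r g ->
  rint l r (fun x => f x * g x) ^+ 2 <=
  rint l r (fun x => f x ^+ 2) * rint l r (fun x => g x ^+ 2).
Proof.
move=> hf hg.
set A := rint l r (fun x => f x ^+ 2); set B := rint _ _ _; set C := rint _ _ _.
have P s t : 0 <= s ^+ 2 * A + 2 * s * t * B + t ^+ 2 * C.
  have -> : s ^+ 2 * A + 2 * s * t * B + t ^+ 2 * C =
    rint l r (fun x => (s * f x + t * g x) ^+ 2).
    rewrite /A /B /C -!rintZ//; [|exact: hg.2|exact: rL2_mul|exact: hf.2].
    rewrite -rintD; [|by apply/rintegrableZ; exact: hf.2|by apply/rintegrableZ; exact: rL2_mul].
    rewrite -rintD; last by apply/rintegrableZ; exact: hg.2.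
      by apply: eq_rint => x _; ring.
    by apply: rintegrableD; apply/rintegrableZ; [exact: hf.2|exact: rL2_mul].
  by apply: rint_ge0 => x _; exact: sqr_ge0.
have A0 : 0 <= A by apply: rint_ge0 => x _; exact: sqr_ge0.
have C0 : 0 <= C by apply: rint_ge0 => x _; exact: sqr_ge0.
have [AC0|AC0] := eqVneq C 0.
  rewrite AC0 mulr0 leNgt; apply/negP => B1.
  have B2 : B != 0 by rewrite -sqrf_eq0 gt_eqF.
  (* With [C = 0] the form is affine in [t]; this value of [t] makes it [- A - 2], which is
     negative. *)
  have := P 1 (- (A + 1) / B); rewrite AC0.
  rewrite (_ : _ + _ = - A - 2); last by field.
  by lra.
have := P C (- B).
have C1 : 0 < C by rewrite lt_def AC0.
have -> : C ^+ 2 * A + 2 * C * - B * B + (- B) ^+ 2 * C = C * (A * C - B ^+ 2) by ring.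
by rewrite pmulr_rge0// subr_ge0.
Qed.

End IntervalIntegral.

(** * Primitives of square integrable functions and integration by parts *)

Section AbsolutelyContinuous.
Local Open Scope classical_set_scope.
Context {R : realType}.
Local Notation mu := (@lebesgue_measure R).
Implicit Types (l r m c : R) (f g F G : R -> R).

Lemma rintE l r f : rintegrable l r f ->
  (\int[mu]_(x in `]l, r[) (f x)%:E)%E = (rint l r f)%:E.
Proof. by move=> hf; rewrite fineK//; exact: integrable_fin_num. Qed.

Lemma rint_patch l r f : rintegrable l r f ->
  (\int[mu]_x ((f \_ `]l, r[) x)%:E)%E = (rint l r f)%:E.
Proof.
move=> hf; rewrite -rintE// [RHS]integral_mkcond.
by apply: eq_integral => x _; rewrite restrict_EFin.
Qed.

Lemma rintegrable_patch l r f : rintegrable l r f ->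
  mu.-integrable setT (EFin \o (f \_ `]l, r[)).
Proof.
move=> hf; have := (@integrable_mkcond _ _ _ mu _ (EFin \o f) (measurable_itv _)).1 hf.
by apply: eq_integrable => // x _; rewrite restrict_EFin.
Qed.

(** Fubini on the triangle [l < y < x < r] for the product [f x * g y]. *)
Lemma rint_swap l r f g : rintegrable l r f -> rintegrable l r g ->
  rint l r (fun x => f x * rint l x g) =
  rint l r (fun y => g y * (rint l r f - rint l y f)).
Proof.
move=> hf hg.
pose f0 := f \_ `]l, r[; pose g0 := g \_ `]l, r[.
have if0 := rintegrable_patch hf; have ig0 := rintegrable_patch hg.
have mf0 : measurable_fun setT f0.
  by apply/measurable_EFinP; exact: measurable_int if0.
have mg0 : measurable_fun setT g0.
  by apply/measurable_EFinP; exact: measurable_int ig0.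
pose h (z : R * R) : R := if z.2 < z.1 then f0 z.1 * g0 z.2 else 0.
have mh : measurable_fun setT (fun z => (h z)%:E).
  apply/measurable_EFinP; apply: measurable_fun_ifT => //.
  - exact: measurable_fun_ltr.
  - by apply: measurable_funM; exact: measurableT_comp.
have mhx x : measurable_fun setT (fun y => h (x, y)).
  rewrite /h/=; apply: measurable_fun_ifT => //; first exact: measurable_fun_ltr.
  exact: measurable_funM.
(* Tonelli: [|h|] is dominated by the product of the absolute values of the two extensions by zero,
   whose double integral factors. *)
have ih : (mu \x mu)%E.-integrable setT (fun z => (h z)%:E).
  apply/(@integrable12ltyP _ _ _ _ _ mu mu _ mh).
  apply: (@le_lt_trans _ _ (\int[mu]_x ((`|f0 x|)%:E * \int[mu]_y `|(g0 y)%:E|))%E).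
    apply: ge0_le_integral => //=.
    - by move=> x _; exact: integral_ge0.
    - apply: (@measurable_fun_fubini_tonelli_F _ _ _ _ _ mu (fun z => (`|h z|)%:E)) => //=.
      by apply/measurable_EFinP; apply: measurableT_comp => //; exact/measurable_EFinP.
    - apply: emeasurable_funM => //; first by apply/measurable_EFinP; exact: measurableT_comp.
    - move=> x _; rewrite -ge0_integralZl//=.
      + apply: ge0_le_integral => //=.
        * by apply/measurable_EFinP; apply: measurableT_comp => //; exact: mhx.
        * by apply/measurable_EFinP; apply: measurable_funM => //; exact: measurableT_comp.
        * move=> y _; rewrite lee_fin /h/=; case: ifP => _; first by rewrite normrM.
          by rewrite normr0 mulr_ge0.
      + by apply/measurable_EFinP; exact: measurableT_comp.
  rewrite ge0_integralZr//; last 2 first.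
  - by apply/measurable_EFinP; exact: measurableT_comp.
  - exact: integral_ge0.
  apply: lte_mul_pinfty => //.
  - exact: integral_ge0.
  - by rewrite ge0_fin_numE ?integral_ge0//; case/integrableP : if0.
  - by case/integrableP : ig0.
have E := @Fubini _ _ _ _ _ mu mu _ ih.
have L1 x : (\int[mu]_y (h (x, y))%:E = (((fun x => f x * rint l x g) \_ `]l, r[) x)%:E)%E.
  rewrite patchE mem_setE in_itv/=; case: ifPn => [/andP[lx xr]|xN].
  - have ig := rintegrable_sub (lexx l) (ltW xr) hg.
    rewrite EFinM -(rint_patch ig).
    rewrite -(@integralZl _ _ _ mu setT measurableT _ (rintegrable_patch ig) (f x)).
    apply: eq_integral => y _; rewrite /h/= -EFinM; congr EFin.
    rewrite /f0 /g0 !patchE !mem_setE !in_itv/= lx xr/=.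
    case: ifPn => yx; last by rewrite andbF mulr0.
    by rewrite andbT (lt_trans yx xr) andbT.
  - rewrite -[RHS](integral0 mu setT); apply: eq_integral => y _; congr EFin.
    by rewrite /h/= /f0 patchE mem_setE in_itv/= (negbTE xN) mul0r if_same.
have L2 y : (\int[mu]_x (h (x, y))%:E =
    (((fun y => g y * (rint l r f - rint l y f)) \_ `]l, r[) y)%:E)%E.
  rewrite patchE mem_setE in_itv/=; case: ifPn => [/andP[ly yr]|yN].
  - rewrite (rint_split (ltW ly) (ltW yr) hf) addrC addKr.
    have jf := rintegrable_sub (ltW ly) (lexx r) hf.
    rewrite EFinM -(rint_patch jf).
    rewrite -(@integralZl _ _ _ mu setT measurableT _ (rintegrable_patch jf) (g y)).
    apply: eq_integral => x _; rewrite /h/= -EFinM; congr EFin.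
    rewrite /f0 /g0 !patchE !mem_setE !in_itv/= ly yr/=.
    case: ifPn => yx; last by rewrite mulr0.
    by rewrite (lt_trans ly yx)/= mulrC.
  - rewrite -[RHS](integral0 mu setT); apply: eq_integral => x _; congr EFin.
    by rewrite /h/= /g0 patchE mem_setE in_itv/= (negbTE yN) mulr0 if_same.
have L k : (\int[mu]_x ((k \_ `]l, r[) x)%:E = \int[mu]_(x in `]l, r[) (k x)%:E)%E.
  by rewrite [RHS]integral_mkcond; apply: eq_integral => x _; rewrite restrict_EFin.
have K k : rint l r k = fine (\int[mu]_x ((k \_ `]l, r[) x)%:E)%E by rewrite L.
rewrite [LHS]K [RHS]K; congr fine.
transitivity (\int[mu]_x \int[mu]_y (h (x, y))%:E)%E.
  by apply: eq_integral => x _; exact/esym/L1.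
by rewrite E; apply: eq_integral => y _; exact: L2.
Qed.

(** [F] is the representative of an [H^1] function that is continuous on the closed interval, [f]
    its weak derivative. Defining it by the integral formula avoids pointwise differentiation: [f]
    matters only almost everywhere, [F] at every point of [[l, r]]. *)
Definition AC l r F f :=
  rL2 l r f /\ forall x, l <= x <= r -> F x = F l + rint l x f.

Lemma rint_contin l r f : l <= r -> rintegrable l r f ->
  {within `[l, r], continuous (fun x => rint l x f)}.
Proof.
move=> lr hf.
have hg := rintegrable_patch hf.
have hgs (A : set R) : measurable A -> mu.-integrable A (EFin \o (f \_ `]l, r[)).
  by move=> mA; apply: integrableS hg.
have := parameterized_integral_continuous lr (hgs _ (measurable_itv _)).
apply: subspace_eq_continuous => x; rewrite inE/= in_itv/= => /andP[lx xr].
rewrite /from_subspace/= /parameterized_integral.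
rewrite -Rintegral_itv_obnd_cbnd; last by apply: hgs.
rewrite -Rintegral_itv_bndo_bndc; last by apply: hgs.
apply: eq_Rintegral => y; rewrite inE/= in_itv/= => /andP[ly yx].
by rewrite patchE mem_setE in_itv/= ly (lt_le_trans yx xr).
Qed.

Lemma AC_cont l r F f : l <= r -> AC l r F f -> {within `[l, r], continuous F}.
Proof.
move=> lr [hf hF].
have c1 := rint_contin lr (rL2_int hf).
have c2 : {within `[l, r], continuous (fun x => F l + rint l x f)}.
  by move=> x; apply: cvgD; [exact: cvg_cst|exact: c1].
apply: subspace_eq_continuous c2 => x; rewrite inE/= in_itv/= => xlr.
exact/esym/hF.
Qed.

Lemma AC_rL2 l r F f : l <= r -> AC l r F f -> rL2 l r F.
Proof. by move=> lr /(AC_cont lr) /rL2_cont. Qed.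

Lemma AC_prim l r c f : rL2 l r f -> AC l r (fun x => c + rint l x f) f.
Proof.
move=> hf; split => // x _.
by rewrite [X in _ = _ + X + _](_ : _ = 0) ?addr0// /rint set_itvoo0 Rintegral_set0.
Qed.

Lemma AC_inc l r F f x y : AC l r F f -> l <= x -> x <= y -> y <= r ->
  F y = F x + rint x y f.
Proof.
move=> [hf hF] lx xy yr; rewrite (hF y) ?(le_trans lx xy)// (hF x) ?lx ?(le_trans xy)//.
rewrite (rint_split lx xy) ?addrA//.
by apply: rintegrable_sub (rL2_int hf).
Qed.

Lemma AC_sub l r l' r' F f : l <= l' -> r' <= r -> AC l r F f -> AC l' r' F f.
Proof.
move=> ll rr hF; split; first exact: rL2_sub hF.1.
by move=> x /andP[lx xr]; apply: AC_inc hF _ _ _ => //; exact: le_trans rr.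
Qed.

(** Writing [F] and [G] as their value at [l] plus a primitive turns the identity into [rint_swap]
    and algebra. *)
Lemma AC_ibp l r F f G g : l <= r -> AC l r F f -> AC l r G g ->
  rint l r (fun x => f x * G x) = F r * G r - F l * G l - rint l r (fun x => F x * g x).
Proof.
move=> lr HF HG.
have hF := AC_rL2 lr HF; have hG := AC_rL2 lr HG.
case: (HF) => hf EF; case: (HG) => hg EG.
have If := rL2_cont (rint_contin lr (rL2_int hf)).
have Ig := rL2_cont (rint_contin lr (rL2_int hg)).
have -> : rint l r (fun x => f x * G x) = G l * rint l r f + rint l r (fun x => f x * rint l x g).
  rewrite -(rintZ (G l) (rL2_int hf)) -rintD; last 2 first.
  - exact/rintegrableZ/rL2_int.
  - exact: rL2_mul.
  by apply: eq_rint => x /andP[lx xr]; rewrite (EG x) ?(ltW lx) ?(ltW xr)//; ring.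
have -> : rint l r (fun x => F x * g x) = F l * rint l r g + rint l r (fun x => g x * rint l x f).
  rewrite -(rintZ (F l) (rL2_int hg)) -rintD; last 2 first.
  - exact/rintegrableZ/rL2_int.
  - exact: rL2_mul.
  by apply: eq_rint => x /andP[lx xr]; rewrite (EF x) ?(ltW lx) ?(ltW xr)//; ring.
rewrite (rint_swap (rL2_int hf) (rL2_int hg)).
have -> : rint l r (fun y => g y * (rint l r f - rint l y f)) =
    rint l r f * rint l r g - rint l r (fun x => g x * rint l x f).
  rewrite -(rintZ (rint l r f) (rL2_int hg)) -rintB; last 2 first.
  - exact/rintegrableZ/rL2_int.
  - exact: rL2_mul.
  by apply: eq_rint => x _; ring.
rewrite (EF r) ?lr ?lexx// (EG r) ?lr ?lexx//; ring.
Qed.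

End AbsolutelyContinuous.

(** * Smooth functions and the flat function *)

Section Smooth.
Local Open Scope classical_set_scope.
Context {R : realType}.
Local Notation mu := (@lebesgue_measure R).
Implicit Types (l r m c x y : R) (f g F G : R -> R) (p : {poly R}).

Definition smooth f := forall n x, derivable (f^`(n))%classic x 1.

(** An inductive form of n-fold differentiability: since each derivative is a named function,
    closure under sums, products and affine substitutions goes by induction on [n]. *)
Fixpoint diffn n f : Prop :=
  if n is n'.+1 then exists2 g, forall x, is_derive x (1 : R) f (g x) & diffn n' g
  else True.

Lemma is_derive_derive1 f g : (forall x, is_derive x (1 : R) f (g x)) -> f^`() = g.
Proof. by move=> fg; apply/funext => x; rewrite derive1E; apply: derive_val. Qed.

Lemma derive1n_derive1 f n : (f^`(n.+1) = f^`()^`(n))%classic.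
Proof. by rewrite /derive1n iterSr. Qed.

Lemma smoothP f : smooth f <-> forall n, diffn n f.
Proof.
split.
  move=> + n; elim: n f => // n IH f sf /=; exists (f^`()).
    move=> x; have := sf 0 x; rewrite derive1n0 => fx.
    by rewrite derive1E; exact: DeriveDef.
  by apply: IH => m x; rewrite -derive1n_derive1; exact: sf.
move=> + n x; move: f; elim: n => [|n IH] f.
  by move=> /(_ 1)[g fg _]; rewrite derive1n0; exact: ex_derive.
move=> df; rewrite derive1n_derive1; apply: IH => k.
by have [g /is_derive_derive1 ->] := df k.+1.
Qed.

Lemma diffnS n f : diffn n.+1 f -> diffn n f.
Proof. by elim: n f => // n IH f [g fg /IH]; exists g. Qed.

Lemma diffn_cst n c : diffn n (fun=> c).
Proof.
elim: n c => // n IH c /=; exists (fun=> 0) => //.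
by move=> x; exact: is_derive_cst.
Qed.

Lemma diffnD n f g : diffn n f -> diffn n g -> diffn n (fun x => f x + g x).
Proof.
elim: n f g => // n IH f g [f' hf df] [g' hg dg]; exists (fun x => f' x + g' x).
  by move=> x; exact: is_deriveD.
exact: IH.
Qed.

Lemma diffnM n f g : diffn n f -> diffn n g -> diffn n (fun x => f x * g x).
Proof.
elim: n f g => // n IH f g hf hg.
have hf0 := diffnS hf; have hg0 := diffnS hg.
case: hf hg => f' hf df [g' hg dg]; exists (fun x => f x * g' x + g x * f' x).
  by move=> x; exact: is_deriveM.
by apply: diffnD; exact: IH.
Qed.

Lemma diffn_affine n f a b : diffn n f -> diffn n (fun x => f (a * x + b)).
Proof.
elim: n f => // n IH f [g fg dg]; exists (fun x => a * g (a * x + b)).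
  move=> x; rewrite mulrC.
  have h : is_derive x (1 : R) (fun x => a * x + b) a.
    by apply: is_derive_eq; rewrite ?addr0 ?scaler0 ?add0r /GRing.scale/= ?mulr0 ?add0r ?addr0 ?mulr1.
  exact: (@is_derive1_comp _ f (fun x => a * x + b)).
apply: diffnM; first exact: diffn_cst.
exact: IH.
Qed.

Lemma smoothD f g : smooth f -> smooth g -> smooth (fun x => f x + g x).
Proof. by move=> /smoothP hf /smoothP hg; apply/smoothP => n; exact: diffnD. Qed.

Lemma smoothM f g : smooth f -> smooth g -> smooth (fun x => f x * g x).
Proof. by move=> /smoothP hf /smoothP hg; apply/smoothP => n; exact: diffnM. Qed.

Lemma smooth_cst c : smooth (fun=> c).
Proof. by apply/smoothP => n; exact: diffn_cst. Qed.

Lemma smoothZ c f : smooth f -> smooth (fun x => c * f x).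
Proof. by move=> hf; exact: (smoothM (@smooth_cst c) hf). Qed.

Lemma smoothB f g : smooth f -> smooth g -> smooth (fun x => f x - g x).
Proof.
move=> hf hg; have := smoothD hf (@smoothZ (-1) g hg).
by under eq_fun do rewrite mulN1r.
Qed.

Lemma smooth_affine f a b : smooth f -> smooth (fun x => f (a * x + b)).
Proof. by move=> /smoothP hf; apply/smoothP => n; exact: diffn_affine. Qed.

Lemma smooth_derive f : smooth f -> smooth (f^`()).
Proof. by move=> hf n x; rewrite -derive1n_derive1; exact: hf. Qed.

Lemma smooth_is_derive f x : smooth f -> is_derive x (1 : R) f (f^`() x).
Proof.
move=> /(_ 0 x); rewrite derive1n0 => fx; rewrite derive1E; exact: DeriveDef.
Qed.

Lemma is_derive_smooth f g : (forall x, is_derive x (1 : R) f (g x)) ->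
  smooth g -> smooth f.
Proof.
move=> fg /smoothP dg; apply/smoothP => -[//|n]; exists g => //; exact: dg.
Qed.

Lemma smooth_cont f : smooth f -> continuous f.
Proof.
move=> sf x; apply: differentiable_continuous; apply/derivable1_diffP.
exact: (sf 0).
Qed.

(* The functions [p(1/x) exp(-1/x)], [p] a polynomial, are closed under derivation. *)
Definition flat p x : R := if 0 < x then p.[x^-1] * expR (- x^-1) else 0.

(** This is [z <= 1 + z <= expR z] at [z = y / (m + 1)], raised to the power [m + 1]. *)
Lemma expR_ge_pow (m : nat) y : 0 <= y -> (y / m.+1%:R) ^+ m.+1 <= expR y.
Proof.
move=> y0; have {2}-> : y = m.+1%:R * (y / m.+1%:R) by rewrite mulrC divfK// pnatr_eq0.
rewrite expRM_natl.
rewrite lerXn2r ?nnegrE ?divr_ge0 ?expR_ge0//.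
by apply: le_trans (expR_ge1Dx _); rewrite lerDr.
Qed.

(** The exponential beats the polynomial in [1/x] with two powers of [x] to spare. These make the
    difference quotient of [flat p] at 0 tend to 0. *)
Lemma flat_bound p : exists C, forall x, x < 1 -> `|flat p x| <= C * x ^+ 2.
Proof.
pose n := size p; pose C0 : R := \sum_(i < n) `|p`_i|.
have C00 : 0 <= C0 by rewrite sumr_ge0.
have [K K0 EK] : exists2 K : R, 0 < K & n.+2%:R ^+ n.+2 = K.
  by exists (n.+2%:R ^+ n.+2); rewrite ?exprn_gt0.
exists (C0 * K) => x x1; rewrite /flat; case: ifPn => x0; last first.
  by rewrite normr0 mulr_ge0 ?sqr_ge0// mulr_ge0 ?(ltW K0).
have y1 : 1 <= x^-1 by rewrite invf_ge1// ltW.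
have y0 : 0 <= x^-1 by rewrite (le_trans _ y1).
have b1 : `|p.[x^-1]| <= C0 * x^-1 ^+ n.
  rewrite horner_coef (le_trans (ler_norm_sum _ _ _))// /C0 mulr_suml.
  apply: ler_sum => i _; rewrite normrM ler_wpM2l// ger0_norm ?exprn_ge0//.
  by rewrite ler_weXn2l// ltnW.
rewrite normrM (ger0_norm (expR_ge0 _)) expRN ler_pdivrMr ?expR_gt0//.
rewrite (le_trans b1)// -!mulrA ler_wpM2l//.
(* Of the [n + 2] powers of [1/x] supplied by the exponential, [n] match the polynomial and two give
   [x ^+ 2]. *)
have -> : x^-1 ^+ n = K * (x ^+ 2 * (x^-1 / n.+2%:R) ^+ n.+2).
  rewrite expr_div_n EK -[in x^-1 ^+ n.+2]addn2 exprD [x^-1 ^+ 2]exprVn.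
  by field; rewrite !gt_eqF.
by rewrite ler_wpM2l ?(ltW K0)// mulrA -expr2 ler_wpM2l ?sqr_ge0// expR_ge_pow.
Qed.

(** For [x > 0] the chain rule on [p(1/x) exp(-1/x)] gives the factor [x^-2 (p - p')(1/x)], again a
    polynomial in [1/x]. At 0 the quotient is [O(h)] by [flat_bound]. *)
Lemma is_derive_flat p x : is_derive x (1 : R) (flat p) (flat ('X^2 * (p - p^`())) x).
Proof.
have [x0|x0|x0] := ltgtP x 0.
- have E : {near x, cst 0 =1 flat p}.
    near=> y; rewrite /flat ifF//; apply/negbTE; rewrite -leNgt ltW//.
    by near: y; exact: lt_nbhsl.
  rewrite [X in is_derive _ _ _ X](_ : _ = 0); last by rewrite /flat ltNge (ltW x0).
  by apply: (@near_eq_is_derive _ _ _ (cst 0) _ _ _ _ E); exact: is_derive_cst.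
- have E : {near x, (fun y => p.[y^-1] * expR (- y^-1)) =1 flat p}.
    near=> y; rewrite /flat ifT//.
    by near: y; exact: lt_nbhsr.
  apply: (@near_eq_is_derive _ _ _ (fun y => p.[y^-1] * expR (- y^-1)) _ _ _ _ E).
  have hi : is_derive x (1 : R) (fun y => y^-1) (- x ^- 2).
    have := @is_deriveV _ id x 1 1 (lt0r_neq0 x0) (is_derive_id x 1).
    by rewrite /GRing.scale/= mulr1.
  have hp : is_derive x (1 : R) (fun y => p.[y^-1]) (p^`().[x^-1] * - x ^- 2).
    exact: (@is_derive1_comp _ (horner p) _ x _ _ (is_derive_poly p x^-1) hi).
  have he : is_derive x (1 : R) (fun y => expR (- y^-1)) (expR (- x^-1) * x ^- 2).
    have := @is_derive1_comp _ expR _ x _ _ (is_derive_expR (- x^-1)) (is_deriveN hi).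
    by rewrite opprK.
  apply: is_derive_eq.
  rewrite /flat x0 hornerM hornerXn hornerD hornerN /GRing.scale/= exprVn; ring.
- have [C HC] := flat_bound p; rewrite x0.
  rewrite [X in is_derive _ _ _ X](_ : _ = 0); last by rewrite /flat ltxx.
  have fl0 : flat p 0 = 0 by rewrite /flat ltxx.
  have L : (h^-1 *: (flat p (h *: 1 + 0) - flat p 0)) @[h --> 0^'] --> (0 : R).
    apply/cvgrPdist_le => e e0; near=> h.
    rewrite sub0r normrN fl0 subr0 addr0 /GRing.scale/= mulr1 normrM.
    have h0 : h != 0 by near: h; exact: nbhs_dnbhs_neq.
    have h1 : h < 1.
      by near: h; apply: nbhs_dnbhs; exact: lt_nbhsl.
    apply: (@le_trans _ _ (`|h^-1| * (`|C| * h ^+ 2))).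
      by rewrite ler_wpM2l// (le_trans (HC _ h1))// ler_wpM2r ?sqr_ge0// ler_norm.
    rewrite normfV -[h ^+ 2]ger0_norm ?sqr_ge0// normrX.
    rewrite (_ : _ * _ = `|C| * `|h|); last by field; rewrite normr_eq0.
    rewrite (@le_trans _ _ ((`|C| + 1) * `|h|))// ?ler_wpM2r ?lerDl//.
    rewrite mulrC -ler_pdivlMr ?ltr_wpDl//.
    near: h; apply: dnbhs0_le.
    by rewrite divr_gt0// ltr_wpDl.
  apply: DeriveDef; first by apply/cvg_ex; exists 0.
  exact: (cvg_lim _ L).
Unshelve. all: by end_near. Qed.

Lemma smooth_flat p : smooth (flat p).
Proof.
apply/smoothP => n; elim: n p => // n IH p.
by exists (flat ('X^2 * (p - p^`()))) => // x; exact: is_derive_flat.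
Qed.

End Smooth.

(** * Fundamental theorem of calculus and smooth primitives *)

Section Primitive.
Local Open Scope classical_set_scope.
Context {R : realType}.
Local Notation mu := (@lebesgue_measure R).
Implicit Types (l r m c d x y : R) (f g F G phi psi : R -> R).

Lemma cont_rL2 l r f : continuous f -> rL2 l r f.
Proof. by move=> cf; apply: rL2_cont; exact: continuous_subspaceT. Qed.

Lemma smooth_rL2 l r f : smooth f -> rL2 l r f.
Proof. by move=> sf; apply: cont_rL2; exact: smooth_cont. Qed.

Lemma derivable_AC l r F f : (forall x, l <= x <= r -> is_derive x (1 : R) F (f x)) ->
  {within `[l, r], continuous f} -> AC l r F f.
Proof.
move=> dF cf; split; first exact: rL2_cont.
move=> x /andP[]; rewrite le_eqVlt => /orP[/eqP<- _|lx xr].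
  by rewrite [X in _ + X](_ : _ = 0) ?addr0// /rint set_itvoo0 Rintegral_set0.
have dF' y : l <= y <= r -> derivable F y 1 by move=> /dF ylr; exact: ex_derive.
have cF y : l <= y <= r -> {for y, continuous F}.
  by move=> ylr; apply: differentiable_continuous; apply/derivable1_diffP; exact: dF'.
have sub : `[l, x] `<=` `[l, r].
  by move=> y /=; rewrite !in_itv/= => /andP[-> /le_trans]; apply.
have cf' : {within `[l, x], continuous f} by apply: continuous_subspaceW cf.
have /(congr1 fine) : (\int[mu]_(t in `[l, x]) (f t)%:E = (F x)%:E - (F l)%:E)%E.
  apply: continuous_FTC2 => //.
  - split; first by move=> t; rewrite in_itv/= => /andP[lt tx]; apply: dF'; lra.
    + by apply: cvg_at_right_filter; apply: cF; lra.
    + by apply: cvg_at_left_filter; apply: cF; lra.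
  - move=> t; rewrite in_itv/= => /andP[lt tx]; rewrite derive1E.
    have tlr : l <= t <= r by lra.
    exact: (@derive_val _ _ _ _ _ _ _ (dF t tlr)).
rewrite -EFinB /= => E; rewrite /rint.
have If : mu.-integrable `[l, x] (EFin \o f).
  by apply: continuous_compact_integrable => //; exact: segment_compact.
rewrite Rintegral_itv_bndo_bndc; last first.
  by apply: integrableS If => //; exact: subset_itv_oo_cc.
rewrite Rintegral_itv_obnd_cbnd; last first.
  by apply: integrableS If => //; exact: subset_itv_oc_cc.
by rewrite /Rintegral E addrC subrK.
Qed.

Lemma smooth_AC l r f : smooth f -> AC l r f (f^`()).
Proof.
move=> sf; apply: derivable_AC; first by move=> x _; exact: smooth_is_derive.
by apply: continuous_subspaceT; exact/smooth_cont/smooth_derive.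
Qed.

Lemma rint_empty l r f : r <= l -> rint l r f = 0.
Proof. by move=> rl; rewrite /rint set_itv_ge ?Rintegral_set0// bnd_simp -leNgt. Qed.

Lemma eq0_rint l r f : (forall x, l < x < r -> f x = 0) -> rint l r f = 0.
Proof.
move=> f0; have [lr|rl] := leP l r; last by rewrite rint_empty// ltW.
by rewrite (eq_rint f0) rint_cst// mul0r.
Qed.

Lemma is_derive_prim A f : continuous f -> (forall x, x <= A -> f x = 0) ->
  forall x, is_derive x (1 : R) (fun y => rint A y f) (f x).
Proof.
move=> cf fA x; have [xA|Ax] := ltP x A.
  apply: (@near_eq_is_derive _ _ _ (cst 0)); last by rewrite (fA x (ltW xA)); exact: is_derive_cst.
  near=> y; rewrite rint_empty//; near: y; exact: lt_le_nbhsl.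
(* The fundamental theorem needs [x] strictly to the right of the base point. Since [f] vanishes up
   to [A], integrating from [A - 1] changes nothing and covers [x = A]. *)
have Ax1 : A - 1 < x by rewrite ltrBlDr (le_lt_trans Ax)// ltrDl.
have Iy y : mu.-integrable `]A - 1, y] (EFin \o f).
  apply: (@integrableS _ _ _ mu `[A - 1, y]%classic) => //; first exact: subset_itv_oc_cc.
  apply: continuous_compact_integrable; first exact: segment_compact.
  exact: continuous_subspaceT.
have [||||dF vF] := @continuous_FTC1 _ f (BRight (A - 1)) x (x + 1).
- by rewrite ltrDl.
- exact: Iy.
- exact: Ax1.
- exact: cf.
apply: (@near_eq_is_derive _ _ _ (fun y => \int[mu]_(t in [set` Interval (BRight (A - 1)) (BRight y)]) f t)).
  near=> y; rewrite -Rintegral_itv_bndo_bndc; last first.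
    by apply: integrableS (Iy y) => //; apply: subset_itv; rewrite bnd_simp.
  rewrite -/(rint _ _ _).
  have [Ay|yA] := leP A y.
    rewrite (@rint_split _ _ A) ?gerBl//; last exact/rL2_int/cont_rL2.
    by rewrite [X in X + _]eq0_rint ?add0r// => z /andP[_ /ltW]; exact: fA.
  rewrite [RHS]rint_empty ?ltW// eq0_rint// => z /andP[_ zy]; apply: fA.
  by rewrite ltW// (lt_trans zy).
by rewrite -vF derive1E; exact: DeriveDef.
Unshelve. all: by end_near. Qed.

Lemma smooth_prim A f : smooth f -> (forall x, x <= A -> f x = 0) ->
  smooth (fun y => rint A y f).
Proof.
move=> sf fA; apply: (is_derive_smooth _ sf); apply: is_derive_prim => //.
exact: (smooth_cont sf).
Qed.

End Primitive.

(** * A smooth transition from 0 to 1 *)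

Section SmoothStep.
Local Open Scope classical_set_scope.
Context {R : realType}.
Implicit Types (l r x y : R).

(** An unnormalised bump supported in [[0, 1]]; the second factor is the first one reflected at
    [1/2]. *)
Let rho x : R := flat 1 x * flat 1 (-1 * x + 1).

Let flat1 x : 0 < x -> flat 1 x = expR (- x^-1).
Proof. by move=> x0; rewrite /flat x0 hornerE mul1r. Qed.

Let flat1_ge0 x : 0 <= flat 1 x.
Proof. by rewrite /flat; case: ifP => // _; rewrite hornerE mul1r expR_ge0. Qed.

Let rho_ge0 x : 0 <= rho x. Proof. exact: mulr_ge0. Qed.

Let rho0 x : x <= 0 -> rho x = 0.
Proof. by move=> x0; rewrite /rho {1}/flat ltNge x0 mul0r. Qed.

Let rho1 x : 1 <= x -> rho x = 0.
Proof.
move=> x1; rewrite /rho [X in _ * X]/flat ifF ?mulr0//.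
by apply/negbTE; rewrite -leNgt; lra.
Qed.

Let smooth_rho : smooth rho.
Proof. by apply: smoothM; [exact: smooth_flat|apply: smooth_affine; exact: smooth_flat]. Qed.

Let Z := rint 0 1 rho.

Let Z_gt0 : 0 < Z.
Proof.
have Ir l r : rintegrable l r rho by exact/rL2_int/smooth_rL2.
(* Only the middle piece is estimated: on []1/4, 3/4[] both factors are at least [exp(-4)]. *)
have -> : Z = rint 0 (1/4) rho + (rint (1/4) (3/4) rho + rint (3/4) 1 rho).
  by rewrite -!rint_split//; lra.
have h l r : 0 <= rint l r rho by apply: rint_ge0.
apply: ltr_wpDl => //; apply: ltr_pwDl => //.
apply: (@lt_le_trans _ _ (expR (- 4) * expR (- 4) * (3/4 - 1/4))).
  by rewrite !mulr_gt0 ?expR_gt0//; lra.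
rewrite -rint_cst; last by lra.
apply: le_rint => //; first exact: rintegrable_cst.
have e4 y : 1/4 < y -> expR (-4) <= flat 1 y.
  move=> y4; have y0 : 0 < y by lra.
  rewrite flat1// ler_expR lerN2 -[leRHS]invrK lef_pV2 ?posrE ?invr_gt0//; lra.
move=> x /andP[x1 x3]; apply: ler_pM; rewrite ?expR_ge0//.
  exact: e4.
by apply: e4; lra.
Qed.

Definition smooth_step x : R := Z^-1 * rint 0 x rho.

Lemma smooth_smooth_step : smooth smooth_step.
Proof. by apply: smoothZ; exact: smooth_prim. Qed.

Lemma smooth_step0 x : x <= 0 -> smooth_step x = 0.
Proof. by move=> x0; rewrite /smooth_step rint_empty// mulr0. Qed.

Lemma smooth_step1 x : 1 <= x -> smooth_step x = 1.
Proof.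
move=> x1; rewrite /smooth_step (@rint_split _ _ 1)//; last exact/rL2_int/smooth_rL2.
rewrite [X in _ + X]eq0_rint ?addr0 ?mulVf ?gt_eqF//.
by move=> y /andP[/ltW y1 _]; exact: rho1.
Qed.

Lemma smooth_step_ge0 x : 0 <= smooth_step x.
Proof. by rewrite mulr_ge0 ?invr_ge0 ?(ltW Z_gt0)// rint_ge0. Qed.

Lemma smooth_step_le1 x : smooth_step x <= 1.
Proof.
have [x1|x1] := leP 1 x; first by rewrite smooth_step1.
have [x0|x0] := leP x 0; first by rewrite smooth_step0.
rewrite /smooth_step ler_pdivrMl ?Z_gt0// mulr1 /Z.
rewrite (@rint_split _ 0 x 1 rho) ?(ltW x0) ?(ltW x1)//; last exact/rL2_int/smooth_rL2.
by rewrite lerDl rint_ge0.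
Qed.

End SmoothStep.

(** * Test functions *)

Section TestFunctions.
Local Open Scope classical_set_scope.
Context {R : realType}.
Implicit Types (l r m c d x y : R) (f g F G phi psi : R -> R).

Lemma test_smooth l r phi : test_function l r phi -> smooth phi.
Proof. by case. Qed.

Lemma test_sub l r l' r' phi : l' <= l -> r <= r' ->
  test_function l r phi -> test_function l' r' phi.
Proof.
move=> ll rr [sphi [c [d [lc dr h]]]]; split => //; exists c, d; split => //.
  exact: le_lt_trans lc.
exact: lt_le_trans rr.
Qed.

Lemma testZ l r c phi : test_function l r phi -> test_function l r (fun x => c * phi x).
Proof.
move=> [sphi [c' [d [lc dr h]]]]; split; first exact: smoothZ.
by exists c', d; split => // x /h ->; rewrite mulr0.
Qed.

Lemma testD l r phi psi : test_function l r phi -> test_function l r psi ->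
  test_function l r (fun x => phi x + psi x).
Proof.
move=> [s1 [c1 [d1 [lc1 dr1 h1]]]] [s2 [c2 [d2 [lc2 dr2 h2]]]]; split; first exact: smoothD.
exists (Num.min c1 c2), (Num.max d1 d2); split.
- by rewrite lt_min lc1.
- by rewrite gt_max dr1.
- move=> x; rewrite in_itv/= ge_min le_max !negb_and !negb_or => h.
  by rewrite h1 ?h2 ?addr0// in_itv/= negb_and; case/orP: h => /andP[h3 h4]; rewrite ?h3 ?h4 ?orbT.
Qed.

Lemma testB l r phi psi : test_function l r phi -> test_function l r psi ->
  test_function l r (fun x => phi x - psi x).
Proof.
move=> h1 h2; have := testD h1 (testZ (-1) h2).
by under eq_fun do rewrite mulN1r.
Qed.

Lemma test_derive l r phi : test_function l r phi -> test_function l r (phi^`()).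
Proof.
move=> [sphi [c [d [lc dr h]]]]; split; first exact: smooth_derive.
exists c, d; split => // x; rewrite in_itv/= negb_and -!ltNge => xcd.
have E : \forall y \near x, (fun=> 0 : R) y = phi y.
  case/orP: xcd => [xc|xd]; near=> y; rewrite h// in_itv/= negb_and -!ltNge.
    by apply/orP; left; near: y; exact: lt_nbhsl.
  by apply/orP; right; near: y; exact: lt_nbhsr.
have D : is_derive x (1 : R) phi 0.
  by apply: (near_eq_is_derive E); exact: is_derive_cst.
by rewrite derive1E; apply: derive_val.
Unshelve. all: by end_near. Qed.

Lemma test_derive1n l r n phi : test_function l r phi -> test_function l r (phi^`(n))%classic.
Proof.
by move=> h; elim: n => [|n IH]; rewrite ?derive1n0// derive1nS; exact: test_derive.
Qed.

Lemma test_le l r x phi : test_function l r phi -> x <= l -> phi x = 0.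
Proof.
move=> [_ [c [d [lc dr h]]]] xl; apply: h.
by rewrite in_itv/= negb_and -ltNge (le_lt_trans xl lc).
Qed.

Lemma test_ge l r x phi : test_function l r phi -> r <= x -> phi x = 0.
Proof.
move=> [_ [c [d [lc dr h]]]] rx; apply: h.
by rewrite in_itv/= negb_and -!ltNge (lt_le_trans dr rx) orbT.
Qed.

Lemma test_rL2 l r l' r' phi : test_function l r phi -> rL2 l' r' phi.
Proof. by move=> /test_smooth; exact: smooth_rL2. Qed.

(** A difference of two smooth steps of growing slope. The limit is 0 at [c] and 1 at [d] because
    [smooth_step] vanishes at 0, which is why the interval is half-open. *)
Lemma test_indicator l r c d : l < c -> c <= d -> d < r ->
  exists chi : nat -> R -> R, [/\ forall n, test_function l r (chi n),
    forall n x, `|chi n x| <= 1 &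
    forall x, \forall n \near \oo, chi n x = (c < x <= d)%R%:R].
Proof.
(* The summand [(r - d)^-1] makes the transition at [d], of width [(k n)^-1], end before [r]. *)
move=> lc cd dr; pose k n : R := (r - d)^-1 + n%:R + 1.
have k0 n : 0 < k n by rewrite /k ltr_wpDl// addr_ge0// invr_ge0 subr_ge0 ltW.
exists (fun n x => smooth_step (k n * x + - (k n * c)) - smooth_step (k n * x + - (k n * d))).
split.
- move=> n; split.
    by apply: smoothB; apply: smooth_affine; exact: smooth_smooth_step.
  exists c, (d + (k n)^-1); split => //.
    rewrite -ltrBrDl -[ltRHS]invrK ltf_pV2 ?posrE ?invr_gt0 ?subr_gt0//.
    by rewrite /k -addrA ltrDl ltr_wpDl.
  move=> x; rewrite in_itv/= negb_and -!ltNge => /orP[xc|xd].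
    rewrite !smooth_step0 ?subrr// -mulrBr pmulr_rle0// subr_le0 ltW//.
    exact: lt_le_trans cd.
  have : 1 <= k n * (x - d) by rewrite -ler_pdivrMl// mulr1 lerBrDl ltW.
  rewrite mulrBr => h; rewrite !smooth_step1 ?subrr//.
  by rewrite (le_trans h)// lerD2l lerN2 ler_pM2l.
- move=> n x; have := smooth_step_le1 (k n * x + - (k n * c)).
  have := smooth_step_ge0 (k n * x + - (k n * c)).
  have := smooth_step_le1 (k n * x + - (k n * d)).
  have := smooth_step_ge0 (k n * x + - (k n * d)).
  by rewrite ler_norml; lra.
- have ev y : \forall n \near \oo, smooth_step (k n * y) = (0 < y)%R%:R.
    have [y0|y0] := leP y 0.
      by near=> n; rewrite smooth_step0// mulrC mulr_le0_ge0// ltW.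
    near=> n; rewrite smooth_step1// -ler_pdivrMr// div1r.
    apply: (@le_trans _ _ n%:R).
      by near: n; exact: nbhs_infty_ger.
    by rewrite /k -addrA addrC -addrA lerDl addr_ge0// invr_ge0 subr_ge0 ltW.
  move=> x; near=> n; rewrite -!(mulrBr (k n)).
  rewrite (_ : smooth_step (k n * (x - c)) = (0 < x - c)%R%:R); last by near: n; exact: ev.
  rewrite (_ : smooth_step (k n * (x - d)) = (0 < x - d)%R%:R); last by near: n; exact: ev.
  rewrite !subr_gt0; case: ltP => xc; case: ltP => xd /=; rewrite ?subrr ?subr0//.
  by move: (le_lt_trans (le_trans xc cd) xd); rewrite ltxx.
Unshelve. all: by end_near. Qed.

End TestFunctions.

(** * The fundamental lemma of the calculus of variations and the du Bois-Reymond lemma *)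

Section DuBoisReymond.
Local Open Scope classical_set_scope.
Context {R : realType}.
Local Notation mu := (@lebesgue_measure R).
Implicit Types (l r m c d x y : R) (f g F G phi psi : R -> R).

Lemma rint_dominated l r (fn : nat -> R -> R) f g :
  (forall n, measurable_fun `]l, r[ (fn n)) -> measurable_fun `]l, r[ f ->
  (forall x, l < x < r -> fn n x @[n --> \oo] --> f x) ->
  rintegrable l r g -> (forall n x, l < x < r -> `|fn n x| <= g x) ->
  rintegrable l r f /\ rint l r (fn n) @[n --> \oo] --> rint l r f.
Proof.
move=> mfn mf fnf ig fng.
have [] := @dominated_convergence _ _ _ mu `]l, r[%classic (measurable_itv _)
  (fun n x => (fn n x)%:E) (EFin \o f) (EFin \o g).
- by move=> n; apply/measurable_EFinP; exact: mfn.
- exact/measurable_EFinP.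
- apply: aeW => x /=; rewrite in_itv/= => /fnf h; by apply: cvg_EFin => //; exact: nearW.
- exact: ig.
- by apply: aeW => x n /=; rewrite in_itv/= => /fng h; rewrite lee_fin.
move=> h1 _ h3; split => //.
apply: fine_cvg; rewrite fineK//; exact: integrable_fin_num h1.
Qed.

Lemma ae_exists l r (P : R -> Prop) : l < r ->
  {ae mu, forall x, `]l, r[%classic x -> P x} -> exists2 x, l < x < r & P x.
Proof.
move=> lr [N [mN N0 sN]]; apply: contrapT => h.
have sN' : `]l, r[%classic `<=` N.
  move=> x /= xlr; apply: sN => /= /(_ xlr) Px; apply: h; exists x => //.
have h1 : mu `]l, r[%classic = 0.
  by apply: measure_negligible => //; exists N.
have h2 : mu `]l, r[%classic = (r - l)%:E by rewrite lebesgue_measure_itv/= lte_fin lr.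
by move: h1; rewrite h2 => -[] /eqP; rewrite subr_eq0 gt_eqF.
Qed.

(** If the functions differed at a point they would differ on a nondegenerate interval near it,
    which is not a null set. *)
Lemma cont_aeq_eq l r F G : l < r -> {within `[l, r], continuous F} ->
  {within `[l, r], continuous G} -> aeq l r F G ->
  forall x, l <= x <= r -> F x = G x.
Proof.
move=> lr cF cG FG x /andP[lx xr]; apply: contrapT => /eqP.
rewrite -subr_eq0 -normr_gt0 => D0.
have xlr : `[l, r]%classic x by rewrite /= in_itv/= lx.
have cH : {within `[l, r], continuous (fun x => F x - G x)}.
  by move=> z; apply: cvgB; [exact: cF|exact: cG].
have /cvgrPdist_lt/(_ _ D0) := (subspace_continuousP _ _).1 cH x xlr.
rewrite near_withinE => /nbhs_ballP[e /= e0 He].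
have lr' : Num.max l (x - e) < Num.min r (x + e).
  by rewrite lt_min !gt_max; apply/andP; split; apply/andP; split; lra.
have FG' : aeq (Num.max l (x - e)) (Num.min r (x + e)) F G.
  by apply: aeq_sub FG; rewrite ?le_max ?ge_min lexx.
have [y] := ae_exists lr' FG'.
rewrite lt_min !gt_max => /andP[/andP[ly ey] /andP[yr ye]] E.
have /He : ball x e y by rewrite /ball/= ltr_norml; apply/andP; split; lra.
by rewrite /from_subspace/= in_itv/= (ltW ly) (ltW yr) E subrr subr0 ltxx => /(_ isT).
Qed.

(** Testing with approximate indicators shows that [F] has zero integral over every interval with
    closure in []l, r[]; Lebesgue differentiation then recovers [F] almost everywhere. *)
Lemma fundamental_lemma l r F : rintegrable l r F ->
  (forall phi, test_function l r phi -> rint l r (fun x => F x * phi x) = 0) ->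
  aeq l r F (fun=> 0).
Proof.
move=> hF F0.
have mF := rintegrable_meas hF.
have I0 c d : l < c -> c <= d -> d < r -> rint c d F = 0.
  move=> lc cd dr; have [chi [tchi chi1 chic]] := test_indicator lc cd dr.
  have [|||||hI cvI] := @rint_dominated l r (fun n x => F x * chi n x)
    (fun x => F x * (c < x <= d)%R%:R) (fun x => `|F x|).
  - move=> n; apply: measurable_funM => //; exact: rL2_meas (test_rL2 _ _ (tchi n)).
  - apply: measurable_funM => //.
    rewrite (_ : (fun x => _) = \1_`]c, d]); first exact: measurable_indic.
    by apply/funext => x; rewrite indicE mem_setE in_itv.
  - move=> x _; apply: cvg_near_cst; near=> n; congr (_ * _); near: n; exact: chic.
  - exact: integrable_norm.
  - by move=> n x _; rewrite normrM ler_piMr.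
  have lr : l < r by lra.
  have : rint l r (fun x => F x * (c < x <= d)%R%:R) = 0.
    apply: cvg_unique cvI _ => //; apply: cvg_near_cst; near=> n.
    by apply: F0; exact: tchi.
  rewrite (@rint_split _ l c r)//; [|lra|lra].
  rewrite (@rint_split _ c d r)//; [|lra|]; last first.
    by apply: rintegrable_sub hI => //; lra.
  rewrite eq0_rint; last first.
    by move=> x /andP[_ xc]; rewrite ltNge (ltW xc)/= mulr0.
  rewrite [X in _ + (_ + X)]eq0_rint; last first.
    by move=> x /andP[xc _]; rewrite [x <= d]leNgt xc andbF mulr0.
  rewrite add0r addr0 => <-; apply: eq_rint => x /andP[-> /ltW ->].
  by rewrite mulr1.
(* The primitive of the extension by zero is locally constant inside []l, r[], while its derivative
   is [F] at almost every point. *)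
have hg := rintegrable_patch hF.
have hI y : mu.-integrable `]-oo, y] (EFin \o (F \_ `]l, r[)).
  by apply: integrableS hg.
have := FTC1Ny hI (open_integrable_locally openT hg).
apply: filterS.
move=> x [_ dx]; rewrite /= in_itv/= => /andP[lx xr].
have -> : F x = (F \_ `]l, r[) x by rewrite patchE mem_setE in_itv/= lx xr.
rewrite -dx derive1E; apply: derive_val.
pose P y := \int[mu]_(t in `]-oo, y]) (F \_ `]l, r[) t.
have E : \forall y \near x, (fun=> P x : R) y = P y.
  have Py c y : l < c -> c <= y -> y < r -> P c = P y.
    move=> lc cy yr; have H : P y - P c = \int[mu]_(t in `]c, y]) (F \_ `]l, r[) t.
      by apply: (@Rintegral_itvB _ (F \_ `]l, r[) -oo%O (BRight y) c (hI y)); rewrite ?bnd_simp.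
    apply/eqP; rewrite eq_sym -subr_eq0 H -Rintegral_itv_bndo_bndc; last first.
      exact: integrableS hg.
    rewrite -/(rint _ _ _) -(I0 c y lc cy yr); apply/eqP; apply: eq_rint => z /andP[cz zy].
    by rewrite patchE mem_setE in_itv/= (lt_trans lc cz) (lt_trans zy yr).
  near=> y; have [xy|/ltW yx] := leP x y.
    by apply: Py => //; near: y; exact: lt_nbhsl.
  by apply/esym/Py => //; near: y; exact: lt_nbhsr.
by apply: (near_eq_is_derive E); exact: is_derive_cst.
Unshelve. all: by end_near. Qed.

(** The zero mean makes the primitive vanish again to the right of the support of [psi]. *)
Lemma test_prim l r psi : l < r -> test_function l r psi -> rint l r psi = 0 ->
  test_function l r (fun y => rint l y psi) /\ (fun y => rint l y psi)^`() = psi.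
Proof.
move=> lr tpsi I0; have spsi := test_smooth tpsi.
have h x : x <= l -> psi x = 0 by exact: test_le tpsi.
split; last first.
  by apply: is_derive_derive1; apply: is_derive_prim => //; exact: smooth_cont.
split; first exact: smooth_prim.
case: tpsi => _ [c [d [lc dr cd]]]; exists c, d; split => // x.
rewrite in_itv/= negb_and -!ltNge => /orP[xc|dx].
  by apply: eq0_rint => y /andP[_ yx]; apply: cd; rewrite in_itv/= negb_and -ltNge (lt_trans yx xc).
have [xl|lx] := leP x l; first by rewrite rint_empty.
have It y z : rintegrable y z psi by exact/rL2_int/smooth_rL2.
have Z y z : d <= y -> rint y z psi = 0.
  move=> dy; apply: eq0_rint => t /andP[yt _]; apply: cd.
  by rewrite in_itv/= negb_and -!ltNge (le_lt_trans dy yt) orbT.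
have [xr|rx] := leP x r.
  by move: I0; rewrite (@rint_split _ l x r) ?(ltW lx)// (Z x) ?(ltW dx)// addr0.
by rewrite (@rint_split _ l r x) ?(ltW lr) ?(ltW rx)// I0 add0r Z// ltW.
Qed.

Lemma du_bois_reymond l r F : l < r -> rL2 l r F ->
  (forall phi, test_function l r phi -> rint l r (fun x => F x * derive1 phi x) = 0) ->
  exists c, aeq l r F (fun=> c).
Proof.
move=> lr hF F0.
(* If all test functions had zero integral, the fundamental lemma would give [1 = 0] almost
   everywhere. *)
have [psi0 [tpsi0 I0]] : exists psi0, test_function l r psi0 /\ rint l r psi0 <> 0.
  apply: contrapT => h.
  have := @fundamental_lemma l r (fun=> 1) (rintegrable_cst _ _ _).
  have h1 phi : test_function l r phi -> rint l r (fun x => 1 * phi x) = 0.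
    move=> tphi; rewrite (eq_rint (g := phi)) => [|x _]; last by rewrite mul1r.
    by apply: contrapT => h2; apply: h; exists phi.
  move=> /(_ h1)/(ae_exists lr)[x _ /eqP]; by rewrite oner_eq0.
have ts phi : test_function l r phi -> rL2 l r phi by exact: test_rL2.
have {}I0 : rint l r psi0 != 0 by exact/eqP.
pose eta x := (rint l r psi0)^-1 * psi0 x.
have teta : test_function l r eta by exact: testZ.
have Ieta : rint l r eta = 1 by rewrite rintZ ?mulVf//; exact/rL2_int/ts.
exists (rint l r (fun x => F x * eta x)); set c := rint _ _ _.
have hFc : rL2 l r (fun x => F x - c) by apply: rL2B => //; exact: rL2_cst.
have : aeq l r (fun x => F x - c) (fun=> 0).
  apply: fundamental_lemma; first exact: rL2_int.
  move=> psi tpsi; have hpsi := ts _ tpsi; have heta := ts _ teta.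
  pose J := rint l r psi.
  (* Subtracting [J * eta] removes the mean of [psi], so what remains is the derivative of a test
     function and [F] is orthogonal to it. *)
  have tP : test_function l r (fun x => psi x - J * eta x).
    by apply: testB => //; exact: testZ.
  have [] := test_prim lr tP.
    rewrite rintB; [|exact: rL2_int|exact/rL2_int/rL2Z].
    by rewrite rintZ ?Ieta ?mulr1 ?subrr//; exact: rL2_int.
  move=> /F0 + E; rewrite E => F0'.
  transitivity (rint l r (fun x => F x * psi x) - c * J).
    rewrite /J -rintZ; last exact: rL2_int.
    rewrite -rintB; [|exact: rL2_mul|exact/rintegrableZ/rL2_int].
    by apply: eq_rint => x _; ring.
  rewrite mulrC -F0'; transitivity (rint l r (fun x => F x * psi x - J * (F x * eta x))).
    rewrite rintB; [|exact: rL2_mul|exact/rintegrableZ/rL2_mul].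
    by rewrite rintZ//; exact: rL2_mul.
  by apply: eq_rint => x _; ring.
by apply: aeq_imp => x _ /eqP; rewrite subr_eq0 => /eqP.
Qed.

Lemma AC_weak l r F f phi : l <= r -> AC l r F f -> test_function l r phi ->
  rint l r (fun x => F x * derive1 phi x) = - rint l r (fun x => f x * phi x).
Proof.
move=> lr hF tphi.
rewrite (AC_ibp lr hF (smooth_AC l r (test_smooth tphi))).
by rewrite (test_le tphi (lexx l)) (test_ge tphi (lexx r)) !mulr0 subrr sub0r opprK.
Qed.

(** The difference of [f] and a primitive of [g] has zero weak derivative, hence is constant. *)
Lemma weak_AC l r f g : l < r -> rL2 l r f -> rL2 l r g ->
  (forall phi, test_function l r phi ->
     rint l r (fun x => f x * derive1 phi x) = - rint l r (fun x => g x * phi x)) ->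
  exists2 F, AC l r F g & aeq l r f F.
Proof.
move=> lr hf hg fg.
have hG := AC_prim 0 hg; have hG2 := AC_rL2 (ltW lr) hG.
have [|phi tphi|c fc] := @du_bois_reymond l r (fun x => f x - (0 + rint l x g)) lr.
- exact: rL2B.
- have hphi : rL2 l r (phi^`()) by apply: test_rL2; exact: test_derive tphi.
  transitivity (rint l r (fun x => f x * derive1 phi x) -
                rint l r (fun x => (0 + rint l x g) * derive1 phi x)).
    rewrite -rintB; [|exact: rL2_mul|exact: rL2_mul].
    by apply: eq_rint => x _; ring.
  by rewrite fg// (AC_weak (ltW lr) hG tphi) subrr.
exists (fun x => c + rint l x g); first exact: AC_prim.
by apply: aeq_imp fc => x _ <-; rewrite add0r subrK.
Qed.

Lemma AC_uniq l r F f g : l <= r -> AC l r F f -> AC l r F g -> aeq l r f g.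
Proof.
move=> lr hf hg.
have : aeq l r (fun x => f x - g x) (fun=> 0).
  apply: fundamental_lemma; first by apply: rL2_int; exact: rL2B hf.1 hg.1.
  move=> phi tphi; have hphi := test_rL2 l r tphi.
  transitivity (rint l r (fun x => f x * phi x) - rint l r (fun x => g x * phi x)).
    rewrite -rintB; [|exact: rL2_mul hf.1 hphi|exact: rL2_mul hg.1 hphi].
    by apply: eq_rint => x _; ring.
  have := AC_weak lr hf tphi; rewrite (AC_weak lr hg tphi) => /oppr_inj ->.
  by rewrite subrr.
by apply: aeq_imp => x _ /eqP; rewrite subr_eq0 => /eqP.
Qed.

Lemma AC_eq l r F G f : (forall x, l <= x <= r -> F x = G x) -> AC l r F f -> AC l r G f.
Proof.
move=> FG [hf hF]; split => // x xlr; rewrite -(FG x) // -(FG l) ?(hF x)//.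
by case/andP: xlr => lx xr; rewrite lexx (le_trans lx).
Qed.

Lemma AC_aeq l r F f g : rL2 l r g -> aeq l r f g -> AC l r F f -> AC l r F g.
Proof.
move=> hg fg [hf hF]; split => // x xlr; rewrite hF//; congr (_ + _).
case/andP: xlr => lx xr; apply: aeq_rint.
- exact: rL2_meas (rL2_sub (lexx l) xr hf).
- exact: rL2_meas (rL2_sub (lexx l) xr hg).
- exact: aeq_sub fg.
Qed.

End DuBoisReymond.

(** * Poincare inequalities with sharp constants, the trace bound and integration by parts across
    [xi] *)

Section Poincare.
Local Open Scope classical_set_scope.
Context {R : realType}.
Implicit Types (l r m c d x y : R) (f g F G : R -> R).

(** The derivative of the product stays in [L^2] because the continuous factors are bounded on
    [[l, r]]; the integral formula is [AC_ibp] on [[l, x]]. *)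
Lemma ACM l r F f G g : AC l r F f -> AC l r G g ->
  AC l r (fun x => F x * G x) (fun x => f x * G x + F x * g x).
Proof.
move=> hF hG.
have [rl|lr] := ltP r l.
  have e (h : R -> R) : rL2 l r h.
    apply: (@eq_rL2 _ _ _ (fun=> 0)); last exact: rL2_cst.
    by move=> x /andP[h1 h2]; move: (lt_trans h1 h2); rewrite ltNge (ltW rl).
  split => // x /andP[h1 h2]; move: (le_trans h1 h2).
  by rewrite leNgt rl.
have cF := AC_cont lr hF; have cG := AC_cont lr hG.
have bd (H : R -> R) h : {within `[l, r], continuous H} -> rL2 l r h ->
    rL2 l r (fun x => H x * h x).
  move=> cH [mh hh].
  have cH2 : {within `[l, r], continuous (fun x => H x ^+ 2)}.
    by move=> x; apply: cvgM; exact: cH.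
  have mH := rL2_meas (rL2_cont cH).
  split; first exact: measurable_funM.
  have [M _ HM] : exists2 M, 0 <= M & forall x, l < x < r -> H x ^+ 2 <= M.
    have [c clr HM] := EVT_max lr cH2; exists (H c ^+ 2); first exact: sqr_ge0.
    by move=> x /andP[/ltW lx /ltW xr]; apply: HM; rewrite in_itv/= lx.
  apply: (rintegrable_le _ _ (rintegrableZ M hh)).
    by apply: measurable_funX; exact: measurable_funM.
  move=> x xlr; rewrite ger0_norm ?sqr_ge0// exprMn ler_wpM2r ?sqr_ge0//.
  exact: HM.
have h1 : rL2 l r (fun x => f x * G x).
  apply: (@eq_rL2 _ _ _ (fun x => G x * f x)); first by move=> x _; rewrite mulrC.
  exact: bd hF.1.
have h2 : rL2 l r (fun x => F x * g x) by exact: bd hG.1.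
split; first exact: rL2D.
move=> x /andP[lx xr]; rewrite rintD; last 2 first.
- by apply: rintegrable_sub (rL2_int h1).
- by apply: rintegrable_sub (rL2_int h2).
rewrite (AC_ibp lx (AC_sub (lexx l) xr hF) (AC_sub (lexx l) xr hG)); ring.
Qed.

(* Integrate [(u' + lam * tan s * u) ^+ 2 >= 0], the cross term by parts. *)
Lemma wirtinger_lt (lam : R) u0 u1 : 0 < lam -> lam < pi -> AC 0 1 u0 u1 ->
  u0 0 = 0 -> u0 1 = 0 ->
  lam ^+ 2 * rint 0 1 (fun x => u0 x ^+ 2) <= rint 0 1 (fun x => u1 x ^+ 2).
Proof.
move=> l0 lpi hu u00 u01.
(* This maps [[0, 1]] onto [[-lam/2, lam/2]], inside the domain of [tan] as [lam < pi]. *)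
pose s x := lam * x - lam / 2.
pose W x : R := tan (s x).
pose W' x : R := lam * (1 + W x ^+ 2).
have cs x : 0 <= x <= 1 -> cos (s x) != 0.
  move=> /andP[x0 x1]; rewrite gt_eqF// cos_gt0_pihalf// /s.
  have := ler_pM2l l0 x 1; have := ler_pM2l l0 0 x; rewrite x0 x1 mulr0 mulr1 => h1 h2.
  by apply/andP; split; lra.
have dW x : 0 <= x <= 1 -> is_derive x (1 : R) W (W' x).
  move=> x01; have ds : is_derive x (1 : R) s lam.
    by apply: is_derive_eq; rewrite /GRing.scale/= ?mulr0 ?mulr1 ?subr0 ?add0r ?addr0.
  have := @is_derive1_comp _ tan s x _ _ (is_derive_tan (cs x x01)) ds.
  by rewrite /W' -cos2_tan2 ?cs// mulrC.
have cW : {within `[0, 1], continuous W}.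
  apply: derivable_within_continuous => x; rewrite in_itv/= => x01.
  exact: @ex_derive _ _ _ _ _ _ _ (dW x x01).
have cW' : {within `[0, 1], continuous W'}.
  move=> x; apply: cvgM; first exact: cvg_cst.
  by apply: cvgD; [exact: cvg_cst|apply: cvgM; exact: cW].
have hW : AC 0 1 W W' by exact: derivable_AC.
have huu := ACM hu hu.
have h := AC_ibp ler01 huu hW; rewrite u00 u01 !mul0r subrr sub0r in h.
have r0 := AC_rL2 ler01 hu; have r1 := hu.1.
have rW0 : rL2 0 1 (fun x => W x * u0 x).
  by apply: rL2_cont => x; apply: cvgM; [exact: cW|exact: AC_cont hu _].
have : 0 <= rint 0 1 (fun x => (u1 x + lam * (W x * u0 x)) ^+ 2).
  by apply: rint_ge0 => x _; exact: sqr_ge0.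
have rr := rL2Z lam rW0.
rewrite (eq_rint (g := fun x => u1 x ^+ 2 +
  (lam * ((u1 x * u0 x + u0 x * u1 x) * W x) + lam ^+ 2 * (W x * u0 x) ^+ 2))); last first.
  by move=> x _; ring.
have i1 : rintegrable 0 1 (fun x => (u1 x * u0 x + u0 x * u1 x) * W x).
  apply: rL2_mul; [exact: huu.1|exact: AC_rL2 hW].
have i2 := rW0.2.
rewrite rintD; [|exact: r1.2|by apply: rintegrableD; exact: rintegrableZ].
rewrite rintD; [|exact: rintegrableZ|exact: rintegrableZ].
rewrite !rintZ// h.
(* As [W' = lam (1 + W^2)], the integrals of [(W u0)^2] cancel and only those of [u1^2] and
   [lam^2 u0^2] survive. *)
rewrite (_ : rint 0 1 (fun x => u0 x * u0 x * W' x) =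
  lam * rint 0 1 (fun x => u0 x ^+ 2) + lam * rint 0 1 (fun x => (W x * u0 x) ^+ 2)); last first.
  rewrite -!rintZ//; [|exact: r0.2].
  rewrite -rintD; [|by apply: rintegrableZ; exact: r0.2|exact: rintegrableZ].
  by apply: eq_rint => x _; rewrite /W'; ring.
by move=> ?; nra.
Qed.

(** The limit [lam -> pi] of [wirtinger_lt]: a failure at [pi] would persist slightly below it. *)
Lemma wirtinger u0 u1 : AC 0 1 u0 u1 -> u0 0 = 0 -> u0 1 = 0 ->
  pi ^+ 2 * rint 0 1 (fun x => u0 x ^+ 2) <= rint 0 1 (fun x => u1 x ^+ 2).
Proof.
move=> hu u00 u01.
set B := rint 0 1 (fun x => u0 x ^+ 2); set A := rint _ _ _.
have B0 : 0 <= B by apply: rint_ge0 => x _; exact: sqr_ge0.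
have A0 : 0 <= A by apply: rint_ge0 => x _; exact: sqr_ge0.
have pi0 := pi_gt0 R.
rewrite leNgt; apply/negP => AB.
have {}B0 : 0 < B.
  rewrite lt_def B0 andbT; apply/eqP => B00; move: AB; rewrite B00 mulr0 ltNge A0//.
(* The second bound makes the loss [2 pi e B] at most half of the gap [pi^2 B - A]; the first keeps
   [pi - e] positive. *)
pose e := Num.min (pi / 2) ((pi ^+ 2 * B - A) / (4 * pi * B)).
have e0 : 0 < e by rewrite lt_min !divr_gt0 ?subr_gt0// ?mulr_gt0.
have e1 : e <= pi / 2 by rewrite ge_min lexx.
have e2 : e * (4 * pi * B) <= pi ^+ 2 * B - A.
  by rewrite -ler_pdivlMr ?mulr_gt0// ge_min lexx orbT.
have := @wirtinger_lt (pi - e) u0 u1 _ _ hu u00 u01.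
rewrite -/A -/B => /(_ _ _) h.
have {}h : (pi - e) ^+ 2 * B <= A by apply: h; lra.
have : 0 <= e ^+ 2 * B by rewrite mulr_ge0 ?sqr_ge0 ?ltW.
by nra.
Qed.

(** [u1] has no boundary values, so [wirtinger] cannot be applied to it. Instead the integral of
    [(u'' + pi^2 u)^2] is expanded: the cross term is [- 2 pi^2] times that of [u'^2], and
    [wirtinger] for [u] bounds the last term by [pi^2] times that of [u'^2]. *)
Lemma poincare_mixed u0 u1 u2 : AC 0 1 u0 u1 -> AC 0 1 u1 u2 -> u0 0 = 0 -> u0 1 = 0 ->
  pi ^+ 2 * rint 0 1 (fun x => u1 x ^+ 2) <= rint 0 1 (fun x => u2 x ^+ 2).
Proof.
move=> hu hu1 u00 u01; have w := wirtinger hu u00 u01.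
have r0 := AC_rL2 ler01 hu; have r1 := hu.1; have r2 := hu1.1.
have h := AC_ibp ler01 hu1 hu; rewrite u00 u01 !mulr0 subrr sub0r in h.
have : 0 <= rint 0 1 (fun x => (u2 x + pi ^+ 2 * u0 x) ^+ 2).
  by apply: rint_ge0 => x _; exact: sqr_ge0.
rewrite (eq_rint (g := fun x => u2 x ^+ 2 +
  (2 * pi ^+ 2 * (u2 x * u0 x) + pi ^+ 4 * u0 x ^+ 2))); last by move=> x _; ring.
rewrite rintD; [|exact: r2.2|by apply: rintegrableD; apply: rintegrableZ; [exact: rL2_mul|exact: r0.2]].
rewrite rintD; [|apply: rintegrableZ; exact: rL2_mul|apply: rintegrableZ; exact: r0.2].
rewrite rintZ; last exact: rL2_mul.
rewrite rintZ; last exact: r0.2.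
rewrite h (eq_rint (g := fun x => u1 x ^+ 2) (f := fun x => u1 x * u1 x)); last first.
  by move=> x _; rewrite expr2.
set A := rint 0 1 _ in w *; set B := rint 0 1 (fun x => u1 x ^+ 2) in w *; set C := rint _ _ _.
have := ler_wpM2l (sqr_ge0 pi) w.
rewrite mulrA -exprD; lra.
Qed.

Lemma poincare u0 u1 u2 : AC 0 1 u0 u1 -> AC 0 1 u1 u2 -> u0 0 = 0 -> u0 1 = 0 ->
  pi ^+ 4 * rint 0 1 (fun x => u0 x ^+ 2) <= rint 0 1 (fun x => u2 x ^+ 2).
Proof.
move=> hu hu1 u00 u01; have w := wirtinger hu u00 u01.
have m := poincare_mixed hu hu1 u00 u01.
apply: le_trans m; have := ler_wpM2l (sqr_ge0 pi) w.
by rewrite mulrA -exprD.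
Qed.

(** [u(xi)] is the integral of [u'] over []0, xi[]; Cauchy-Schwarz and [poincare_mixed] give the
    rest. *)
Lemma trace_bound (xi : R) u0 u1 u2 : 0 < xi -> xi < 1 -> AC 0 1 u0 u1 -> AC 0 1 u1 u2 ->
  u0 0 = 0 -> u0 1 = 0 ->
  pi ^+ 2 * u0 xi ^+ 2 <= rint 0 1 (fun x => u2 x ^+ 2).
Proof.
move=> xi0 xi1 hu hu1 u00 u01.
apply: le_trans (poincare_mixed hu hu1 u00 u01).
rewrite ler_wpM2l ?sqr_ge0//.
have xi01 : 0 <= xi <= 1 by rewrite !ltW.
rewrite (hu.2 xi xi01) u00 add0r.
have r1 := hu.1.
have r1' : rL2 0 xi u1 by apply: rL2_sub r1 => //; exact: ltW.
have := rint_cauchy_schwarz r1' (@rL2_cst _ 0 xi 1).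
rewrite (eq_rint (g := u1)); last by move=> x _; rewrite mulr1.
move=> /le_trans; apply.
rewrite expr1n (rint_cst _ (ltW xi0)) mul1r subr0.
rewrite (@rint_split _ 0 xi 1 (fun x => u1 x ^+ 2)) ?(ltW xi0) ?(ltW xi1)//; last exact: r1.2.
have p1 : 0 <= rint 0 xi (fun x => u1 x ^+ 2) by apply: rint_ge0 => x _; exact: sqr_ge0.
have p2 : 0 <= rint xi 1 (fun x => u1 x ^+ 2) by apply: rint_ge0 => x _; exact: sqr_ge0.
by rewrite (le_trans (ler_piMr p1 (ltW xi1)))// lerDl.
Qed.

(** Two integrations by parts on each side of [xi]. The boundary terms at 0 and 1 vanish, those with
    [p1 xi] cancel by continuity of the second derivative, and those with [p0 xi] add up to the jump
    of the third. *)
Lemma beam_ibp (xi kappa : R) (y2 y3 y4 z2 z3 z4 p0 p1 p2 : R -> R) : 0 < xi -> xi < 1 ->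
  AC 0 xi y2 y3 -> AC 0 xi y3 y4 -> AC xi 1 z2 z3 -> AC xi 1 z3 z4 ->
  y2 0 = 0 -> z2 1 = 0 -> y2 xi = z2 xi -> z3 xi - y3 xi = - kappa ->
  AC 0 1 p0 p1 -> AC 0 1 p1 p2 -> p0 0 = 0 -> p0 1 = 0 ->
  rint 0 xi (fun x => y4 x * p0 x) + rint xi 1 (fun x => z4 x * p0 x) =
  kappa * p0 xi + (rint 0 xi (fun x => y2 x * p2 x) + rint xi 1 (fun x => z2 x * p2 x)).
Proof.
move=> xi0 xi1 hy2 hy3 hz2 hz3 y20 z21 yz jump hp0 hp1 p00 p01.
have [x0 x1] := (ltW xi0, ltW xi1).
have l0 : AC 0 xi p0 p1 by apply: AC_sub hp0.
have l1 : AC 0 xi p1 p2 by apply: AC_sub hp1.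
have r0 : AC xi 1 p0 p1 by apply: AC_sub hp0.
have r1 : AC xi 1 p1 p2 by apply: AC_sub hp1.
rewrite (AC_ibp x0 hy3 l0) (AC_ibp x0 hy2 l1) (AC_ibp x1 hz3 r0) (AC_ibp x1 hz2 r1).
rewrite p00 p01 y20 z21 yz !mulr0 !mul0r (_ : kappa = y3 xi - z3 xi); first by ring.
by rewrite -[LHS]opprK -jump opprB.
Qed.

End Poincare.

(** * Completeness of [L^2] and density of test functions *)

Section Completeness.
Local Open Scope classical_set_scope.
Context {R : realType}.
Local Notation mu := (@lebesgue_measure R).
Implicit Types (l r m c d x y : R) (f g F G phi psi : R -> R).

Lemma rint_sqDZ l r f g c : rL2 l r f -> rL2 l r g ->
  rint l r (fun x => (f x + c * g x) ^+ 2) =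
  rint l r (fun x => f x ^+ 2) + 2 * c * rint l r (fun x => f x * g x) +
  c ^+ 2 * rint l r (fun x => g x ^+ 2).
Proof.
move=> hf hg.
rewrite -(rintZ (2 * c) (rL2_mul hf hg)) -(rintZ (c ^+ 2) hg.2).
rewrite -rintD; [|exact: hf.2|exact/rintegrableZ/rL2_mul].
rewrite -rintD; [|by apply: rintegrableD; [exact: hf.2|exact/rintegrableZ/rL2_mul]
                 |exact: rintegrableZ hg.2].
by apply: eq_rint => x _; ring.
Qed.

Lemma le0_geometric (q M z : R) : 0 <= q -> q < 1 -> (forall n, z <= M * q ^+ n) -> z <= 0.
Proof.
move=> q0 q1 h; have : (M * q ^+ n) @[n --> \oo] --> M * 0.
  by apply: cvgM; [exact: cvg_cst|apply: cvg_expr; rewrite ger0_norm].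
rewrite mulr0 => cv; rewrite -(cvg_lim _ cv)//.
by apply: limr_ge; [apply/cvg_ex; exists 0|exact: nearW].
Qed.

Lemma telescope_le (s : nat -> R) c (n m : nat) : 0 <= c ->
  (forall k, `|s k.+1 - s k| <= c * 2^-1 ^+ k) -> (n <= m)%N ->
  `|s m - s n| <= 2 * c * 2^-1 ^+ n.
Proof.
move=> c0 h nm.
suff : `|s m - s n| <= 2 * c * 2^-1 ^+ n - 2 * c * 2^-1 ^+ m.
  by move=> /le_trans; apply; rewrite gerBl !mulr_ge0 ?exprn_ge0// invr_ge0.
elim: m nm => [|m IH]; first by rewrite leqn0 => /eqP ->; rewrite !subrr normr0.
rewrite leq_eqVlt => /orP[/eqP->|]; first by rewrite !subrr normr0.
rewrite ltnS => /IH {}IH.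
have -> : s m.+1 - s n = (s m.+1 - s m) + (s m - s n) by ring.
apply: (le_trans (ler_normD _ _)); apply: (le_trans (lerD (h m) IH)).
by rewrite exprS; lra.
Qed.

(* The series of [4 ^+ k * (f_(k+1) - f_k) ^+ 2] has a finite integral, so that [f_k] converges
   geometrically at almost every point. *)
Lemma rL2_complete l r (f : nat -> R -> R) (K : R) : l < r -> (forall n, rL2 l r (f n)) ->
  (forall n, rint l r (fun x => (f n.+1 x - f n x) ^+ 2) <= K * 16^-1 ^+ n) ->
  exists g, rL2 l r g /\
    exists C : R, forall n, rint l r (fun x => (f n x - g x) ^+ 2) <= C * 4^-1 ^+ n.
Proof.
move=> lr hf hK.
pose D : set R := `]l, r[; have mD : measurable D by exact: measurable_itv.
pose dk k x : R := 4 ^+ k * (f k.+1 x - f k x) ^+ 2.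
have dk0 k x : 0 <= dk k x by apply: mulr_ge0; [exact: exprn_ge0|exact: sqr_ge0].
have idk k : rintegrable l r (dk k).
  by apply: rintegrableZ; exact: (rL2B (hf k.+1) (hf k)).2.
have mdk k : measurable_fun D (fun x => (dk k x)%:E).
  by apply/measurable_EFinP; exact: rintegrable_meas.
pose H x := (\sum_(0 <= k <oo) (dk k x)%:E)%E.
have H0 x : (0 <= H x)%E by apply: nneseries_ge0 => k _; rewrite lee_fin.
have mH : measurable_fun D H.
  by apply: ge0_emeasurable_sum => // k x _ _; rewrite lee_fin.
have IH : (\int[mu]_(x in D) H x < +oo)%E.
  rewrite integral_nneseries//; last by move=> k x _; rewrite lee_fin.
  apply: (@le_lt_trans _ _ (\sum_(0 <= k <oo) (K * 4^-1 ^+ k)%:E)%E).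
    apply: lee_nneseries => [k _ _|k _].
      by apply: integral_ge0 => x _; rewrite lee_fin.
    rewrite -/D rintE// lee_fin rintZ; last exact: (rL2B (hf k.+1) (hf k)).2.
    rewrite (le_trans (ler_wpM2l _ (hK k))) ?exprn_ge0//.
    by rewrite mulrCA -exprMn (_ : 4 * 16^-1 = 4^-1)//; field.
  have K0 : 0 <= K.
    have := hK 0; rewrite expr0 mulr1; apply: le_trans.
    by apply: rint_ge0 => x _; exact: sqr_ge0.
  apply: (@le_lt_trans _ _ (4 / 3 * K)%:E); last exact: ltry.
  apply: lime_le.
    by apply: is_cvg_nneseries => k _ _; rewrite lee_fin mulr_ge0// exprn_ge0// invr_ge0.
  apply: nearW => n; rewrite sumEFin lee_fin.
  have -> : \sum_(0 <= k < n) K * 4^-1 ^+ k = 4 / 3 * K * (1 - 4^-1 ^+ n).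
    elim: n => [|n IHn]; first by rewrite big_nil expr0 subrr mulr0.
    by rewrite big_nat_recr//= IHn exprS; field.
  by rewrite ler_piMr ?mulr_ge0// gerBl exprn_ge0// invr_ge0.
have iHE : mu.-integrable D H.
  apply/integrableP; split=> //.
  have -> : (\int[mu]_(x in D) `|H x|)%E = (\int[mu]_(x in D) H x)%E; last exact: IH.
  by apply: eq_integral => x _; rewrite gee0_abs.
have iH : rintegrable l r (fine \o H).
  apply: (@le_integrable _ _ _ mu _ _ _ H) => //.
  - by apply/measurable_EFinP; exact: measurableT_comp.
  - move=> x _ /=; rewrite [leRHS]gee0_abs//.
    by case: (H x) (H0 x) => [h||]//=; rewrite ?lee_fin => h0; rewrite ?normr0 ?ger0_norm ?leey.
pose A : set R := D `&` [set x | H x \is a fin_num].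
have mA : measurable A by exact: emeasurable_fin_num.
(* Cutting off to the set where the series is finite makes the sequence converge at every point of
   the interval, so that the limit is measurable; almost everywhere nothing changes. *)
pose fA n x : R := f n x * \1_A x.
have sb x k : A x -> `|f k.+1 x - f k x| <= Num.sqrt (fine (H x)) * 2^-1 ^+ k.
  move=> [Dx /= Hx].
  have b : (f k.+1 x - f k x) ^+ 2 <= fine (H x) * 4^-1 ^+ k.
    have : ((dk k x)%:E <= H x)%E.
      apply: le_trans (nneseries_lim_ge k.+1 _); last by move=> i _; rewrite lee_fin.
      by rewrite big_nat_recr//= leeDr// sumEFin lee_fin sumr_ge0.
    rewrite -{1}(fineK Hx) lee_fin /dk mulrC -ler_pdivlMr ?exprn_gt0//.
    by rewrite exprVn.
  have H0' : 0 <= fine (H x) by rewrite fine_ge0.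
  rewrite -sqrtr_sqr (le_trans (ler_wsqrtr b))//.
  rewrite sqrtrM// (_ : 4^-1 ^+ k = (2^-1 ^+ k) ^+ 2) ?sqrtr_sqr ?ger0_norm ?exprn_ge0//.
  by rewrite -exprM mulnC exprM; congr (_ ^+ _); field.
have key x (n m : nat) : (n <= m)%N -> A x ->
    (f m x - f n x) ^+ 2 <= 4 * 4^-1 ^+ n * fine (H x).
  move=> nm Ax; have H0' : 0 <= fine (H x) by rewrite fine_ge0.
  have h := telescope_le (sqrtr_ge0 _) (fun k => sb x k Ax) nm.
  have := ler_pM (normr_ge0 _) (normr_ge0 _) h h; rewrite -!expr2.
  rewrite real_normK ?num_real// !exprMn sqr_sqrtr// => /le_trans; apply.
  rewrite -exprM mulnC exprM (_ : 2^-1 ^+ 2 = 4^-1); last by field.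
  by rewrite (_ : 2 ^+ 2 = 4); [lra|ring].
have cvA x : A x -> cvgn (fun n => f n x).
  move=> Ax; pose d k := f k.+1 x - f k x.
  have cd : cvgn (series d).
    apply: normed_cvg; apply: (@series_le_cvg _ _ (geometric (Num.sqrt (fine (H x))) 2^-1)).
    - by move=> n; exact: normr_ge0.
    - by move=> n; rewrite /= mulr_ge0 ?sqrtr_ge0 ?exprn_ge0.
    - by move=> n; exact: sb.
    - by apply: is_cvg_geometric_series; rewrite ger0_norm// invf_lt1// ltr1n.
  rewrite (_ : (fun n => f n x) = (fun n => f 0 x + series d n)).
    by apply: is_cvgD => //; exact: is_cvg_cst.
  apply/funext => n; rewrite /series/= telescope_sumr//.
  by rewrite addrC subrK.
pose g x := limn (fun n => fA n x).
have fAg x : D x -> fA n x @[n --> \oo] --> g x.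
  move=> Dx; rewrite /g; have [Ax|nAx] := pselect (A x).
    have -> : fA ^~ x = f ^~ x.
      by apply/funext => n; rewrite /fA indicE mem_set ?mulr1.
    exact: cvA.
  have -> : fA ^~ x = (fun=> 0).
    by apply/funext => n; rewrite /fA indicE memNset ?mulr0.
  exact: is_cvg_cst.
have mf n : measurable_fun D (f n) by exact: rL2_meas (hf n).
have mfA n : measurable_fun D (fA n).
  by apply: measurable_funM => //; exact: measurable_indic.
have mg : measurable_fun D g by exact: measurable_fun_cvg fAg.
have AE n : aeq l r (f n) (fA n).
  have hae := @integrable_ae _ _ _ mu _ mD _ iHE; apply: filterS hae => x Hx Dx.
  by rewrite /fA indicE mem_set ?mulr1//; split => //; exact: Hx.
have rA n : rL2 l r (fA n) by apply: aeq_rL2 (hf n); [exact: mfA|exact: AE].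
have bd n x : l < x < r -> (fA n x - g x) ^+ 2 <= 4 * 4^-1 ^+ n * fine (H x).
  move=> xlr; have Dx : D x by rewrite /D/= in_itv.
  have cv : (fA n x - fA m x) ^+ 2 @[m --> \oo] --> (fA n x - g x) ^+ 2.
    by apply: cvgM; apply: cvgB; [exact: cvg_cst|exact: fAg|exact: cvg_cst|exact: fAg].
  apply: (cvgr_to_le cv); near=> m.
  have [Ax|nAx] := pselect (A x).
    rewrite /fA indicE mem_set// !mulr1 -sqrrN opprB; apply: key => //.
    by near: m; exact: nbhs_infty_ge.
  rewrite /fA indicE memNset// !mulr0 subrr expr0n/= !mulr_ge0 ?exprn_ge0 ?invr_ge0//.
  exact: fine_ge0.
have ib n : rintegrable l r (fun x => 4 * 4^-1 ^+ n * fine (H x)) by exact: rintegrableZ.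
have rAg n : rintegrable l r (fun x => (fA n x - g x) ^+ 2).
  apply: rintegrable_le (ib n); first exact/measurable_funX/measurable_funB.
  by move=> x xlr; rewrite ger0_norm ?sqr_ge0// bd.
have hg : rL2 l r g.
  split => //; have := rintegrableD (rintegrableZ 2 (rA 0).2) (rintegrableZ 2 (rAg 0)).
  apply: rintegrable_le; first exact: measurable_funX.
  move=> x _; rewrite ger0_norm ?sqr_ge0//.
  by have := sqr_ge0 (2 * fA 0 x - g x); lra.
exists g; split => //; exists (4 * rint l r (fine \o H)) => n.
rewrite mulrAC -rintZ//.
rewrite (_ : rint l r (fun x => (f n x - g x) ^+ 2) = rint l r (fun x => (fA n x - g x) ^+ 2)).
  by apply: le_rint => //; exact: bd.
apply: aeq_rint; [exact/measurable_funX/measurable_funB|exact/measurable_funX/measurable_funB|].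
by apply: aeq_imp (AE n) => x _ ->.
Unshelve. all: by end_near. Qed.

(* A minimizing sequence of test functions is Cauchy by the parallelogram law, and [f] minus its
   limit is orthogonal to all test functions. *)
Lemma test_dense l r f (e : R) : l < r -> rL2 l r f -> 0 < e ->
  exists phi, test_function l r phi /\ rint l r (fun x => (f x - phi x) ^+ 2) <= e.
Proof.
move=> lr hf e0.
have tL phi : test_function l r phi -> rL2 l r phi by exact: test_rL2.
pose S : set R := [set rint l r (fun x => (f x - phi x) ^+ 2) | phi in test_function l r].
have S0 z : S z -> 0 <= z by move=> [phi _ <-]; apply: rint_ge0 => x _; exact: sqr_ge0.
have hS : has_inf S.
  split; last by exists 0 => z /S0.
  have t0 : test_function l r (fun=> 0).
    split; first exact: smooth_cst.
    by exists ((l + l + r) / 3), ((l + r + r) / 3); split => //; lra.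
  by eexists; exists (fun=> 0).
pose d := inf S.
have dS phi : test_function l r phi -> d <= rint l r (fun x => (f x - phi x) ^+ 2).
  by move=> tphi; apply: ge_inf; [exact: hS.2|exists phi].
have ex n : exists phi, test_function l r phi /\
    rint l r (fun x => (f x - phi x) ^+ 2) <= d + 16^-1 ^+ n.
  have e16 : 0 < 16^-1 ^+ n :> R by rewrite exprn_gt0.
  have [_ [phi tphi <-] /ltW h] := inf_adherent e16 hS.
  by exists phi.
have [phi hphi] := choice ex.
have tphi n := (hphi n).1.
have nphi n := (hphi n).2.
have rfp n : rL2 l r (fun x => f x - phi n x) by apply: rL2B => //; exact: tL.
(* The midpoint of two approximants is at squared distance at least [d] from [f], so the
   parallelogram identity leaves [2 + 2/16 <= 4] times [16^-1 ^+ n]. *)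
have [n||g [hg [C hC]]] := @rL2_complete l r phi 4 lr.
- exact: tL.
- move=> n.
  have tm : test_function l r (fun x => 2^-1 * phi n.+1 x + 2^-1 * phi n x).
    by apply: testD; apply: testZ.
  have rm := rL2B hf (tL _ tm).
  have e1 : rint l r (fun x => (phi n.+1 x - phi n x) ^+ 2) =
      2 * rint l r (fun x => (f x - phi n x) ^+ 2) +
      2 * rint l r (fun x => (f x - phi n.+1 x) ^+ 2) -
      4 * rint l r (fun x => (f x - (2^-1 * phi n.+1 x + 2^-1 * phi n x)) ^+ 2).
    rewrite -!rintZ; [|exact: rm.2|exact: (rfp n.+1).2|exact: (rfp n).2].
    rewrite -rintD; [|exact: rintegrableZ (rfp n).2|exact: rintegrableZ (rfp n.+1).2].
    rewrite -rintB; last 2 first.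
    + by apply: rintegrableD; [exact: rintegrableZ (rfp n).2|exact: rintegrableZ (rfp n.+1).2].
    + exact: rintegrableZ rm.2.
    by apply: eq_rint => x _; field.
  rewrite e1; have := dS _ tm; have := nphi n; have := nphi n.+1.
  have : 0 <= 16^-1 ^+ n :> R by rewrite exprn_ge0.
  by rewrite exprS; lra.
have rgp n : rL2 l r (fun x => phi n x - g x) by apply: rL2B => //; exact: tL.
have fg : aeq l r (fun x => f x - g x) (fun=> 0).
  have rfg := rL2B hf hg.
  apply: fundamental_lemma; first exact: rL2_int.
  move=> psi tpsi; have rpsi := tL _ tpsi.
  set c := rint _ _ _; pose P := rint l r (fun x => psi x ^+ 2).
  have P0 : 0 <= P by apply: rint_ge0 => x _; exact: sqr_ge0.
  apply/eqP; rewrite -sqrf_eq0 eq_le sqr_ge0 andbT.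
  apply: (@le0_geometric 4^-1 (2 * (P + 1) + 2 * (C * P))) => [||n].
  - by rewrite invr_ge0.
  - by rewrite invf_lt1// ltr1n.
  pose cn := rint l r (fun x => (f x - phi n x) * psi x).
  have h1 : cn ^+ 2 <= (P + 1) * 16^-1 ^+ n.
    (* Moving the almost minimal [phi n] along [psi] by nearly the optimal step [cn / P] cannot gain
       more than [16^-1 ^+ n]; the [+ 1] avoids a zero denominator. *)
    pose t := cn / (P + 1).
    have := dS _ (testD (tphi n) (testZ t tpsi)).
    rewrite (eq_rint (g := fun x => ((f x - phi n x) + (- t) * psi x) ^+ 2)); last first.
      by move=> x _; ring.
    rewrite rint_sqDZ// -/cn -/P => h2.
    have h3 := nphi n.
    have Pp : 0 < P + 1 by rewrite ltr_wpDl.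
    have h4 : 2 * t * cn - t ^+ 2 * P <= 16^-1 ^+ n.
      by move: h2 h3; rewrite !mulrN !mulNr sqrrN; lra.
    have tP : t * (P + 1) = cn by rewrite /t divfK// gt_eqF.
    have h5 : t ^+ 2 * (P + 1) <= 16^-1 ^+ n.
      apply: le_trans h4; rewrite -tP.
      have -> : 2 * t * (t * (P + 1)) - t ^+ 2 * P = t ^+ 2 * (P + 1) + t ^+ 2 by ring.
      by rewrite lerDl sqr_ge0.
    rewrite -tP (_ : _ ^+ 2 = (P + 1) * (t ^+ 2 * (P + 1))); last by ring.
    by rewrite ler_pM2l.
  have h2 : (c - cn) ^+ 2 <= C * P * 4^-1 ^+ n.
    have -> : c - cn = rint l r (fun x => (phi n x - g x) * psi x).
      rewrite /c /cn -rintB; [|exact: rL2_mul|exact: rL2_mul].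
      by apply: eq_rint => x _; ring.
    apply: (le_trans (rint_cauchy_schwarz (rgp n) rpsi)); rewrite -/P.
    by rewrite mulrAC ler_wpM2r.
  have h3 : 16^-1 ^+ n <= 4^-1 ^+ n :> R.
    by rewrite lerXn2r ?nnegrE ?invr_ge0// lef_pV2 ?posrE//; lra.
  have := ler_wpM2l (addr_ge0 P0 ler01) h3.
  by have := sqr_ge0 (c - 2 * cn); lra.
have C0 : 0 <= C.
  have := hC 0; rewrite expr0 mulr1; apply: le_trans.
  by apply: rint_ge0 => x _; exact: sqr_ge0.
have [n hn] : exists n, C * 4^-1 ^+ n <= e.
  apply: contrapT => /forallNP h.
  have : e <= 0.
    apply: (@le0_geometric 4^-1 C) => [||n]; [by rewrite invr_ge0|by rewrite invf_lt1// ltr1n|].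
    by have /negP := h n; rewrite -ltNge => /ltW.
  by rewrite leNgt e0.
exists (phi n); split => //; apply: le_trans hn; apply: le_trans (hC n).
rewrite le_eqVlt; apply/orP; left; apply/eqP; apply: aeq_rint.
- exact: rintegrable_meas (rfp n).2.
- exact: rintegrable_meas (rgp n).2.
- by apply: aeq_imp fg => x _ /eqP; rewrite subr_eq0 => /eqP ->; rewrite -sqrrN opprB.
Qed.

End Completeness.

(** * Real and imaginary parts; Sobolev functions as chains of absolutely continuous functions *)

Section Components.
Local Open Scope classical_set_scope.
Local Open Scope complex_scope.
Context {R : realType}.
Local Notation mu := (@lebesgue_measure R).
Implicit Types (l r x c : R) (p : bool) (f g : cfun R) (F : nat -> R -> R) (phi : R -> R).

(** A boolean index for the two parts lets each real statement be used once, uniformly in [p]. *)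
Definition cmp p (z : R[i]) : R := if p then complex.Re z else complex.Im z.
Definition cf p f x : R := cmp p (f x).

Lemma cmp_eq (z w : R[i]) : (forall p, cmp p z = cmp p w) -> z = w.
Proof. by case: z w => a b [c d] h; have /= -> := h true; have /= -> := h false. Qed.

Lemma cmpD p (z w : R[i]) : cmp p (z + w) = cmp p z + cmp p w.
Proof. by case: p z w => -[a b] [c d]. Qed.

Lemma cmpN p (z : R[i]) : cmp p (- z) = - cmp p z.
Proof. by case: p z => -[a b]. Qed.

Lemma cmpB p (z w : R[i]) : cmp p (z - w) = cmp p z - cmp p w.
Proof. by rewrite cmpD cmpN. Qed.

Lemma cmpZ p c (z : R[i]) : cmp p (c%:C * z) = c * cmp p z.
Proof. by case: p z => -[a b] /=; rewrite mul0r ?subr0 ?addr0. Qed.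

Lemma cmpMr p c (z : R[i]) : cmp p (z * c%:C) = cmp p z * c.
Proof. by rewrite mulrC cmpZ mulrC. Qed.

Lemma cmp0 p : cmp p 0 = 0.
Proof. by case: p. Qed.

Lemma cmp_cst p (h : bool -> R) : cmp p (h true +i* h false) = h p.
Proof. by case: p. Qed.

Lemma normc_sq (z : R[i]) : Normc.normc z ^+ 2 = cmp true z ^+ 2 + cmp false z ^+ 2.
Proof. by case: z => a b /=; rewrite sqr_sqrtr// addr_ge0 ?sqr_ge0. Qed.

Lemma L2P l r f : L2 l r f <-> forall p, rL2 l r (cf p f).
Proof.
split=> [[mRe mIm fin] p|h].
  have mp q : measurable_fun `]l, r[ (cf q f) by case: q.
  have I : rintegrable l r (fun x => Normc.normc (f x) ^+ 2).
    apply/integrableP; split.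
      apply/measurable_EFinP.
      rewrite (_ : (fun x => _) = (fun x => cf true f x ^+ 2 + cf false f x ^+ 2)); last first.
        by apply/funext => x; rewrite normc_sq.
      by apply: measurable_funD; exact: measurable_funX (mp _).
    rewrite (_ : (\int[mu]_(x in `]l, r[) _)%E = (\int[mu]_(x in `]l, r[) (Normc.normc (f x) ^+ 2)%:E)%E)//.
    by apply: eq_integral => x _; rewrite /= ger0_norm// sqr_ge0.
  split=> //; apply: rintegrable_le I; first exact: measurable_funX.
  move=> x _; rewrite ger0_norm ?sqr_ge0// normc_sq /cf.
  by case: p; rewrite ?lerDl ?lerDr sqr_ge0.
split; [exact: (h true).1|exact: (h false).1|].
have := rintegrableD (h true).2 (h false).2 => /integrableP[_]; apply: le_lt_trans.
rewrite le_eqVlt; apply/orP; left; apply/eqP; apply: eq_integral => x _.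
by rewrite /= ger0_norm ?addr_ge0 ?sqr_ge0// normc_sq.
Qed.

Lemma ae_cf l r f g : f = g %[ae mu in `]l, r[%classic] <->
  forall p, aeq l r (cf p f) (cf p g).
Proof.
split=> [h p|h].
  by apply: filterS h => x h /h E; rewrite /cf E.
apply: filterS2 (h true) (h false) => x h1 h2 xlr.
by apply: cmp_eq => -[]; [exact: h1|exact: h2].
Qed.

Lemma cmp_pairing l r f phi p :
  cmp p (pairing l r f phi) = rint l r (fun x => cf p f x * phi x).
Proof.
rewrite /pairing /cintegral /rint; case: p => /=; apply: eq_Rintegral => x _.
  exact: (cmpMr true).
exact: (cmpMr false).
Qed.

Lemma weakP l r k f g : is_weak_derivative l r k f g <->
  forall p phi, test_function l r phi ->
    rint l r (fun x => cf p f x * (phi^`(k))%classic x) =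
    (-1) ^+ k * rint l r (fun x => cf p g x * phi x).
Proof.
have sgn p (z : R[i]) : cmp p ((-1) ^+ k * z) = (-1) ^+ k * cmp p z.
  by rewrite -cmpZ rmorphXn rmorphN1.
split=> [h p phi tphi|h phi tphi].
  by have /(congr1 (cmp p)) := h phi tphi; rewrite sgn !cmp_pairing.
by apply: cmp_eq => p; rewrite sgn !cmp_pairing h.
Qed.

(** [F j] stands for the j-th derivative. Below order [k] it is the continuous representative; [F k]
    is determined only almost everywhere. *)
Definition chain l r k F := forall j, (j < k)%N -> AC l r (F j) (F j.+1).

Lemma chain_rL2 l r k F j : l <= r -> (0 < k)%N -> chain l r k F -> (j <= k)%N ->
  rL2 l r (F j).
Proof.
move=> lr k0 hF; rewrite leq_eqVlt => /orP[/eqP->|/hF]; last exact: AC_rL2.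
by case: k k0 hF => // k _ /(_ k (ltnSn k)) [].
Qed.

Lemma chain_weak l r k F j phi : l <= r -> chain l r k F -> (j <= k)%N ->
  test_function l r phi ->
  rint l r (fun x => F 0%N x * (phi^`(j))%classic x) =
  (-1) ^+ j * rint l r (fun x => F j x * phi x).
Proof.
move=> lr hF; elim: j phi => [|j IH] phi jk tphi; first by rewrite expr0 mul1r.
have -> : (phi^`(j.+1))%classic = ((derive1 phi)^`(j))%classic by rewrite derive1n_derive1.
rewrite IH//; [|exact: ltnW|exact: test_derive].
by rewrite (AC_weak lr (hF j jk) tphi) exprSr mulrN1 mulrN mulNr.
Qed.

Lemma chain_sub l r l' r' k F : l <= l' -> r' <= r -> chain l r k F -> chain l' r' k F.
Proof. by move=> ll rr hF j jk; apply: AC_sub (hF j jk). Qed.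

Lemma chain_le l r k k' F : (k' <= k)%N -> chain l r k F -> chain l r k' F.
Proof. by move=> kk hF j jk; apply: hF; exact: leq_trans kk. Qed.

(** By induction on [j]: continuous functions equal almost everywhere are equal, and then so are
    their derivatives almost everywhere. *)
Lemma chain_uniq l r k F G : l < r -> chain l r k F -> chain l r k G ->
  aeq l r (F 0%N) (G 0%N) ->
  forall j, (j < k)%N -> (forall x, l <= x <= r -> F j x = G j x) /\
    aeq l r (F j.+1) (G j.+1).
Proof.
move=> lr hF hG FG; have lr' := ltW lr; elim=> [|j IH] jk.
  have E := cont_aeq_eq lr (AC_cont lr' (hF _ jk)) (AC_cont lr' (hG _ jk)) FG.
  split=> //; apply: (AC_uniq lr' (hF _ jk)).
  by apply: AC_eq (hG _ jk) => x /E.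
have [_ FGj] := IH (ltnW jk).
have E := cont_aeq_eq lr (AC_cont lr' (hF _ jk)) (AC_cont lr' (hG _ jk)) FGj.
split=> //; apply: (AC_uniq lr' (hF _ jk)).
by apply: AC_eq (hG _ jk) => x /E.
Qed.

(** The definition supplies weak derivatives of each order separately. Testing order [j + 1] with
    [phi] and order [j] with [phi'] shows that consecutive ones are linked, and [weak_AC]
    applies. *)
Lemma Sobolev_chain l r k f : l < r -> Sobolev l r k f ->
  exists F : bool -> nat -> R -> R,
    forall p, chain l r k (F p) /\ aeq l r (cf p f) (F p 0%N).
Proof.
move=> lr [Lf hS].
have /choice[g hg] : forall j, exists g, (j <= k)%N -> L2 l r g /\ is_weak_derivative l r j f g.
  move=> j; have [/hS[g Lg wg]|_] := boolP (j <= k)%N; first by exists g.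
  by exists f.
have rg p j : (j <= k)%N -> rL2 l r (cf p (g j)) by move=> /hg[/L2P].
have wg p j : (j < k)%N -> exists Fj, AC l r Fj (cf p (g j.+1)) /\ aeq l r (cf p (g j)) Fj.
  move=> jk; have [_ /weakP w1] := hg j.+1 jk; have [_ /weakP w0] := hg j (ltnW jk).
  have [phi tphi|Fj h1 h2] := weak_AC lr (rg p j (ltnW jk)) (rg p j.+1 jk); last by exists Fj.
  have := w1 p phi tphi; rewrite derive1n_derive1 (w0 p _ (test_derive tphi)).
  by rewrite exprSr mulrN1 mulNr -mulrN => /(mulfI _); apply; rewrite expf_neq0 ?oppr_eq0 ?oner_neq0.
have /choice[F0 hF0] : forall pj : bool * nat, exists Fj, (pj.2 < k)%N ->
    AC l r Fj (cf pj.1 (g pj.2.+1)) /\ aeq l r (cf pj.1 (g pj.2)) Fj.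
  move=> [p j]/=; have [/(wg p)[Fj hFj]|_] := boolP (j < k)%N; first by exists Fj.
  by exists (fun=> 0).
(* Order [k] has no continuous representative to offer, so the given weak derivative itself ends the
   chain. *)
exists (fun p j => if (j < k)%N then F0 (p, j) else cf p (g j)) => p.
have gF j : (j <= k)%N -> aeq l r (cf p (g j)) (if (j < k)%N then F0 (p, j) else cf p (g j)).
  move=> jk; case: ifPn => [jk'|_]; last exact: aeq_refl.
  exact: (hF0 (p, j) jk').2.
split.
  move=> j jk; rewrite jk; apply: (AC_aeq _ (gF j.+1 jk)); last exact: (hF0 (p, j) jk).1.
  case: ifPn => [jk'|_]; last exact: rg.
  exact: AC_rL2 (ltW lr) (hF0 (p, j.+1) jk').1.
apply: aeq_trans (gF 0%N (leq0n k)).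
have [/L2P Lg /weakP w] := hg 0%N (leq0n k); have /L2P Lf' := Lf.
(* The weak derivative of order 0 is a separately chosen function and has to be identified with
   [f]. *)
have : aeq l r (fun x => cf p f x - cf p (g 0%N) x) (fun=> 0).
  apply: fundamental_lemma; first exact/rL2_int/rL2B.
  move=> phi tphi; have rphi := test_rL2 l r tphi.
  have := w p phi tphi; rewrite derive1n0 expr0 mul1r => E.
  transitivity (rint l r (fun x => cf p f x * phi x) - rint l r (fun x => cf p (g 0%N) x * phi x)).
    rewrite -rintB; [|exact: rL2_mul|exact: rL2_mul].
    by apply: eq_rint => x _; ring.
  by rewrite E subrr.
by apply: aeq_imp => x _ /eqP; rewrite subr_eq0 => /eqP.
Qed.

Definition cpair (h : bool -> R -> R) : cfun R := fun x => h true x +i* h false x.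

Lemma cf_cpair p h : cf p (cpair h) = h p.
Proof. by apply/funext => x; rewrite /cf /cpair (cmp_cst p (h ^~ x)). Qed.

Lemma weak_chain l r k f (F : bool -> nat -> R -> R) j : l < r -> (0 < k)%N -> L2 l r f ->
  (forall p, chain l r k (F p)) -> (forall p, aeq l r (cf p f) (F p 0%N)) -> (j <= k)%N ->
  is_weak_derivative l r j f (cpair (F ^~ j)).
Proof.
move=> lr k0 /L2P Lf hF hf jk; apply/weakP => p phi tphi.
rewrite cf_cpair -(chain_weak (ltW lr) (hF p) jk tphi).
apply: aeq_rint.
- by apply: measurable_funM; [exact: rL2_meas (Lf p)|exact: rL2_meas (test_rL2 _ _ (test_derive1n j tphi))].
- apply: measurable_funM; [exact: rL2_meas (chain_rL2 (ltW lr) k0 (hF p) _)|].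
  exact: rL2_meas (test_rL2 _ _ (test_derive1n j tphi)).
- by apply: aeq_imp (hf p) => x _ ->.
Qed.

Lemma chain_Sobolev l r k f (F : bool -> nat -> R -> R) : l < r -> (0 < k)%N -> L2 l r f ->
  (forall p, chain l r k (F p)) -> (forall p, aeq l r (cf p f) (F p 0%N)) ->
  Sobolev l r k f.
Proof.
move=> lr k0 Lf hF hf; split => // j jk; exists (cpair (F ^~ j)).
  by apply/L2P => p; rewrite cf_cpair; exact: chain_rL2 (ltW lr) k0 (hF p) jk.
exact: weak_chain hF hf jk.
Qed.

Lemma weak_uniq l r j f g g' : L2 l r g -> L2 l r g' ->
  is_weak_derivative l r j f g -> is_weak_derivative l r j f g' ->
  forall p, aeq l r (cf p g) (cf p g').
Proof.
move=> /L2P Lg /L2P Lg' /weakP h /weakP h' p.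
have : aeq l r (fun x => cf p g x - cf p g' x) (fun=> 0).
  apply: fundamental_lemma; first exact/rL2_int/rL2B.
  move=> phi tphi; have rphi := test_rL2 l r tphi.
  transitivity (rint l r (fun x => cf p g x * phi x) - rint l r (fun x => cf p g' x * phi x)).
    rewrite -rintB; [|exact: rL2_mul|exact: rL2_mul].
    by apply: eq_rint => x _; ring.
  apply/eqP; rewrite subr_eq0; apply/eqP; apply: (@mulfI _ ((-1) ^+ j)).
    by rewrite expf_neq0// oppr_eq0 oner_neq0.
  by rewrite -h// h'.
by apply: aeq_imp => x _ /eqP; rewrite subr_eq0 => /eqP.
Qed.

(** A chain shows that the set from which [weakD] is chosen is nonempty; uniqueness of weak
    derivatives then locates the choice up to a null set. *)
Lemma weakD_chain l r k f (F : bool -> nat -> R -> R) j : l < r -> (0 < k)%N -> L2 l r f ->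
  (forall p, chain l r k (F p)) -> (forall p, aeq l r (cf p f) (F p 0%N)) -> (j <= k)%N ->
  L2 l r (weakD l r j f) /\ forall p, aeq l r (cf p (weakD l r j f)) (F p j).
Proof.
move=> lr k0 Lf hF hf jk.
have w := weak_chain lr k0 Lf hF hf jk.
have Lc : L2 l r (cpair (F ^~ j)).
  by apply/L2P => p; rewrite cf_cpair; exact: chain_rL2 (ltW lr) k0 (hF p) jk.
have [L1 w1] : [set g | L2 l r g /\ is_weak_derivative l r j f g] (weakD l r j f).
  by apply: xgetI; split; [exact: Lc|exact: w].
split=> // p; have := weak_uniq L1 Lc w1 w p.
by rewrite cf_cpair.
Qed.

(** Continuity up to the boundary fixes the chosen representative on all of [[l, r]], end points
    included, so traces become values of [G]. *)
Lemma crepE l r f (G : bool -> R -> R) : l < r ->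
  (forall p, {within `[l, r], continuous (G p)}) -> (forall p, aeq l r (cf p f) (G p)) ->
  forall p x, l <= x <= r -> cmp p (crep l r f x) = G p x.
Proof.
move=> lr cG hf p x xlr.
have [c1 c2 /ae_cf E] : [set g : cfun R |
    [/\ {within `[l, r], continuous (fun x => complex.Re (g x))},
        {within `[l, r], continuous (fun x => complex.Im (g x))} &
        f = g %[ae mu in `]l, r[%classic]]] (crep l r f).
  apply: (@xgetI _ _ _ (cpair G)); split; [exact: (cG true)|exact: (cG false)|].
  by apply/ae_cf => q; rewrite cf_cpair.
have cq : {within `[l, r], continuous (cf p (crep l r f))} by case: p {E}.
apply: (cont_aeq_eq lr cq (cG p)) => //.
by apply: aeq_trans (hf p); exact/aeq_sym/E.
Qed.

End Components.

(** * The energy space, the domain and the operator in terms of chains *)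

Section BeamOperator.
Local Open Scope classical_set_scope.
Local Open Scope complex_scope.
Context {R : realType}.
Local Notation mu := (@lebesgue_measure R).
Implicit Types (l r x c a b alpha xi : R) (p : bool) (U V W : state R) (phi : R -> R).

Definition Hrep U (F : bool -> nat -> R -> R) : Prop :=
  [/\ L2 0 1 U.1, L2 0 1 U.2 & forall p,
    [/\ chain 0 1 2 (F p), aeq 0 1 (cf p U.1) (F p 0%N), F p 0%N 0 = 0 & F p 0%N 1 = 0]].

Let lt01 : (0 : R) < 1 := ltr01.

Lemma inHP U : inH U <-> exists F, Hrep U F.
Proof.
split=> [[S c0 c1 L]|[F [L1 L2 hF]]].
  have [F hF] := Sobolev_chain lt01 S; exists F; split => // [|p]; first by case: S.
  have [cF uF] := hF p.
  have E := @crepE R 0 1 U.1 (fun p => F p 0%N) lt01 (fun q => AC_cont ler01 ((hF q).1 0%N isT))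
    (fun q => (hF q).2) p.
  split=> //.
    by rewrite -E ?lexx ?ler01// c0 cmp0.
  by rewrite -E ?lexx ?ler01// c1 cmp0.
have hc p : chain 0 1 2 (F p) by case: (hF p).
have ha p : aeq 0 1 (cf p U.1) (F p 0%N) by case: (hF p).
have E := @crepE R 0 1 U.1 (fun p => F p 0%N) lt01 (fun q => AC_cont ler01 (hc q 0%N isT)) ha.
split => //.
- exact: chain_Sobolev hc ha.
- by apply: cmp_eq => p; rewrite E ?lexx ?ler01// cmp0; case: (hF p).
- by apply: cmp_eq => p; rewrite E ?lexx ?ler01// cmp0; case: (hF p).
Qed.

Lemma Hrep_weakD U F : Hrep U F ->
  L2 0 1 (weakD 0 1 2 U.1) /\ forall p, aeq 0 1 (cf p (weakD 0 1 2 U.1)) (F p 2%N).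
Proof.
move=> [L1 _ hF]; have [hc ha] : (forall p, chain 0 1 2 (F p)) /\
    (forall p, aeq 0 1 (cf p U.1) (F p 0%N)) by split=> p; case: (hF p).
exact: (@weakD_chain R 0 1 2 _ F 2%N lt01 isT L1 hc ha isT).
Qed.

(* [Y] and [Z] represent u and its derivatives on (0, xi) and (xi, 1), [F] those of u and [G] those
   of v on (0, 1). *)
Definition domrep a alpha xi U (Y Z F G : bool -> nat -> R -> R) : Prop :=
  [/\ Hrep U F, L2 0 1 U.2 & forall p,
   [/\ [/\ chain 0 xi 4 (Y p) & aeq 0 xi (cf p U.1) (Y p 0%N)],
       [/\ chain xi 1 4 (Z p) & aeq xi 1 (cf p U.1) (Z p 0%N)],
       [/\ chain 0 1 2 (G p), aeq 0 1 (cf p U.2) (G p 0%N), G p 0%N 0 = 0 & G p 0%N 1 = 0] &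
       [/\ Y p 2%N 0 = 0, Z p 2%N 1 = 0, Y p 2%N xi = Z p 2%N xi &
           Z p 3%N xi - Y p 3%N xi = - (alpha / a) * G p 0%N xi]]].

Section Data.
Context (a b alpha xi : R) (a0 : 0 < a) (xi0 : 0 < xi) (xi1 : xi < 1).

Lemma L2_sub l r l' r' (f : cfun R) : l <= l' -> r' <= r -> L2 l r f -> L2 l' r' f.
Proof. by move=> ll rr /L2P h; apply/L2P => p; exact: rL2_sub (h p). Qed.

(** Every choice made by [weakD] and [crep] is replaced by explicit functions, and the trace and
    jump conditions become equations between their values. *)
Lemma domAP U : domA a alpha xi U <-> exists Y Z F G, domrep a alpha xi U Y Z F G.
Proof.
have le0 := ltW xi0; have le1 := ltW xi1.
have cont l r k F p j : l < r -> (forall p, chain l r k (F p)) -> (j < k)%N ->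
  {within `[l, r], continuous (F p j : R -> R)}.
  by move=> lr hF jk; exact: AC_cont (ltW lr) (hF p j jk).
split.
  case=> -[SY SZ SF SG] [c0 v0 c1 v1] [y0 z1] yz jump.
  have [Y hY] := Sobolev_chain xi0 SY; have [Z hZ] := Sobolev_chain xi1 SZ.
  have [F hF] := Sobolev_chain lt01 SF; have [G hG] := Sobolev_chain lt01 SG.
  have [Yc Ya] : (forall p, chain 0 xi 4 (Y p)) /\ (forall p, aeq 0 xi (cf p U.1) (Y p 0%N)).
    by split=> p; case: (hY p).
  have [Zc Za] : (forall p, chain xi 1 4 (Z p)) /\ (forall p, aeq xi 1 (cf p U.1) (Z p 0%N)).
    by split=> p; case: (hZ p).
  have [Fc Fa] : (forall p, chain 0 1 2 (F p)) /\ (forall p, aeq 0 1 (cf p U.1) (F p 0%N)).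
    by split=> p; case: (hF p).
  have [Gc Ga] : (forall p, chain 0 1 2 (G p)) /\ (forall p, aeq 0 1 (cf p U.2) (G p 0%N)).
    by split=> p; case: (hG p).
  have EF := crepE lt01 (fun q => cont _ _ _ F q 0%N lt01 Fc isT) Fa.
  have EG := crepE lt01 (fun q => cont _ _ _ G q 0%N lt01 Gc isT) Ga.
  have LY : L2 0 xi U.1 by case: SY.
  have LZ : L2 xi 1 U.1 by case: SZ.
  have EY j : (j < 4)%N -> forall p x, 0 <= x <= xi ->
      cmp p (crep 0 xi (weakD 0 xi j U.1) x) = Y p j x.
    move=> j4; apply: (crepE xi0) => q; first exact: cont Yc j4.
    exact: (weakD_chain xi0 _ LY Yc Ya (ltnW j4)).2.
  have EZ j : (j < 4)%N -> forall p x, xi <= x <= 1 ->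
      cmp p (crep xi 1 (weakD xi 1 j U.1) x) = Z p j x.
    move=> j4; apply: (crepE xi1) => q; first exact: cont Zc j4.
    exact: (weakD_chain xi1 _ LZ Zc Za (ltnW j4)).2.
  have h01 : 0 <= xi <= 1 by rewrite le0 le1.
  exists Y, Z, F, G; split.
  - split; [by case: SF|by case: SG|move=> p; split => //].
      by rewrite -EF ?lexx ?ler01// c0 cmp0.
    by rewrite -EF ?lexx ?ler01// c1 cmp0.
  - by case: SG.
  - move=> p; split; [by []|by []| |].
    + split => //; first by rewrite -EG ?lexx ?ler01// v0 cmp0.
      by rewrite -EG ?lexx ?ler01// v1 cmp0.
    + split.
      * by rewrite -EY ?lexx ?le0// y0 cmp0.
      * by rewrite -EZ ?lexx ?le1// z1 cmp0.
      * by rewrite -EY ?lexx ?le0// -EZ ?lexx ?le1// yz.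
      * rewrite -EY ?lexx ?le0// -EZ ?lexx ?le1// -cmpB jump -EG//.
        by rewrite -cmpZ rmorphN.
case=> Y [Z [F [G [[LU LV hF] _ h]]]].
have [Yc Ya] : (forall p, chain 0 xi 4 (Y p)) /\ (forall p, aeq 0 xi (cf p U.1) (Y p 0%N)).
  by split=> p; case: (h p) => -[].
have [Zc Za] : (forall p, chain xi 1 4 (Z p)) /\ (forall p, aeq xi 1 (cf p U.1) (Z p 0%N)).
  by split=> p; case: (h p) => _ [].
have [Gc Ga] : (forall p, chain 0 1 2 (G p)) /\ (forall p, aeq 0 1 (cf p U.2) (G p 0%N)).
  by split=> p; case: (h p) => _ _ [].
have [Fc Fa] : (forall p, chain 0 1 2 (F p)) /\ (forall p, aeq 0 1 (cf p U.1) (F p 0%N)).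
  by split=> p; case: (hF p).
have EF := crepE lt01 (fun q => cont _ _ _ F q 0%N lt01 Fc isT) Fa.
have EG := crepE lt01 (fun q => cont _ _ _ G q 0%N lt01 Gc isT) Ga.
have LY : L2 0 xi U.1 by exact: L2_sub LU.
have LZ : L2 xi 1 U.1 by exact: L2_sub LU.
have EY j : (j < 4)%N -> forall p x, 0 <= x <= xi ->
    cmp p (crep 0 xi (weakD 0 xi j U.1) x) = Y p j x.
  move=> j4; apply: (crepE xi0) => q; first exact: cont Yc j4.
  exact: (weakD_chain xi0 _ LY Yc Ya (ltnW j4)).2.
have EZ j : (j < 4)%N -> forall p x, xi <= x <= 1 ->
    cmp p (crep xi 1 (weakD xi 1 j U.1) x) = Z p j x.
  move=> j4; apply: (crepE xi1) => q; first exact: cont Zc j4.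
  exact: (weakD_chain xi1 _ LZ Zc Za (ltnW j4)).2.
have h01 : 0 <= xi <= 1 by rewrite le0 le1.
split.
- by split; [exact: chain_Sobolev Yc Ya|exact: chain_Sobolev Zc Za|
  exact: chain_Sobolev Fc Fa|exact: chain_Sobolev Gc Ga].
- split; apply: cmp_eq => p; rewrite ?EF ?EG ?lexx ?ler01// cmp0; case: (hF p) => //;
    by case: (h p) => _ _ [].
- split; apply: cmp_eq => p; rewrite ?EY ?EZ ?lexx ?le0 ?le1// cmp0; by case: (h p) => _ _ _ [].
- apply: cmp_eq => p; rewrite EY ?EZ ?lexx ?le0 ?le1//; by case: (h p) => _ _ _ [].
- apply: cmp_eq => p; rewrite cmpB EY ?EZ ?lexx ?le0 ?le1//.
  by rewrite -rmorphN cmpZ EG//; case: (h p) => _ _ _ [].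
Qed.

Lemma domA_inH U : domA a alpha xi U -> inH U.
Proof. by move=> /domAP[Y [Z [F [G [hF _ _]]]]]; apply/inHP; exists F. Qed.

Lemma rL2_patch l r l' r' (f : R -> R) : rL2 l r f -> rL2 l' r' (f \_ `]l, r[).
Proof.
move=> [mf hf]; split.
  apply: (@measurable_funS _ _ _ _ setT) => //; apply/(measurable_restrictT _ _).1 => //.
have := rintegrable_patch hf => h; apply: (@integrableS _ _ _ mu setT) => //.
apply: eq_integrable h => // x _; congr EFin.
by rewrite !patchE; case: ifP => // _; rewrite expr0n.
Qed.

Lemma rint_patch_mul l r m1 m2 (f g : R -> R) : l <= m1 -> m1 <= m2 -> m2 <= r ->
  rL2 m1 m2 f -> rL2 l r g ->
  rint l r (fun x => (f \_ `]m1, m2[) x * g x) = rint m1 m2 (fun x => f x * g x).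
Proof.
move=> lm mm mr hf hg.
have I : rintegrable l r (fun x => (f \_ `]m1, m2[) x * g x).
  by apply: rL2_mul => //; exact: rL2_patch.
rewrite (rint_split lm (le_trans mm mr) I) (@rint_split _ m1 m2 r)//; last first.
  by apply: rintegrable_sub I.
rewrite [X in X + _]eq0_rint ?add0r; last first.
  by move=> x /andP[_ xm]; rewrite patchE mem_setE in_itv/= ltNge (ltW xm)/= mul0r.
rewrite [X in _ + X]eq0_rint ?addr0; last first.
  by move=> x /andP[xm _]; rewrite patchE mem_setE in_itv/= [x < m2]ltNge (ltW xm)/= andbF mul0r.
by apply: eq_rint => x xm; rewrite patchE mem_setE in_itv/= xm.
Qed.

(** The candidate is [- a u_xxxx - b v] with [u_xxxx] taken on each side of [xi]. By [beam_ibp] the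
    jump of [u_xxx] reproduces the Dirac term. The test pairs range over [H^2] with zero traces
    because the dissipation estimate tests with [u] and [v]. *)
Lemma opA_exists U Y Z F G : domrep a alpha xi U Y Z F G ->
  exists w : bool -> R -> R, (forall p, rL2 0 1 (w p)) /\
  forall p (q0 q1 q2 : R -> R), AC 0 1 q0 q1 -> AC 0 1 q1 q2 -> q0 0 = 0 -> q0 1 = 0 ->
    rint 0 1 (fun x => w p x * q0 x) = - a * rint 0 1 (fun x => F p 2%N x * q2 x)
      - b * rint 0 1 (fun x => cf p U.2 x * q0 x) - alpha * G p 0%N xi * q0 xi.
Proof.
move=> [[LU /L2P LV hF] _ h].
have le0 := ltW xi0; have le1 := ltW xi1.
exists (fun p x => - a * ((Y p 4%N \_ `]0, xi[) x + (Z p 4%N \_ `]xi, 1[) x) - b * cf p U.2 x).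
have rY p : rL2 0 xi (Y p 4%N).
  by case: (h p) => -[Yc _] _ _ _; exact: (chain_rL2 (k := 4%N) (j := 4%N) le0 isT Yc isT).
have rZ p : rL2 xi 1 (Z p 4%N).
  by case: (h p) => _ [Zc _] _ _; exact: (chain_rL2 (k := 4%N) (j := 4%N) le1 isT Zc isT).
have rYp p := rL2_patch 0 1 (rY p); have rZp p := rL2_patch 0 1 (rZ p).
split.
  by move=> p; apply: rL2B; apply: rL2Z => //; exact: rL2D.
move=> p q0 q1 q2 hq0 hq1 q00 q01.
have [[Yc Ya] [Zc Za] [Gc Ga G0 G1] [y0 z1 yz jump]] := h p.
have [Fc Fa F0 F1] := hF p.
have rq0 := AC_rL2 ler01 hq0.
(* On each side the piecewise and the global chain of [u] agree up to order 2, so the [Y 2] and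
   [Z 2] left by [beam_ibp] combine into [F 2]. *)
have UY := chain_uniq xi0 (chain_le (k := 4%N) (k' := 2%N) isT Yc) (chain_sub (lexx 0) le1 Fc)
  (aeq_trans (aeq_sym Ya) (aeq_sub (lexx 0) le1 Fa)).
have UZ := chain_uniq xi1 (chain_le (k := 4%N) (k' := 2%N) isT Zc) (chain_sub le0 (lexx 1) Fc)
  (aeq_trans (aeq_sym Za) (aeq_sub le0 (lexx 1) Fa)).
have [_ Y2] := UY 1%N isT; have [_ Z2] := UZ 1%N isT.
have rF2 : rL2 0 1 (F p 2%N) by exact: (chain_rL2 (k := 2%N) (j := 2%N) ler01 isT Fc isT).
have rq2 := hq1.1.
have rF2q2 := rL2_mul rF2 rq2.
have -> : rint 0 1 (fun x => F p 2%N x * q2 x) =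
    rint 0 xi (fun x => Y p 2%N x * q2 x) + rint xi 1 (fun x => Z p 2%N x * q2 x).
  rewrite (rint_split le0 le1 rF2q2); congr (_ + _); apply/esym/aeq_rint.
  - apply: rintegrable_meas; apply: rL2_mul; first exact: (chain_rL2 (k := 4%N) (j := 2%N) le0 isT Yc isT).
    exact: rL2_sub rq2.
  - by apply: rintegrable_meas; exact: rintegrable_sub rF2q2.
  - by apply: aeq_imp Y2 => x _ ->.
  - apply: rintegrable_meas; apply: rL2_mul; first exact: (chain_rL2 (k := 4%N) (j := 2%N) le1 isT Zc isT).
    exact: rL2_sub rq2.
  - by apply: rintegrable_meas; exact: rintegrable_sub rF2q2.
  - by apply: aeq_imp Z2 => x _ ->.
have jump' : Z p 3%N xi - Y p 3%N xi = - (alpha / a * G p 0%N xi) by rewrite jump mulNr.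
have B := beam_ibp xi0 xi1 (Yc 2%N isT) (Yc 3%N isT) (Zc 2%N isT) (Zc 3%N isT) y0 z1 yz jump'
  hq0 hq1 q00 q01.
have i1 : rintegrable 0 1 (fun x => (Y p 4%N \_ `]0, xi[) x * q0 x) by exact: rL2_mul.
have i2 : rintegrable 0 1 (fun x => (Z p 4%N \_ `]xi, 1[) x * q0 x) by exact: rL2_mul.
have i3 : rintegrable 0 1 (fun x => cf p U.2 x * q0 x) by exact: rL2_mul.
rewrite (eq_rint (g := fun x => - a * ((Y p 4%N \_ `]0, xi[) x * q0 x +
  (Z p 4%N \_ `]xi, 1[) x * q0 x) - b * (cf p U.2 x * q0 x))); last by move=> x _; ring.
rewrite rintB; [|by apply/rintegrableZ/rintegrableD|exact: rintegrableZ].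
rewrite !rintZ//; last exact: rintegrableD.
rewrite rintD// !rint_patch_mul// B.
by field; rewrite gt_eqF.
Qed.

Lemma derive1n4 phi : (phi^`(4))%classic = ((derive1 (derive1 phi))^`(2))%classic.
Proof. by rewrite (derive1n_derive1 phi 3); exact: (derive1n_derive1 (derive1 phi) 2). Qed.

Lemma chain_weak4 (f : nat -> R -> R) phi : chain 0 1 2 f -> test_function 0 1 phi ->
  rint 0 1 (fun x => f 0%N x * (phi^`(4))%classic x) =
  rint 0 1 (fun x => f 2%N x * derive1 (derive1 phi) x).
Proof.
move=> cf tphi; rewrite derive1n4; move: (test_derive (test_derive tphi)).
move: (derive1 (derive1 phi)) => psi tpsi.
by have := chain_weak ler01 cf (leqnn 2%N) tpsi; rewrite sqrrN expr1n mul1r.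
Qed.

(** The distributional identity determines an [L^2] function almost everywhere, so the chosen second
    component coincides with the candidate of [opA_exists]. *)
Lemma opA_spec U Y Z F G : domrep a alpha xi U Y Z F G ->
  L2 0 1 (opA a b alpha xi U).2 /\
  forall p (q0 q1 q2 : R -> R), AC 0 1 q0 q1 -> AC 0 1 q1 q2 -> q0 0 = 0 -> q0 1 = 0 ->
    rint 0 1 (fun x => cf p (opA a b alpha xi U).2 x * q0 x) =
    - a * rint 0 1 (fun x => F p 2%N x * q2 x)
      - b * rint 0 1 (fun x => cf p U.2 x * q0 x) - alpha * G p 0%N xi * q0 xi.
Proof.
move=> hU; have [w [rw hw]] := opA_exists hU.
have [[LU LV hF] _ h] := hU.
have le0 := ltW xi0; have le1 := ltW xi1.
have EG : forall p, cmp p (crep 0 1 U.2 xi) = G p 0%N xi.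
  move=> p; apply: (@crepE R 0 1 U.2 (fun p => G p 0%N) lt01) => [q|q|]; last by rewrite le0 le1.
    by case: (h q) => _ _ [Gc _ _ _] _; exact: AC_cont ler01 (Gc 0%N isT).
  by case: (h q) => _ _ [].
(* A test function and its first two derivatives form an admissible pair; two derivatives are moved
   back from [u_xx] to reach the fourth-order pairing of the definition. *)
have key p phi : test_function 0 1 phi ->
    rint 0 1 (fun x => w p x * phi x) =
    - a * rint 0 1 (fun x => cf p U.1 x * (phi^`(4))%classic x)
      - b * rint 0 1 (fun x => cf p U.2 x * phi x) - alpha * G p 0%N xi * phi xi.
  move=> tphi; have [Fc Fa _ _] := hF p.
  have sphi := test_smooth tphi.
  rewrite (hw p phi (derive1 phi) (derive1 (derive1 phi))); last 4 first.
  - exact: smooth_AC.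
  - by apply: smooth_AC; exact: smooth_derive.
  - exact: test_le tphi _.
  - exact: test_ge tphi _.
  have C2 := chain_weak4 Fc tphi.
  have t4 := rL2_meas (test_rL2 0 1 (test_derive1n 4%N tphi)).
  move: C2 t4; move: ((phi^`(4))%classic) => psi C2 t4.
  suff C1 : rint 0 1 (fun x => F p 0%N x * psi x) =
      rint 0 1 (fun x => cf p U.1 x * psi x) by rewrite -C2 C1.
  apply: aeq_rint.
  - apply: measurable_funM => //.
    exact: rL2_meas (chain_rL2 (k := 2%N) (j := 0%N) ler01 isT Fc isT).
  - by apply: measurable_funM => //; move/L2P: LU => /(_ p) /rL2_meas.
  - by apply: aeq_imp Fa => x _ ->.
have Lc : L2 0 1 (cpair w) by apply/L2P => p; rewrite cf_cpair.
have spec (g : cfun R) : is_opA2 a b alpha xi U g <-> forall p phi, test_function 0 1 phi ->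
    rint 0 1 (fun x => cf p g x * phi x) = rint 0 1 (fun x => w p x * phi x).
  have rhs phi p : cmp p (- a%:C * pairing 0 1 U.1 (phi^`(4))%classic
      - b%:C * pairing 0 1 U.2 phi - alpha%:C * crep 0 1 U.2 xi * (phi xi)%:C) =
      - a * rint 0 1 (fun x => cf p U.1 x * (phi^`(4))%classic x)
      - b * rint 0 1 (fun x => cf p U.2 x * phi x) - alpha * G p 0%N xi * phi xi.
    by rewrite !cmpB -rmorphN !cmpZ cmpMr cmpZ !cmp_pairing EG.
  split=> [hg p phi tphi|hg phi tphi].
    by have /(congr1 (cmp p)) := hg phi tphi; rewrite cmp_pairing rhs -key.
  by apply: cmp_eq => p; rewrite cmp_pairing rhs -key// hg.
have [L1 /spec w1] : [set g | L2 0 1 g /\ is_opA2 a b alpha xi U g] (opA a b alpha xi U).2.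
  by apply: (@xgetI _ _ _ (cpair w)); split => //; apply/spec => p phi _; rewrite cf_cpair.
split=> // p q0 q1 q2 hq0 hq1 q00 q01; rewrite -(hw p q0 q1 q2)//.
have L1p := (L2P _ _ _).1 L1 p.
have E : aeq 0 1 (fun x => cf p (opA a b alpha xi U).2 x - w p x) (fun=> 0).
  apply: fundamental_lemma; first exact/rL2_int/rL2B.
  move=> phi tphi; have rphi := test_rL2 0 1 tphi.
  transitivity (rint 0 1 (fun x => cf p (opA a b alpha xi U).2 x * phi x) -
                rint 0 1 (fun x => w p x * phi x)).
    rewrite -rintB; [|exact: rL2_mul|exact: rL2_mul].
    by apply: eq_rint => x _; ring.
  by rewrite w1// subrr.
have rq0 := AC_rL2 ler01 hq0.
apply: aeq_rint.
- by apply: rintegrable_meas; exact: rL2_mul.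
- by apply: rintegrable_meas; exact: rL2_mul.
- by apply: aeq_imp E => x _ /eqP; rewrite subr_eq0 => /eqP ->.
Qed.

Lemma opA_inH U : domA a alpha xi U -> inH (opA a b alpha xi U).
Proof.
move=> /domAP[Y [Z [F [G hU]]]]; have [L _] := opA_spec hU.
have [[_ LV _] _ h] := hU.
by apply/inHP; exists G; split => // p; case: (h p) => _ _ [].
Qed.

End Data.
End BeamOperator.

(* Locked, lest unification compares integrals by unfolding them. *)
Fact form_key : unit. Proof. by []. Qed.

(** * The modified energy form *)

Section EnergyForms.
Local Open Scope classical_set_scope.
Local Open Scope complex_scope.
Context {R : realType}.
Implicit Types (a b c k alpha beta xi : R) (p : bool) (U V W : state R) (f g h : R -> R).

Definition ip := locked_with form_key (fun f g => rint 0 1 (fun x => f x * g x)).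

Lemma ipE f g : ip f g = rint 0 1 (fun x => f x * g x).
Proof. by rewrite /ip unlock. Qed.

Lemma ipC f g : ip f g = ip g f.
Proof. by rewrite !ipE; apply: eq_rint => x _; rewrite mulrC. Qed.

Lemma ip_lin c f g h : rL2 0 1 f -> rL2 0 1 g -> rL2 0 1 h ->
  ip (fun x => c * f x + g x) h = c * ip f h + ip g h.
Proof.
move=> hf hg hh; rewrite !ipE -rintZ; last exact: rL2_mul.
rewrite -rintD; [|by apply: rintegrableZ; exact: rL2_mul|exact: rL2_mul].
by apply: eq_rint => x _; ring.
Qed.

Lemma ip_aeq f f' g g' : rL2 0 1 f -> rL2 0 1 f' -> rL2 0 1 g -> rL2 0 1 g' ->
  aeq 0 1 f f' -> aeq 0 1 g g' -> ip f g = ip f' g'.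
Proof.
move=> hf hf' hg hg' ff gg; rewrite !ipE; apply: aeq_rint.
- by apply: rintegrable_meas; exact: rL2_mul.
- by apply: rintegrable_meas; exact: rL2_mul.
- exact: aeq_fun2 ff gg.
Qed.

Lemma ipxx_ge0 f : 0 <= ip f f.
Proof. by rewrite ipE; apply: rint_ge0 => x _; rewrite -expr2 sqr_ge0. Qed.

Lemma ipxxE f : ip f f = rint 0 1 (fun x => f x ^+ 2).
Proof. by rewrite ipE; apply: eq_rint => x _; rewrite expr2. Qed.

Lemma ip_sqD c f g : rL2 0 1 f -> rL2 0 1 g ->
  0 <= ip f f + 2 * c * ip g f + c ^+ 2 * ip g g.
Proof.
move=> hf hg; have := ipxx_ge0 (fun x => f x + c * g x).
by rewrite ipxxE rint_sqDZ// -!ipxxE -ipE (ipC f g).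
Qed.

Definition cu p U := cf p U.1.
Definition cv p U := cf p U.2.
Definition cd p U := cf p (weakD 0 1 2 U.1).

Lemma inH_rL2 U p : inH U -> [/\ rL2 0 1 (cu p U), rL2 0 1 (cv p U) & rL2 0 1 (cd p U)].
Proof.
move=> /inHP[F hF]; have [Ld _] := Hrep_weakD hF.
by case: hF => /L2P L1 /L2P L2 _; move/L2P in Ld; split; [exact: L1|exact: L2|exact: Ld].
Qed.

Lemma inH_cu U p : inH U -> rL2 0 1 (cu p U).
Proof. by move=> /(inH_rL2 p)[]. Qed.
Lemma inH_cv U p : inH U -> rL2 0 1 (cv p U).
Proof. by move=> /(inH_rL2 p)[]. Qed.
Lemma inH_cd U p : inH U -> rL2 0 1 (cd p U).
Proof. by move=> /(inH_rL2 p)[]. Qed.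
Local Hint Resolve inH_cu inH_cv inH_cd : core.

Lemma AC_lin l r c (f0 f1 g0 g1 : R -> R) : l <= r -> AC l r f0 f1 -> AC l r g0 g1 ->
  AC l r (fun x => c * f0 x + g0 x) (fun x => c * f1 x + g1 x).
Proof.
move=> lr [rf hf] [rg hg]; split; first exact/rL2D/rg/rL2Z.
move=> x /andP[lx xr]; rewrite hf ?lx// hg ?lx//.
have [jf jg] : rintegrable l x f1 /\ rintegrable l x g1.
  by split; apply: rL2_int; apply: rL2_sub (lexx l) xr _.
by rewrite rintD ?rintZ//; [ring|exact: rintegrableZ].
Qed.

Lemma cf_lin c (f g : cfun R) p : cf p (c%:C *: f + g) = (fun x => c * cf p f x + cf p g x).
Proof. by apply/funext => x; rewrite /cf -cmpZ -cmpD. Qed.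

Lemma Hrep_lin c U V F G : Hrep U F -> Hrep V G ->
  Hrep (c%:C *: U + V) (fun p j x => c * F p j x + G p j x).
Proof.
move=> [/L2P LU /L2P LU2 hF] [/L2P LV /L2P LV2 hG]; split.
- by apply/L2P => p; rewrite cf_lin; apply: rL2D => //; exact: rL2Z.
- by apply/L2P => p; rewrite cf_lin; apply: rL2D => //; exact: rL2Z.
- move=> p; have [Fc Fa F0 F1] := hF p; have [Gc Ga G0 G1] := hG p; split.
  + by move=> j j2; apply: AC_lin => //; [exact: Fc|exact: Gc].
  + rewrite cf_lin; exact: (aeq_fun2 (fun y z => c * y + z) Fa Ga).
  + by rewrite F0 G0 mulr0 addr0.
  + by rewrite F1 G1 mulr0 addr0.
Qed.

Lemma inH_lin c U V : inH U -> inH V -> inH (c%:C *: U + V).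
Proof.
by move=> /inHP[F hF] /inHP[G hG]; apply/inHP; eexists; exact: Hrep_lin hF hG.
Qed.

Lemma cd_lin c U V p : inH U -> inH V ->
  aeq 0 1 (cd p (c%:C *: U + V)) (fun x => c * cd p U x + cd p V x).
Proof.
move=> /inHP[F hF] /inHP[G hG].
have [_ h] := Hrep_weakD (Hrep_lin c hF hG).
apply: aeq_trans (h p) _; apply: aeq_sym.
by apply: (aeq_fun2 (fun y z => c * y + z)); [exact: (Hrep_weakD hF).2|exact: (Hrep_weakD hG).2].
Qed.

(** The polarised form, one component at a time. Keeping [beta] and [k] as parameters makes the
    energy inner product the instance [beta = k = 0], so both share their algebra. *)
Definition bp a beta k p U V :=
  ip (cv p U) (cv p V) + beta * (ip (cu p U) (cv p V) + ip (cv p U) (cu p V)) +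
  k * ip (cu p U) (cu p V) + a * ip (cd p U) (cd p V).

Definition bf := locked_with form_key
  (fun a beta k U V => bp a beta k true U V + bp a beta k false U V).

Lemma bfE a beta k U V : bf a beta k U V = bp a beta k true U V + bp a beta k false U V.
Proof. by rewrite /bf unlock. Qed.

Lemma bfC a beta k U V : bf a beta k U V = bf a beta k V U.
Proof.
rewrite !bfE /bp !(ipC (cv _ U)) !(ipC (cu _ U)) !(ipC (cd _ U)).
by rewrite ![ip _ (cu _ U) + ip _ _]addrC.
Qed.

Lemma bf_lin a beta k c U V W : inH U -> inH V -> inH W ->
  bf a beta k (c%:C *: U + V) W = c * bf a beta k U W + bf a beta k V W.
Proof.
move=> hU hV hW; have hL := inH_lin c hU hV.
have E p : bp a beta k p (c%:C *: U + V) W = c * bp a beta k p U W + bp a beta k p V W.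
  have Ed : ip (cd p (c%:C *: U + V)) (cd p W) = c * ip (cd p U) (cd p W) + ip (cd p V) (cd p W).
    rewrite -ip_lin; auto.
    apply: ip_aeq; auto; [by apply: rL2D; [apply: rL2Z|]; auto|exact: cd_lin|exact: aeq_refl].
  have Eu f : rL2 0 1 f -> ip (cu p (c%:C *: U + V)) f = c * ip (cu p U) f + ip (cu p V) f.
    by move=> hf; rewrite {1}/cu /= cf_lin (ip_lin c (inH_cu p hU) (inH_cu p hV) hf).
  have Ev f : rL2 0 1 f -> ip (cv p (c%:C *: U + V)) f = c * ip (cv p U) f + ip (cv p V) f.
    by move=> hf; rewrite {1}/cv /= cf_lin (ip_lin c (inH_cv p hU) (inH_cv p hV) hf).
  rewrite /bp Ed !Eu ?Ev; auto.
  do 10! move: (ip _ _) => ?; ring.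
by rewrite !bfE !E; do 4! move: (bp _ _ _ _ _ _) => ?; ring.
Qed.

Lemma eqH_cd U V p : inH U -> inH V -> eqH U V -> aeq 0 1 (cd p U) (cd p V).
Proof.
move=> /inHP[F hF] [SV _ _ L2V] [/ae_cf E _].
have [_ h] := Hrep_weakD hF.
have hV : Hrep V F.
  case: hF => _ _ hF; split => //; first by case: SV.
  by move=> q; have [Fc Fa F0 F1] := hF q; split => //; apply: aeq_trans (aeq_sym (E q)) _.
by apply: aeq_trans (h p) (aeq_sym ((Hrep_weakD hV).2 p)).
Qed.

Lemma bf_eqH a beta k U V W : inH U -> inH V -> inH W -> eqH U V ->
  bf a beta k U W = bf a beta k V W.
Proof.
move=> hU hV hW UV; have Ed p := eqH_cd p hU hV UV.
case: UV => /ae_cf E1 /ae_cf E2; rewrite !bfE /bp.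
have EE p : [/\ ip (cv p U) (cv p W) = ip (cv p V) (cv p W),
   ip (cu p U) (cv p W) = ip (cu p V) (cv p W), ip (cv p U) (cu p W) = ip (cv p V) (cu p W),
   ip (cu p U) (cu p W) = ip (cu p V) (cu p W) & ip (cd p U) (cd p W) = ip (cd p V) (cd p W)].
  have [U1 U2 U3] := inH_rL2 p hU; have [V1 V2 V3] := inH_rL2 p hV.
  have [W1 W2 W3] := inH_rL2 p hW.
  have key f f' g : rL2 0 1 f -> rL2 0 1 f' -> rL2 0 1 g -> aeq 0 1 f f' -> ip f g = ip f' g.
    by move=> hf hf' hg h; exact: (ip_aeq hf hf' hg hg h (aeq_refl _ _ _)).
  by split; [exact: key (E2 p)|exact: key (E1 p)|exact: key (E2 p)|exact: key (E1 p)|exact: key (Ed p)].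
by have [-> -> -> -> ->] := EE true; have [-> -> -> -> ->] := EE false.
Qed.

Lemma normHE a U : inH U -> normH a U = Num.sqrt (bf a 0 0 U U).
Proof.
move=> hU; rewrite /normH /innerH /cintegral /=; congr Num.sqrt.
have i p f g : rL2 0 1 f -> rL2 0 1 g -> rintegrable 0 1 (fun x => f x * g x) by exact: rL2_mul.
transitivity (rint 0 1 (fun x =>
  (cv true U x * cv true U x + a * (cd true U x * cd true U x)) +
  (cv false U x * cv false U x + a * (cd false U x * cd false U x)))).
  apply: eq_rint => x _; rewrite /cv /cd /cf.
  by case: (weakD _ _ _ _ x) => d1 d2; case: (U.2 x) => v1 v2 /=; ring.
have j p : rintegrable 0 1 (fun x => cv p U x * cv p U x + a * (cd p U x * cd p U x)).
  by apply: rintegrableD; [|apply: rintegrableZ]; apply: rL2_mul; auto.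
rewrite rintD// bfE /bp !ipE !mul0r !addr0.
by congr (_ + _); rewrite rintD ?rintZ//; try apply: rintegrableZ; apply: rL2_mul; auto.
Qed.

Lemma energyE a U : inH U -> energy a U = 2^-1 * bf a 0 0 U U.
Proof.
move=> hU; rewrite /energy; congr (_ * _).
transitivity (rint 0 1 (fun x =>
  (cv true U x * cv true U x + a * (cd true U x * cd true U x)) +
  (cv false U x * cv false U x + a * (cd false U x * cd false U x)))).
  by apply: eq_rint => x _; rewrite !normc_sq /cv /cd /cf; ring.
have j p : rintegrable 0 1 (fun x => cv p U x * cv p U x + a * (cd p U x * cd p U x)).
  by apply: rintegrableD; [|apply: rintegrableZ]; apply: rL2_mul; auto.
rewrite rintD// bfE /bp !ipE !mul0r !addr0.
by congr (_ + _); rewrite rintD ?rintZ//; try apply: rintegrableZ; apply: rL2_mul; auto.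
Qed.

Lemma bf00_ge0 a U : 0 <= a -> 0 <= bf a 0 0 U U.
Proof.
by move=> a0; rewrite !bfE /bp !mul0r !addr0 !addr_ge0 ?ipxx_ge0// mulr_ge0// ipxx_ge0.
Qed.

Lemma cu_poincare U p : inH U -> pi ^+ 4 * ip (cu p U) (cu p U) <= ip (cd p U) (cd p U).
Proof.
move=> hU; have [F hF] := (inHP U).1 hU; have [_ h] := Hrep_weakD hF.
have [_ _ /(_ p)[Fc Fa F0 F1]] := hF.
have P := poincare (Fc 0%N isT) (Fc 1%N isT) F0 F1.
have r j : (j <= 2)%N -> rL2 0 1 (F p j).
  by move=> j2; exact: (chain_rL2 (k := 2%N) (j := j) ler01 isT Fc j2).
rewrite (@ip_aeq _ (F p 0%N) _ (F p 0%N))//; auto.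
by rewrite (@ip_aeq (cd p U) (F p 2%N) _ (F p 2%N)) ?ipxxE//; auto; exact: h.
Qed.

(* With k = beta^2 + s the form is |v + beta u|^2 + a |u_xx|^2 + s |u|^2. *)
Lemma bp_ge a beta k c U p : inH U -> - ((a - c) * pi ^+ 4) <= k - beta ^+ 2 -> 0 <= c -> c <= a ->
  ip (cv p U) (cv p U) + 2 * beta * ip (cu p U) (cv p U) + beta ^+ 2 * ip (cu p U) (cu p U)
    + c * ip (cd p U) (cd p U) <= bp a beta k p U U.
Proof.
move=> hU sc c0 ca; have P := cu_poincare p hU; have u0 := ipxx_ge0 (cu p U).
rewrite /bp (ipC (cv p U) (cu p U)).
set u := ip (cu p U) (cu p U) in P u0 *; set d := ip (cd p U) (cd p U) in P *.
set m := ip _ _; set v := ip _ _.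
have H1 : 0 <= (k - beta ^+ 2 + (a - c) * pi ^+ 4) * u.
  by rewrite mulr_ge0// -lerBlDr sub0r.
have H2 : 0 <= (a - c) * (d - pi ^+ 4 * u) by rewrite mulr_ge0// subr_ge0.
by nra.
Qed.

Lemma bf_ge_cd a beta k c U : inH U -> - ((a - c) * pi ^+ 4) <= k - beta ^+ 2 -> 0 <= c -> c <= a ->
  c * (ip (cd true U) (cd true U) + ip (cd false U) (cd false U)) <= bf a beta k U U.
Proof.
move=> hU sc c0 ca; rewrite !bfE mulrDr; apply: lerD.
  apply: le_trans (bp_ge true hU sc c0 ca); rewrite lerDr.
  by apply: ip_sqD; auto.
apply: le_trans (bp_ge false hU sc c0 ca); rewrite lerDr.
by apply: ip_sqD; auto.
Qed.

Lemma bf_linr a beta k c U V W : inH U -> inH V -> inH W ->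
  bf a beta k W (c%:C *: U + V) = c * bf a beta k W U + bf a beta k W V.
Proof. by move=> hU hV hW; rewrite bfC bf_lin// (bfC _ _ _ U W) (bfC _ _ _ V W). Qed.

Lemma bf_sqD a beta k c U V : inH U -> inH V ->
  bf a beta k (c%:C *: U + V) (c%:C *: U + V) =
  c ^+ 2 * bf a beta k U U + 2 * c * bf a beta k V U + bf a beta k V V.
Proof.
move=> hU hV; have hL := inH_lin c hU hV.
rewrite bf_lin// !bf_linr// (_ : bf a beta k U V = bf a beta k V U); last exact: bfC.
by do 3! move: (bf _ _ _ _ _) => ?; ring.
Qed.

Lemma bf_eqH2 a beta k U V : inH U -> inH V -> eqH U V -> bf a beta k U U = bf a beta k V V.
Proof.
by move=> hU hV UV; rewrite (bf_eqH _ _ _ hU hV hU UV) bfC (bf_eqH _ _ _ hU hV hV UV).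
Qed.

Lemma normH_sq a U : 0 <= a -> inH U -> normH a U ^+ 2 = bf a 0 0 U U.
Proof. by move=> a0 hU; rewrite normHE// sqr_sqrtr// bf00_ge0. Qed.

Lemma normH_ge0 a U : 0 <= normH a U.
Proof. exact: sqrtr_ge0. Qed.

End EnergyForms.

(** * The dissipation estimate and equivalence of the form with the energy *)

Section Dissipation.
Local Open Scope classical_set_scope.
Local Open Scope complex_scope.
Context {R : realType}.
Implicit Types (a b c k alpha beta xi : R) (p : bool) (U V W : state R) (f g h : R -> R).

(* The damping constant of the form, [k = 2 beta ^+ 2 - b * beta], is chosen so that the
   cross terms recombine into [(2 beta - b) |v + beta u|^2]. *)
Lemma dissipation a b alpha xi beta c k U : 0 < a -> 0 < xi -> xi < 1 -> 0 < alpha ->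
  0 <= beta -> 2 * beta <= b -> 0 < c -> c <= a ->
  k = 2 * beta ^+ 2 - b * beta -> - ((a - c) * pi ^+ 4) <= k - beta ^+ 2 ->
  domA a alpha xi U ->
  bf a beta k U (opA a b alpha xi U) <=
  - (beta - alpha * beta ^+ 2 / (4 * c * pi ^+ 2)) * bf a beta k U U.
Proof.
move=> a0 xi0 xi1 al0 be0 beb c0 ca kE sc dU.
have [Y [Z [F [G hU]]]] := (domAP a alpha xi0 xi1 U).1 dU.
have iU := domA_inH xi0 xi1 dU; have iA := opA_inH b a0 xi0 xi1 dU.
have [Lw spec] := opA_spec b a0 xi0 xi1 hU; have [hF _ h] := hU.
set A := opA a b alpha xi U in iA spec Lw *.
have pi0 : 0 < pi :> R := pi_gt0 R.
have key p : bp a beta k p U A <= - (beta - alpha * beta ^+ 2 / (4 * c * pi ^+ 2)) * bp a beta k p U U.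
  have [U1r U2r U3r] := inH_rL2 p iU; have [A1r A2r A3r] := inH_rL2 p iA.
  have [_ _ [Gc Ga G0 G1] _] := h p; have [_ _ /(_ p)[Fc Fa F0 F1]] := hF.
  have rF j : (j <= 2)%N -> rL2 0 1 (F p j).
    by move=> j2; exact: (chain_rL2 (k := 2%N) (j := j) ler01 isT Fc j2).
  have rG j : (j <= 2)%N -> rL2 0 1 (G p j).
    by move=> j2; exact: (chain_rL2 (k := 2%N) (j := j) ler01 isT Gc j2).
  have Fd : aeq 0 1 (cd p U) (F p 2%N) by exact: (Hrep_weakD hF).2.
  have hA : Hrep A G by split=> [||q]; [by case: iA => -[]|exact: Lw|case: (h q) => _ _ []].
  have Gd : aeq 0 1 (cd p A) (G p 2%N) by exact: (Hrep_weakD hA).2.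
  have Ev : aeq 0 1 (cv p U) (G p 0%N) by exact: Ga.
  have Eu : aeq 0 1 (cu p U) (F p 0%N) by exact: Fa.
  have S1 := spec p _ _ _ (Gc 0%N isT) (Gc 1%N isT) G0 G1.
  have S2 := spec p _ _ _ (Fc 0%N isT) (Fc 1%N isT) F0 F1.
  rewrite -!ipE in S1 S2.
  have T := trace_bound xi0 xi1 (Fc 0%N isT) (Fc 1%N isT) F0 F1.
  rewrite -ipxxE in T.
  have B := bp_ge p iU sc (ltW c0) ca.
  have I1 := ip_sqD beta U2r U1r.
  have E1 : ip (cv p U) (cv p A) = ip (cf p A.2) (G p 0%N).
    by rewrite ipC; apply: ip_aeq => //; [exact: rG|exact: aeq_refl].
  have E2 : ip (cu p U) (cv p A) = ip (cf p A.2) (F p 0%N).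
    by rewrite ipC; apply: ip_aeq => //; [exact: rF|exact: aeq_refl].
  have E3 : ip (cd p U) (cd p A) = ip (F p 2%N) (G p 2%N).
    by apply: ip_aeq => //; [exact: rF|exact: rG].
  have E4 : ip (cd p U) (cd p U) = ip (F p 2%N) (F p 2%N).
    by apply: ip_aeq => //; exact: rF.
  have E5 : ip (cf p U.2) (G p 0%N) = ip (cv p U) (cv p U).
    by apply: ip_aeq => //; [exact: rG|exact: aeq_refl|exact: aeq_sym].
  have E6 : ip (cf p U.2) (F p 0%N) = ip (cu p U) (cv p U).
    by rewrite ipC; apply: ip_aeq => //; [exact: rF|exact: aeq_sym|exact: aeq_refl].
  have E7 : cu p A = cv p U by [].
  rewrite E5 in S1; rewrite E6 in S2; rewrite E4 in B.
  rewrite /bp E4 in B; rewrite /bp E7 E1 E2 E3 S1 S2 E4; move: B I1 T.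
  rewrite !(ipC (cv p U) (cu p U)).
  move: (ip (cv p U) _) (ip (cu p U) (cv p U)) (ip (cu p U) (cu p U)) (ip (F p 2%N) (F p 2%N))
    (ip (F p 2%N) (G p 2%N)) (F p 0%N xi) (G p 0%N xi) => VV UV UU FF FG f g B I1 T.
  (* With this [q] the remainder [alpha (beta u(xi) / 2)^2] of completing the square in [v(xi)]
     equals [q c pi^2 u(xi)^2]. The trace bound turns it into [q c |u_xx|^2], which is at most [q]
     times the form. *)
  set q := alpha * beta ^+ 2 / (4 * c * pi ^+ 2).
  have q0 : 0 <= q.
    apply: divr_ge0; first by rewrite mulr_ge0 ?sqr_ge0// ltW.
    by rewrite mulr_ge0 ?sqr_ge0// mulr_ge0// ltW.
  have qE : q * c * pi ^+ 2 * f ^+ 2 = alpha * (beta * f / 2) ^+ 2.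
    rewrite /q; have : 0 < pi ^+ 2 :> R by rewrite exprn_gt0.
    by move: (pi ^+ 2) => P P0; field; rewrite !gt_eqF.
  have H1 : 0 <= (b - 2 * beta) * (VV + 2 * beta * UV + beta ^+ 2 * UU).
    by rewrite mulr_ge0// subr_ge0.
  have H2 : 0 <= alpha * (g + beta * f / 2) ^+ 2 by rewrite mulr_ge0 ?sqr_ge0// ltW.
  have H3 : 0 <= q * c * (FF - pi ^+ 2 * f ^+ 2).
    by apply: mulr_ge0; [apply: mulr_ge0 => //; exact: ltW|rewrite subr_ge0].
  have H4 : 0 <= q * (VV + beta * (UV + UV) + k * UU + a * FF
      - (VV + 2 * beta * UV + beta ^+ 2 * UU + c * FF)) by rewrite mulr_ge0// subr_ge0.
  have H5 : 0 <= q * (VV + 2 * beta * UV + beta ^+ 2 * UU) by rewrite mulr_ge0.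
  by rewrite kE in H4 *; lra.
rewrite !bfE mulrDr; apply: lerD; exact: key.
Qed.

Lemma cu_le_cd U p : inH U -> ip (cu p U) (cu p U) <= ip (cd p U) (cd p U) / pi ^+ 4.
Proof.
by move=> hU; rewrite ler_pdivlMr ?exprn_gt0 ?pi_gt0// mulrC; exact: cu_poincare.
Qed.

Lemma bf_lower a beta c k U : inH U -> 0 <= a -> 0 < c -> c <= a ->
  - ((a - c) * pi ^+ 4) <= k - beta ^+ 2 ->
  bf a 0 0 U U <= (2 + (2 * beta ^+ 2 / pi ^+ 4 + a) / c) * bf a beta k U U.
Proof.
move=> hU a0 c0 ca sc; have p4 : 0 < pi ^+ 4 :> R by rewrite exprn_gt0// pi_gt0.
have key p : bp a 0 0 p U U <= (2 + (2 * beta ^+ 2 / pi ^+ 4 + a) / c) * bp a beta k p U U.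
  have [ru rv _] := inH_rL2 p hU.
  have B := bp_ge p hU sc (ltW c0) ca; have P := cu_le_cd p hU.
  have I1 := ip_sqD beta rv ru; have I2 := ip_sqD (2 * beta) rv ru; have D0 := ipxx_ge0 (cd p U).
  rewrite [X in X <= _]/bp; move: (bp _ _ _ _ _ _) B P I1 I2 D0.
  move: (ip (cv p U) (cv p U)) (ip (cu p U) (cv p U)) (ip (cv p U) (cu p U))
    (ip (cu p U) (cu p U)) (ip (cd p U) (cd p U)) => VV UV VU UU DD Phi B P I1 I2 D0.
  have H1 : 0 <= (2 * beta ^+ 2) * (DD / pi ^+ 4 - UU).
    by rewrite mulr_ge0 ?subr_ge0// mulr_ge0 ?sqr_ge0.
  have m0 : 0 <= (2 * beta ^+ 2 / pi ^+ 4 + a) / c.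
    by rewrite divr_ge0 ?(ltW c0)// addr_ge0// divr_ge0 ?(ltW p4)// mulr_ge0 ?sqr_ge0.
  have H2 : 0 <= (2 * beta ^+ 2 / pi ^+ 4 + a) / c * (Phi - c * DD).
    by rewrite mulr_ge0// subr_ge0; lra.
  have E : (2 * beta ^+ 2 / pi ^+ 4 + a) / c * (c * DD) = 2 * beta ^+ 2 * (DD / pi ^+ 4) + a * DD.
    by move: p4; move: (pi ^+ 4) => q q0; field; rewrite !gt_eqF.
  have cD : 0 <= c * DD by rewrite mulr_ge0// ltW.
  rewrite mulrBr E in H2; rewrite mulrDl; move: H2; set m := _ / c * Phi => H2; lra.
by rewrite !bfE mulrDr; apply: lerD; exact: key.
Qed.

(** The cross term is at most [|v|^2 + beta^2 |u|^2], and [k + beta^2 <= 3 beta^2]. *)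
Lemma bf_upper a beta k U : inH U -> 0 < a -> k <= 2 * beta ^+ 2 ->
  bf a beta k U U <= (2 + 3 * beta ^+ 2 / (a * pi ^+ 4)) * bf a 0 0 U U.
Proof.
move=> hU a0 kb; have p4 : 0 < pi ^+ 4 :> R by rewrite exprn_gt0// pi_gt0.
have key p : bp a beta k p U U <= (2 + 3 * beta ^+ 2 / (a * pi ^+ 4)) * bp a 0 0 p U U.
  have [ru rv _] := inH_rL2 p hU.
  have P := cu_le_cd p hU.
  have I1 := ip_sqD (- beta) rv ru; have D0 := ipxx_ge0 (cd p U); have V0 := ipxx_ge0 (cv p U).
  have U0 := ipxx_ge0 (cu p U).
  rewrite /bp (ipC (cv p U) (cu p U)); move: P I1 D0 V0 U0.
  move: (ip (cv p U) (cv p U)) (ip (cu p U) (cv p U))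
    (ip (cu p U) (cu p U)) (ip (cd p U) (cd p U)) => VV UV UU DD P I1 D0 V0 U0.
  have H1 : 0 <= (3 * beta ^+ 2) * (DD / pi ^+ 4 - UU).
    by rewrite mulr_ge0 ?subr_ge0// mulr_ge0 ?sqr_ge0.
  have H2 : 0 <= (2 * beta ^+ 2 - k) * UU by rewrite mulr_ge0// subr_ge0.
  have H3 : 0 <= 3 * beta ^+ 2 / (a * pi ^+ 4) * VV.
    apply: mulr_ge0 => //; apply: divr_ge0; first by rewrite mulr_ge0 ?sqr_ge0.
    by rewrite mulr_ge0// ltW.
  have E : 3 * beta ^+ 2 / (a * pi ^+ 4) * (a * DD) = 3 * beta ^+ 2 * (DD / pi ^+ 4).
    by move: p4; move: (pi ^+ 4) => q q0; field; rewrite !gt_eqF.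
  have aD : 0 <= a * DD by rewrite mulr_ge0// ltW.
  rewrite !mul0r !addr0 [leRHS]mulrDl [X in _ <= _ + X]mulrDr E.
  by move: H3; set m := _ / _ * VV => H3; lra.
by rewrite !bfE mulrDr; apply: lerD; exact: key.
Qed.

Lemma sqrt_form_triangle (x y m : R) : 0 <= x -> 0 <= y -> (forall s, 0 <= s ^+ 2 * x + 2 * s * m + y) ->
  Num.sqrt (x + 2 * m + y) <= Num.sqrt x + Num.sqrt y.
Proof.
move=> x0 y0 h; have mxy : m ^+ 2 <= x * y.
  move: x0; rewrite le_eqVlt => /orP[/eqP x0|x0].
    have [->|m0] := eqVneq m 0; first by rewrite expr0n/= mulr_ge0// -x0.
    (* For [x = 0] and [m != 0] this [s] gives the form the value [-1]. *)
    have := h (- (y + 1) / (2 * m)); rewrite -x0.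
    by rewrite (_ : _ + _ + y = -1) ?ler0N1//; field.
  have := h (- m / x); rewrite (_ : _ + _ + _ = (x * y - m ^+ 2) / x); last by field; rewrite gt_eqF.
  by rewrite pmulr_lge0 ?invr_gt0// subr_ge0.
have m_le : m <= Num.sqrt x * Num.sqrt y.
  rewrite -sqrtrM//; apply: le_trans (ler_norm _) _.
  by rewrite -sqrtr_sqr; exact: ler_wsqrtr.
rewrite -[leRHS]ger0_norm ?addr_ge0 ?sqrtr_ge0// -sqrtr_sqr; apply: ler_wsqrtr.
by rewrite sqrrD !sqr_sqrtr// lerD2r lerD2l mulr2n; lra.
Qed.

Lemma normHD a U V : 0 <= a -> inH U -> inH V -> normH a (U + V) <= normH a U + normH a V.
Proof.
move=> a0 hU hV; have E c := @bf_sqD R a 0 0 c V U hV hU.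
have hUV : inH (U + V) by have := inH_lin 1 hV hU; rewrite scale1r addrC.
rewrite !normHE// [leRHS]addrC.
have := E 1; rewrite scale1r expr1n mul1r mulr1 [V + U]addrC => ->.
apply: sqrt_form_triangle; [exact: bf00_ge0|exact: bf00_ge0|].
by move=> s; rewrite -E; apply: bf00_ge0 => //; exact: inH_lin.
Qed.
End Dissipation.

(** * A one-sided differential inequality *)

Section Comparison.
Local Open Scope classical_set_scope.
Context {R : realType}.
Implicit Types (f g : R -> R) (c gamma s t e d h : R).

Lemma continuous_eps g : continuous g -> forall t e, 0 < e -> exists2 d, 0 < d &
  forall s, `|s - t| < d -> `|g s - g t| <= e.
Proof.
move=> cg t e e0; have /cvgrPdist_le /(_ e e0) := cg t.
move=> /nbhs_ballP[d /= d0 hd]; exists d => // s sd.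
by rewrite distrC; apply: hd; rewrite /ball/= distrC.
Qed.

(** For each slope [e > 0] the supremum of the points where [g x <= g s + e (x - s)] belongs to that
    set by continuity and can be moved to the right while below [t]. The hypothesis concerns
    positive times only, so the start [s = 0] is reached by continuity. *)
Lemma dini_nonincreasing g : continuous g ->
  (forall t, 0 < t -> forall e, 0 < e -> exists2 d, 0 < d &
    forall h, 0 < h -> h < d -> g (t + h) - g t <= e * h) ->
  forall s t, 0 <= s -> s <= t -> g t <= g s.
Proof.
move=> cg dg.
have pos s t : 0 < s -> s <= t -> g t <= g s.
  move=> s0 st; apply/ler_addgt0Pr => e0 e00.
  have ts0 : 0 < t - s + 1 by rewrite ltr_wpDl ?subr_ge0.
  (* The slope is scaled so that the total rise over [[s, t]] stays below [e0]; the [+ 1] covers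
     [s = t]. *)
  pose e := e0 / (t - s + 1); have e_gt0 : 0 < e by rewrite divr_gt0.
  pose A := [set x | s <= x <= t /\ g x <= g s + e * (x - s)].
  have As : A s by split; rewrite ?lexx ?st// subrr mulr0 addr0.
  have Aub : ubound A t by move=> x [/andP[]].
  have hsA : has_sup A by split; [exists s|exists t].
  have sA : s <= sup A by apply: ub_le_sup As; exists t.
  have At : sup A <= t by apply: ge_sup => //; exists s.
  have Asup : g (sup A) <= g s + e * (sup A - s).
    rewrite leNgt; apply/negP => lt1.
    pose e1 := (g (sup A) - (g s + e * (sup A - s))) / 2.
    have e10 : 0 < e1 by rewrite divr_gt0// subr_gt0.
    have [d d0 hd] := continuous_eps cg (sup A) e10.
    have [x Ax xd] := sup_adherent d0 hsA.
    have xA : x <= sup A by apply: ub_le_sup Ax; exists t.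
    have := hd x; rewrite distrC ger0_norm ?subr_ge0// ltrBlDr -ltrBlDl => /(_ xd).
    rewrite ler_norml => /andP[h1 _]; case: Ax => _ h2.
    have : e * (x - s) <= e * (sup A - s) by rewrite ler_pM2l// lerD2r.
    by move: h1 h2 lt1; rewrite /e1; lra.
  have supt : sup A = t.
    apply/eqP; rewrite eq_le At/= leNgt; apply/negP => lt1.
    have [d d0 hd] := dg (sup A) (lt_le_trans s0 sA) e e_gt0.
    pose h := Num.min d (t - sup A) / 2.
    have m0 : 0 < Num.min d (t - sup A) by rewrite lt_min d0 subr_gt0.
    have h0 : 0 < h by rewrite divr_gt0.
    have hm : h < Num.min d (t - sup A) by rewrite /h; lra.
    move: (hm); rewrite lt_min => /andP[hd1 hd2].
    have : A (sup A + h).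
      split; first by apply/andP; split; move: sA h0 hd2; lra.
      by have := hd h h0 hd1; move: Asup; nra.
    by move/(ub_le_sup (ex_intro _ t Aub)); rewrite gerDl leNgt h0.
  move: Asup; rewrite supt => /le_trans; apply; rewrite lerD2l /e mulrAC -mulrA ger_pMr//.
  by rewrite ler_pdivrMr// mul1r lerDl.
move=> s t; rewrite le_eqVlt => /orP[/eqP<-|]; last exact: pos.
rewrite le_eqVlt => /orP[/eqP<-//|t0]; apply/ler_addgt0Pr => e e0.
have [d d0 hd] := continuous_eps cg 0 e0.
pose s0 := Num.min (d / 2) t.
have s00 : 0 < s0 by rewrite lt_min divr_gt0.
have := hd s0; rewrite subr0 gtr0_norm//.
have /[swap]/[apply] : s0 < d by rewrite gt_min; apply/orP; left; lra.
rewrite ler_norml => /andP[_ h2].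
have : g t <= g s0 by apply: pos => //; rewrite ge_min lexx orbT.
by move: h2; lra.
Qed.

Definition econt f := forall t, 0 <= t -> forall e, 0 < e -> exists2 d, 0 < d &
  forall s, 0 <= s -> `|s - t| < d -> `|f s - f t| <= e.

(** Freezing [f] at its value at 0 on the negative axis gives a function continuous on the whole
    line. *)
Lemma econt_max f : econt f -> continuous (fun t => f (Num.max t 0)).
Proof.
move=> cf t; apply/cvgrPdist_le => e e0.
have tm : 0 <= Num.max t 0 by rewrite le_max lexx orbT.
have [d d0 hd] := cf (Num.max t 0) tm e e0.
apply/nbhs_ballP; exists d => //= s; rewrite /ball/= => st.
rewrite distrC; apply: hd; first by rewrite le_max lexx orbT.
rewrite distrC; apply: le_lt_trans st.
case: (leP t 0) => t0; case: (leP s 0) => s0; rewrite ?subrr ?normr0 ?normr_ge0//.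
- by rewrite sub0r normrN gtr0_norm// ler0_norm; lra.
- by rewrite subr0 gtr0_norm// ger0_norm; lra.
Qed.

(** Multiplication by [expR (2 gamma t)] turns the inequality into a right Dini condition, using
    [1 - z <= expR (- z)]. *)
Lemma decay_comparison f gamma : econt f -> (forall t, 0 <= t -> 0 <= f t) ->
  (forall t, 0 < t -> forall e, 0 < e -> exists2 d, 0 < d &
    forall h, 0 < h -> h < d -> f (t + h) <= (1 - 2 * gamma * h) * f t + e * h) ->
  forall t, 0 <= t -> f t <= expR (- (2 * gamma * t)) * f 0.
Proof.
move=> cf f0 df t t0.
pose g x := expR (2 * gamma * x) * f (Num.max x 0).
have gE x : 0 <= x -> g x = expR (2 * gamma * x) * f x by move=> x0; rewrite /g max_l.
have cg : continuous g.
  move=> x; apply: cvgM; last exact: econt_max.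
  by apply: continuous_comp; [exact: mulrl_continuous|exact: continuous_expR].
suff : g t <= g 0.
  rewrite !gE// mulr0 expR0 mul1r expRN => h.
  by rewrite mulrC ler_pdivlMr ?expR_gt0// mulrC.
apply: dini_nonincreasing => // {t t0} t t0 e e0.
(* [K] bounds the exponential weight on [[t, t + 1]] for either sign of [gamma], so the error
   [e / K] becomes at most [e] after weighting. *)
set K := expR (2 * `|gamma| * (t + 1)).
have K0 : 0 < K by exact: expR_gt0.
have [d d0 hd] := df t t0 (e / K) (divr_gt0 e0 K0).
exists (Num.min d 1); first by rewrite lt_min d0 ltr01.
move=> h h0; rewrite lt_min => /andP[hd' h1].
have th0 : 0 <= t + h by rewrite addr_ge0 ?ltW.
rewrite (gE _ th0) (gE _ (ltW t0)) lerBlDr.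
apply: (@le_trans _ _ (expR (2 * gamma * (t + h)) * ((1 - 2 * gamma * h) * f t + e / K * h))).
  by rewrite ler_pM2l ?expR_gt0//; exact: hd.
rewrite mulrDr addrC; apply: lerD.
  rewrite (_ : _ * _ = (expR (2 * gamma * (t + h)) / K) * (e * h)); last first.
    by move: (expR _) => X; field; rewrite gt_eqF.
  apply: ler_piMl; first by rewrite mulr_ge0// ltW.
  rewrite ler_pdivrMr// mul1r /K ler_expR.
  have n0 : 0 <= `|gamma| by [].
  by have := ler_norm gamma; nra.
rewrite mulrA; apply: ler_wpM2r; first exact/f0/ltW.
rewrite (mulrDr (2 * gamma) t h) expRD -mulrA ger_pMr ?expR_gt0//.
have := expR_ge1Dx (- (2 * gamma * h)); rewrite expRN => h2.
by rewrite mulrC -ler_pdivlMr ?expR_gt0// mul1r.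
Qed.

End Comparison.

(** * Decay of the form along a differentiable curve *)

Section FormDecay.
Local Open Scope classical_set_scope.
Local Open Scope complex_scope.
Context {R : realType}.
Variables (a be k M : R).
Hypotheses (a0 : 0 <= a) (M0 : 0 < M).
Implicit Types (U V W : state R) (s t e d h eta : R).
Local Notation Phi U := (bf a be k U U).
Hypothesis Phi_ge0 : forall U, inH U -> 0 <= Phi U.
Hypothesis Phi_le : forall U, inH U -> Phi U <= M * normH a U ^+ 2.

(** Nonnegativity of the form at [U + W / eta] and [U - W / eta], multiplied by [eta]. *)
Lemma form_young eta U W : 0 < eta -> inH U -> inH W ->
  `|2 * bf a be k U W| <= eta * Phi U + Phi W / eta.
Proof.
move=> e0 hU hW.
have key c : 0 <= c ^+ 2 * Phi W + 2 * c * bf a be k U W + Phi U.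
  by rewrite -bf_sqD//; apply: Phi_ge0; exact: inH_lin.
have h1 := key eta^-1; have h2 := key (- eta^-1).
move: h1 h2; move: (bf _ _ _ _ _) (bf _ _ _ _ _) (bf _ _ _ _ _) => z x y h1 h2.
have {}h1 : 0 <= eta * (eta^-1 ^+ 2 * y + 2 * eta^-1 * x + z) by rewrite mulr_ge0// ltW.
have {}h2 : 0 <= eta * ((- eta^-1) ^+ 2 * y + 2 * - eta^-1 * x + z) by rewrite mulr_ge0// ltW.
have E1 : eta * (eta^-1 ^+ 2 * y + 2 * eta^-1 * x + z) = y / eta + 2 * x + eta * z.
  by field; rewrite gt_eqF.
have E2 : eta * ((- eta^-1) ^+ 2 * y + 2 * - eta^-1 * x + z) = y / eta - 2 * x + eta * z.
  by field; rewrite gt_eqF.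
by rewrite E1 in h1; rewrite E2 in h2; rewrite ler_norml; apply/andP; split; lra.
Qed.

Lemma inHB U V : inH U -> inH V -> inH (U - V).
Proof.
by move=> hU hV; have := inH_lin (-1) hV hU; rewrite rmorphN1 scaleN1r addrC.
Qed.

Lemma Phi_small_at e : 0 < e -> exists2 d, 0 < d & forall W, inH W -> normH a W <= d -> Phi W <= e.
Proof.
move=> e0; exists (Num.sqrt (e / M)); first by rewrite sqrtr_gt0 divr_gt0.
move=> W hW hd; apply: le_trans (Phi_le hW) _.
rewrite mulrC -ler_pdivlMr// -[leRHS]sqr_sqrtr; last by rewrite divr_ge0 ?(ltW M0) ?(ltW e0).
by rewrite ler_sqr ?nnegrE ?normH_ge0 ?sqrtr_ge0.
Qed.

Definition econtH (V : R -> state R) := forall t, 0 <= t -> forall e, 0 < e ->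
  exists2 d, 0 < d & forall s, 0 <= s -> `|s - t| < d -> normH a (V s - V t) <= e.

Lemma econt_Phi (V : R -> state R) : (forall t, 0 <= t -> inH (V t)) -> econtH V ->
  econt (fun t => Phi (V t)).
Proof.
move=> hV cV t t0 e e0; have hVt := hV t t0; have P0 := Phi_ge0 hVt.
have P1 : 0 < Phi (V t) + 1 by rewrite ltr_wpDl.
pose eta := e / (2 * (Phi (V t) + 1)).
have eta0 : 0 < eta by rewrite divr_gt0// mulr_gt0.
have i0 : 0 < 1 + eta^-1 by rewrite addr_gt0 ?invr_gt0.
have e20 : 0 < e / 2 / (1 + eta^-1) by rewrite !divr_gt0.
have [e1 e10 he1] := Phi_small_at e20.
have [d d0 hd] := cV t t0 e1 e10; exists d => // s s0 sd.
have hW := inHB (hV s s0) hVt.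
have W2 := he1 _ hW (hd s s0 sd); have W0 := Phi_ge0 hW.
rewrite ler_pdivlMr// mulrDr mulr1 in W2; move: W2.
have E := bf_sqD a be k 1 hW hVt.
rewrite scale1r subrK expr1n mul1r mulr1 in E.
have := form_young eta0 hVt hW.
have : eta * Phi (V t) <= e / 2.
  rewrite (_ : eta * _ = e / 2 * (Phi (V t) / (Phi (V t) + 1))).
    by apply: ler_piMr; [rewrite divr_ge0// ltW|rewrite ler_pdivrMr// mul1r lerDl].
  by rewrite /eta; field; rewrite gt_eqF.
rewrite E; move: (eta * _) (_ / eta) => x y.
by rewrite !ler_norml => hx /andP[h1 h2] h3; apply/andP; split; lra.
Qed.

(** With [W] the error of the difference quotient, [V (t + h) = V t + h (A t + W)]. Expanding the
    form gives [Phi + 2 h <V, A>], controlled by the dissipation, and the errors [2 h <V, W>] and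
    [h^2 Phi (A + W)], which together are at most [e h] for small [h]. *)
Lemma form_decay gamma (V A : R -> state R) :
  (forall t, 0 <= t -> inH (V t)) -> (forall t, 0 < t -> inH (A t)) -> econtH V ->
  (forall t, 0 < t -> forall e, 0 < e -> exists2 d, 0 < d & forall h, 0 < h -> h < d ->
    normH a ((h^-1)%:C *: (V (t + h) - V t) - A t) <= e) ->
  (forall t, 0 < t -> bf a be k (V t) (A t) <= - gamma * Phi (V t)) ->
  forall t, 0 <= t -> Phi (V t) <= expR (- (2 * gamma * t)) * Phi (V 0).
Proof.
move=> hV hA cV dV diss.
apply: (decay_comparison (f := fun t => Phi (V t)) (econt_Phi hV cV)) => [t t0|t t0 e e0].
  exact/Phi_ge0/hV.
have hVt := hV t (ltW t0); have hAt := hA t t0.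
have P0 := Phi_ge0 hVt; have A0 := Phi_ge0 hAt.
have P1 : 0 < Phi (V t) + 1 by rewrite ltr_wpDl.
have [eta eta0 etaP] : exists2 eta, 0 < eta & eta * Phi (V t) <= e / 3.
  exists (e / (3 * (Phi (V t) + 1))); first by rewrite divr_gt0// mulr_gt0.
  rewrite (_ : _ * Phi (V t) = e / 3 * (Phi (V t) / (Phi (V t) + 1))).
    by apply: ler_piMr; [rewrite divr_ge0// ltW|rewrite ler_pdivrMr// mul1r lerDl].
  by field; rewrite gt_eqF.
(* The bound 1 serves in the [h^2] term; the other one makes [Phi W / eta <= e / 3] in the Young
   inequality. *)
have e20 : 0 < Num.min 1 (e / 3 * eta) by rewrite lt_min ltr01 mulr_gt0// divr_gt0.
have [e1 e10 he1] := Phi_small_at e20.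
have [d d0 hd] := dV t t0 e1 e10.
have q0 : 0 < 2 + 2 * Phi (A t) by rewrite ltr_wpDr// mulr_ge0.
exists (Num.min d (e / 3 / (2 + 2 * Phi (A t)))).
  by rewrite lt_min d0 !divr_gt0.
move=> h h0; rewrite lt_min ltr_pdivlMr// => /andP[/(hd h h0) hR hq].
have hVh : inH (V (t + h)) by apply: hV; rewrite addr_ge0// ltW.
move: hR; set W := (X in normH a X) => hR; have WE : W = (h^-1)%:C *: (V (t + h) - V t) - A t by [].
move: (W : state R) WE hR => {}W WE hR.
have hW : inH W.
  rewrite WE; apply: inHB => //; have hz : inH (0 : state R).
    by rewrite -(subrr (V t)); exact: inHB.
  by rewrite -[X in inH X]addr0; apply: inH_lin => //; exact: inHB.
have := he1 _ hW hR; rewrite le_min => /andP[W1]; rewrite -ler_pdivrMr// => W2.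
have W0 := Phi_ge0 hW.
have EV : V (t + h) = h%:C *: (1%:C *: W + A t) + V t.
  rewrite scale1r WE subrK scalerA -rmorphM/= divff ?gt_eqF// scale1r.
  by rewrite subrK.
have hQ := inH_lin 1 hW hAt.
have Y := form_young eta0 hVt hW.
have YA := form_young ltr01 hAt hW.
have E1 := bf_sqD a be k h hQ hVt; have E2 := bf_sqD a be k 1 hW hAt.
have E3 := bf_linr a be k 1 hW hAt hVt.
rewrite -EV in E1; rewrite E1 E3 E2 expr1n !mul1r mulr1.
have D := diss t t0; move: W0 W1 W2 Y YA D hq etaP A0 P0.
rewrite mul1r divr1.
move: (bf _ _ _ W W) (_ / eta) (bf _ _ _ (V t) W) (bf _ _ _ (A t) W) (bf _ _ _ (V t) (A t)).
move: (bf _ _ _ (A t) _) (bf _ _ _ (V t) (V t)) => AA f WW We VW AW VA.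
rewrite !ler_norml => W0 W1 W2 /andP[_ Y] /andP[_ YA] D hq etaP A0 P0.
have Q : WW + 2 * AW + AA <= 2 + 2 * AA by lra.
have H3 : h * (h * (WW + 2 * AW + AA)) <= h * (e / 3).
  rewrite ler_pM2l//; apply: le_trans (ltW hq); by rewrite ler_pM2l.
have H1 : h * (2 * VW) <= h * (e / 3 + e / 3) by rewrite ler_pM2l//; lra.
have H2 : h * VA <= h * (- gamma * f) by rewrite ler_pM2l.
by move: H1 H2 H3; nra.
Qed.

End FormDecay.

(** * Completeness of the energy space *)

Section EnergySpace.
Local Open Scope classical_set_scope.
Local Open Scope complex_scope.
Context {R : realType}.
Variables (a : R).
Hypothesis (a0 : 0 < a).
Implicit Types (U V W X : state R) (s t e d h c N K : R) (p : bool).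

Lemma inH0 : inH (0 : state R).
Proof.
apply/inHP; exists (fun _ _ _ => 0).
have z l r : rL2 l r (fun=> 0 : R) by exact: rL2_cst.
split; [by apply/L2P => -[]; exact: z|by apply/L2P => -[]; exact: z|move=> p; split => //].
- move=> j _; split => // x /andP[x0 _]; rewrite add0r; apply/esym.
  by apply: eq0_rint => y _.
- by case: p; exact: aeq_refl.
Qed.

Lemma inHZ c U : inH U -> inH (c%:C *: U).
Proof. by move=> hU; have := inH_lin c hU inH0; rewrite addr0. Qed.

Lemma inHD U V : inH U -> inH V -> inH (U + V).
Proof. by move=> hU hV; have := inH_lin 1 hU hV; rewrite scale1r. Qed.

Lemma normH_eqH U V : inH U -> inH V -> eqH U V -> normH a U = normH a V.
Proof. by move=> hU hV UV; rewrite !normHE// (bf_eqH2 _ _ _ hU hV UV). Qed.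

Lemma normHZ c U : inH U -> normH a (c%:C *: U) = `|c| * normH a U.
Proof.
move=> hU; have hz := inHZ c hU.
have : bf a 0 0 (c%:C *: U) (c%:C *: U) = c ^+ 2 * bf a 0 0 U U.
  have h00 : bf a 0 0 (0 : state R) (0 : state R) = 0.
    have := bf_lin a 0 0 (-1) hU hU inH0; rewrite rmorphN1 scaleN1r addNr mulN1r addNr => E0.
    by have := bf_lin a 0 0 (-1) inH0 inH0 inH0; rewrite rmorphN1 scaleN1r addNr mulN1r addNr.
  have h0U : bf a 0 0 (0 : state R) U = 0.
    by have := bf_lin a 0 0 (-1) hU hU hU; rewrite rmorphN1 scaleN1r addNr mulN1r addNr.
  by have := bf_sqD a 0 0 c hU inH0; rewrite addr0 h00 h0U mulr0 !addr0.
by rewrite !normHE// => ->; rewrite sqrtrM ?sqr_ge0// sqrtr_sqr.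
Qed.

Lemma normH00 : normH a (0 : state R) = 0.
Proof. by have := normHZ 0 inH0; rewrite normr0 mul0r rmorph0 scale0r. Qed.

Lemma normHN U : inH U -> normH a (- U) = normH a U.
Proof. by move=> hU; have := normHZ (-1) hU; rewrite rmorphN1 scaleN1r normrN1 mul1r. Qed.

Lemma normHB_sym U V : inH U -> inH V -> normH a (U - V) = normH a (V - U).
Proof. by move=> hU hV; rewrite -normHN ?opprB//; exact: inHB. Qed.

Lemma normHB_le U V W : inH U -> inH V -> inH W ->
  normH a (U - W) <= normH a (U - V) + normH a (V - W).
Proof.
move=> hU hV hW; have := normHD (ltW a0) (inHB hU hV) (inHB hV hW).
by rewrite addrA subrK.
Qed.

Lemma normH_le_add U V : inH U -> inH V -> normH a U <= normH a V + normH a (U - V).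
Proof.
by move=> hU hV; have := normHD (ltW a0) hV (inHB hU hV); rewrite addrCA subrr addr0.
Qed.

Lemma normHB_sq U V : inH U -> inH V -> normH a (U - V) ^+ 2 =
  (rint 0 1 (fun x => (cv true U x - cv true V x) ^+ 2) +
    a * rint 0 1 (fun x => (cd true U x - cd true V x) ^+ 2)) +
  (rint 0 1 (fun x => (cv false U x - cv false V x) ^+ 2) +
    a * rint 0 1 (fun x => (cd false U x - cd false V x) ^+ 2)).
Proof.
move=> hU hV; have hB := inHB hU hV.
rewrite normH_sq ?(ltW a0)// bfE /bp !mul0r !addr0 !ipxxE.
have E p : rint 0 1 (fun x => cd p (U - V) x ^+ 2) = rint 0 1 (fun x => (cd p U x - cd p V x) ^+ 2).
  have [_ _ r] := inH_rL2 p hB; have [_ _ rU] := inH_rL2 p hU; have [_ _ rV] := inH_rL2 p hV.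
  apply: aeq_rint.
  - exact: rintegrable_meas (rL2_sq r).
  - exact: rintegrable_meas (rL2_sq (rL2B rU rV)).
  have := cd_lin (-1) p hV hU; rewrite rmorphN1 scaleN1r addrC.
  by apply: aeq_imp => x _ ->; rewrite mulN1r addrC.
have E2 p x : cv p (U - V) x = cv p U x - cv p V x by rewrite /cv /cf -cmpB.
by rewrite !E; congr (_ + _ + (_ + _)); apply: eq_rint => x _; rewrite E2.
Qed.

(** The norm controls [v] and [u_xx] in [L^2], whose limits exist by [rL2_complete]; the limit of
    [u] is rebuilt by integrating that of [u_xx] twice. *)
Lemma normH_complete (x : nat -> state R) : (forall n, inH (x n)) ->
  (forall n, normH a (x n.+1 - x n) <= 4^-1 ^+ n) ->
  exists2 X, inH X & forall e, 0 < e -> exists n0, forall n, (n0 <= n)%N -> normH a (x n - X) <= e.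
Proof.
move=> hx cx.
have sq n : normH a (x n.+1 - x n) ^+ 2 <= 16^-1 ^+ n.
  have E : 16^-1 = 4^-1 ^+ 2 :> R by rewrite exprVn -natrX.
  by rewrite E -exprM mulnC exprM ler_sqr ?nnegrE ?normH_ge0 ?exprn_ge0// invr_ge0.
have q0 (f g : R -> R) : 0 <= rint 0 1 (fun x => (f x - g x) ^+ 2).
  by apply: rint_ge0 => y _; rewrite sqr_ge0.
have bnd p n : rint 0 1 (fun y => (cv p (x n.+1) y - cv p (x n) y) ^+ 2) <= 1 * 16^-1 ^+ n /\
    rint 0 1 (fun y => (cd p (x n.+1) y - cd p (x n) y) ^+ 2) <= a^-1 * 16^-1 ^+ n.
  have := sq n; rewrite normHB_sq//.
  have v1 := q0 (cv true (x n.+1)) (cv true (x n)); have v2 := q0 (cv false (x n.+1)) (cv false (x n)).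
  have d1 := mulr_ge0 (ltW a0) (q0 (cd true (x n.+1)) (cd true (x n))).
  have d2 := mulr_ge0 (ltW a0) (q0 (cd false (x n.+1)) (cd false (x n))).
  rewrite mul1r ler_pdivlMl//.
  by case: p; move: v1 v2 d1 d2; do 4! move: (rint _ _ _) => ?; move: (_ ^+ n) => *; split; lra.
have lim p : exists gv gd, [/\ rL2 0 1 gv, rL2 0 1 gd & exists C, forall n,
    rint 0 1 (fun y => (cv p (x n) y - gv y) ^+ 2) <= C * 4^-1 ^+ n /\
    rint 0 1 (fun y => (cd p (x n) y - gd y) ^+ 2) <= C * 4^-1 ^+ n].
  have [gv [rv [C1 h1]]] := rL2_complete ltr01 (fun n => inH_cv p (hx n)) (fun n => (bnd p n).1).
  have [gd [rd [C2 h2]]] := rL2_complete ltr01 (fun n => inH_cd p (hx n)) (fun n => (bnd p n).2).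
  exists gv, gd; split=> //; exists (Num.max C1 C2) => n.
  have p0 : 0 < 4^-1 ^+ n :> R by rewrite exprn_gt0// invr_gt0.
  split; [apply: le_trans (h1 n) _|apply: le_trans (h2 n) _];
    by rewrite ler_pM2r// le_max lexx ?orbT.
have /choice[gv /choice[gd /all_and3[rv rd /choice[C hC]]]] : forall p, exists gv, exists gd,
    [/\ rL2 0 1 gv, rL2 0 1 gd & exists C, forall n,
    rint 0 1 (fun y => (cv p (x n) y - gv y) ^+ 2) <= C * 4^-1 ^+ n /\
    rint 0 1 (fun y => (cd p (x n) y - gd y) ^+ 2) <= C * 4^-1 ^+ n] by exact: lim.
(* The slope at 0 is chosen so that the second primitive also vanishes at 1. *)
pose c p := - rint 0 1 (fun y => rint 0 y (gd p)).
pose u1 p y := c p + rint 0 y (gd p); pose u0 p y := 0 + rint 0 y (u1 p).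
pose F p j := if j is j'.+1 then if j' is _.+1 then gd p else u1 p else u0 p.
have A1 p : AC 0 1 (u1 p) (gd p) by exact: AC_prim.
have r1 p : rL2 0 1 (u1 p) by exact: AC_rL2 ler01 (A1 p).
have A0 p : AC 0 1 (u0 p) (u1 p) by exact: AC_prim.
pose X : state R := (cpair u0, cpair gv).
have hX : Hrep X F.
  split; [by apply/L2P => p; rewrite cf_cpair; exact: AC_rL2 ler01 (A0 p)|
    by apply/L2P => p; rewrite cf_cpair|move=> p; split].
  - by move=> [|[|j]] // _; [exact: A0|exact: A1].
  - by rewrite /X/= cf_cpair; exact: aeq_refl.
  - by rewrite /F /u0 rint_empty// addr0.
  - rewrite /F /u0 add0r /u1 rintD; [|exact: rintegrable_cst|].
      by rewrite rint_cst// subr0 mulr1 /c addNr.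
    have := rL2_int (rL2B (r1 p) (rL2_cst 0 1 (c p))).
    by apply: eq_rintegrable => y _; rewrite /u1 addrC addKr.
have iX : inH X by apply/inHP; exists F.
exists X => // e e0.
have [_ dX] := Hrep_weakD hX.
pose K := (1 + a) * (`|C true| + `|C false|).
have K0 : 0 <= K by rewrite mulr_ge0 ?addr_ge0 ?(ltW a0).
have main n : normH a (x n - X) ^+ 2 <= K * 4^-1 ^+ n.
  have p0 : 0 < 4^-1 ^+ n :> R by rewrite exprn_gt0// invr_gt0.
  rewrite normHB_sq//.
  have V p : rint 0 1 (fun y => (cv p (x n) y - cv p X y) ^+ 2) <= `|C p| * 4^-1 ^+ n.
    have -> : cv p X = gv p by exact: cf_cpair.
    apply: le_trans (hC p n).1 _.
    by rewrite ler_pM2r// ler_norm.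
  have D p : rint 0 1 (fun y => (cd p (x n) y - cd p X y) ^+ 2) <= `|C p| * 4^-1 ^+ n.
    rewrite (_ : rint 0 1 _ = rint 0 1 (fun y => (cd p (x n) y - gd p y) ^+ 2)).
      by apply: le_trans (hC p n).2 _; rewrite ler_pM2r// ler_norm.
    apply: aeq_rint.
    - exact: rintegrable_meas (rL2_sq (rL2B (inH_cd p (hx n)) (inH_cd p iX))).
    - exact: rintegrable_meas (rL2_sq (rL2B (inH_cd p (hx n)) (rd p))).
    - by apply: aeq_imp (dX p) => y _; rewrite /cd => ->.
  have D' p : a * rint 0 1 (fun y => (cd p (x n) y - cd p X y) ^+ 2) <= a * (`|C p| * 4^-1 ^+ n).
    by rewrite ler_pM2l.
  apply: le_trans (lerD (lerD (V true) (D' true)) (lerD (V false) (D' false))) _.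
  by rewrite /K le_eqVlt; apply/orP; left; apply/eqP; ring.
have [n0 hn0] : exists n0, K * 4^-1 ^+ n0 <= e ^+ 2.
  have : (K * 4^-1 ^+ n) @[n --> \oo] --> K * 0.
    apply: cvgM; first exact: cvg_cst.
    by apply: cvg_expr; rewrite ger0_norm ?invr_ge0// invf_lt1// ltr1n.
  rewrite mulr0 => /cvgrPdist_le /(_ (e ^+ 2) (exprn_gt0 _ e0)) [n0 _ hn0].
  exists n0; have := hn0 n0 (leqnn n0); rewrite /= sub0r normrN; exact: le_trans (ler_norm _).
exists n0 => n n0n.
have : normH a (x n - X) ^+ 2 <= e ^+ 2.
  apply: le_trans (main n) _; apply: le_trans _ hn0; apply: ler_wpM2l => //.
  by apply: ler_wiXn2l => //; rewrite ?invr_ge0// invf_le1// ler1n.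
by rewrite ler_sqr ?nnegrE ?normH_ge0// ltW.
Qed.

(** * Uniform boundedness of the semigroup near time 0 *)

Section UniformBoundedness.
Variable S : R -> state R -> state R.
Hypothesis S_inH : forall t U, 0 <= t -> inH U -> inH (S t U).
Hypothesis S_lin : forall t (c : R[i]) U V, 0 <= t -> inH U -> inH V ->
  eqH (S t (c *: U + V)) (c *: S t U + S t V).
Hypothesis S_bounded : forall t, 0 <= t -> exists M : R, forall U, inH U ->
  normH a (S t U) <= M * normH a U.

Lemma normH_Slin t c U V : 0 <= t -> inH U -> inH V ->
  normH a (S t (c%:C *: U + V)) = normH a (c%:C *: S t U + S t V).
Proof.
move=> t0 hU hV; apply: normH_eqH (S_lin _ t0 hU hV).
  exact: S_inH t0 (inH_lin c hU hV).
by apply: inH_lin; exact: S_inH.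
Qed.

Lemma S_zero t : 0 <= t -> normH a (S t 0) = 0.
Proof.
move=> t0; have [M hM] := S_bounded t0.
by apply/eqP; rewrite eq_le normH_ge0 andbT; have := hM _ inH0; rewrite normH00 mulr0.
Qed.

Lemma normH_SB t U V : 0 <= t -> inH U -> inH V ->
  normH a (S t (U - V)) = normH a (S t U - S t V).
Proof.
move=> t0 hU hV; have := normH_Slin (-1) t0 hV hU.
by rewrite !rmorphN1 !scaleN1r ![- _ + _]addrC.
Qed.

Lemma normH_SD t U V : 0 <= t -> inH U -> inH V ->
  normH a (S t (U + V)) = normH a (S t U + S t V).
Proof. by move=> t0 hU hV; have := normH_Slin 1 t0 hU hV; rewrite !scale1r. Qed.

Lemma normH_SZ t c U : 0 <= t -> inH U -> normH a (S t (c%:C *: U)) = `|c| * normH a (S t U).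
Proof.
move=> t0 hU; have hS := S_inH t0 hU; have hS0 := S_inH t0 inH0.
have h := normH_Slin c t0 hU inH0; rewrite addr0 in h; rewrite h -normHZ//.
have hZ := inHZ c hS; have hL := inHD hZ hS0.
have z := S_zero t0.
apply/eqP; rewrite eq_le; apply/andP; split.
  by apply: le_trans (normHD (ltW a0) hZ hS0) _; rewrite z addr0.
apply: le_trans (normH_le_add hZ hL) _.
by rewrite opprD addrA subrr sub0r normHN// z addr0.
Qed.

(** [N] is the operator norm, obtained as the infimum of the admissible bounds. It is positive as it
    exceeds a strict lower bound at [U0], hence [3/4 N] is no longer admissible. *)
Lemma near_opnorm t K : 0 <= t -> 0 <= K -> (exists2 U, inH U & K * normH a U < normH a (S t U)) ->
  exists N, [/\ K <= N, forall U, inH U -> normH a (S t U) <= N * normH a U &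
    exists2 z, inH z & 3 / 4 * N * normH a z < normH a (S t z)].
Proof.
move=> t0 K0 [U0 hU0 KU0]; have [M hM] := S_bounded t0.
pose B := [set N : R | forall U, inH U -> normH a (S t U) <= N * normH a U].
have lbK : lbound B K.
  move=> N hN; rewrite leNgt; apply/negP => NK.
  have := lt_le_trans KU0 (hN _ hU0); rewrite ltNge => /negP; apply.
  by apply: ler_wpM2r; [exact: normH_ge0|exact: ltW].
have B0 : B !=set0 by exists M.
have KB : K <= inf B by exact: lb_le_inf.
have BN : B (inf B).
  move=> U hU; have := normH_ge0 a U; rewrite le_eqVlt => /orP[/eqP Uz|Upos].
    by have := hM U hU; rewrite -Uz !mulr0.
  rewrite -ler_pdivrMr//; apply: lb_le_inf => // N hN.
  by rewrite ler_pdivrMr//; exact: hN.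
exists (inf B); split=> //.
apply: contrapT => nz.
have Npos : 0 < inf B.
  rewrite lt_neqAle (le_trans K0 KB) andbT; apply/eqP => N0.
  have := BN _ hU0; rewrite -N0 mul0r leNgt => /negP; apply.
  by apply: le_lt_trans KU0; rewrite mulr_ge0// normH_ge0.
have : B (3 / 4 * inf B).
  by move=> U hU; rewrite leNgt; apply/negP => h; apply: nz; exists U.
move/(ge_inf (ex_intro _ K lbK)); rewrite leNgt => /negP; apply.
by lra.
Qed.

(** Of [x + z] and [x - z], at least one has a large image, since [2 S z] is the difference of their
    images. *)
Lemma hump_step t N r x : 0 <= t -> 0 < r -> inH x -> 0 < N ->
  (exists2 z, inH z & 3 / 4 * N * normH a z < normH a (S t z)) ->
  (forall U, inH U -> normH a (S t U) <= N * normH a U) ->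
  exists y, [/\ inH y, normH a (y - x) <= r & 3 / 4 * N * r <= normH a (S t y)].
Proof.
move=> t0 r0 hx N0 [z0 hz0 z0N] hN.
have zp : 0 < normH a z0.
  rewrite lt_neqAle normH_ge0 andbT; apply/eqP => z00.
  by move: z0N; rewrite -z00 mulr0 ltNge => /negP; apply; have := hN _ hz0; rewrite -z00 mulr0.
pose z := (r / normH a z0)%:C *: z0.
have rz : 0 < r / normH a z0 by rewrite divr_gt0.
have hz : inH z by exact: inHZ.
have nz : normH a z = r by rewrite normHZ// gtr0_norm// divfK// gt_eqF.
have Sz : 3 / 4 * N * r <= normH a (S t z).
  rewrite normH_SZ// gtr0_norm// [leRHS]mulrAC ler_pdivlMr// [leLHS]mulrAC [leLHS]mulrC.
  by rewrite ler_pM2l// ltW.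
have [h|h] := leP (3 / 4 * N * r) (normH a (S t (x + z))).
  by exists (x + z); split => //; [exact: inHD|rewrite addrC addKr nz].
exists (x - z); split; first exact: inHB.
  by rewrite addrC addKr normHN// nz.
have hSx := S_inH t0 hx; have hSz := S_inH t0 hz.
rewrite (normH_SB t0 hx hz); rewrite (normH_SD t0 hx hz) in h.
have E : (2 : R)%:C *: S t z = (S t x + S t z) - (S t x - S t z).
  by rewrite rmorph_nat scaler_nat mulr2n opprB [S t x + _]addrC addrACA subrr addr0.
have := normHD (ltW a0) (inHD hSx hSz) (inHB hSz hSx).
rewrite -(normHB_sym hSx hSz) -(opprB (S t x)) -E (normHZ 2 hSz) (ger0_norm (ler0n R 2)).
move: h Sz; move: (_ * r) (normH a (S t z)) (normH a (S t x + S t z)) (normH a (S t x - S t z)).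
by move=> m u v w; lra.
Qed.

Hypothesis S_cont : forall U, inH U -> forall e, 0 < e -> exists2 d, 0 < d &
  forall h, 0 < h -> h < d -> normH a (S h U - U) <= e.

(* Gliding hump: the n-th step moves the point by at most [4^-1 ^+ n] and makes its image under
   [S t_n] too large to be compensated by the remaining steps. *)
Lemma uniform_bound : exists d K, [/\ 0 < d, 0 <= K &
  forall t U, 0 < t -> t <= d -> inH U -> normH a (S t U) <= K * normH a U].
Proof.
apply: contrapT => no.
pose r (n : nat) : R := 4^-1 ^+ n.
have r0 n : 0 < r n by rewrite exprn_gt0// invr_gt0.
(* The image of the limit keeps at least [(3/4 - 1/3) N r n], which is [5/12 N r n]; with
   [N >= 3 (n + 1) / r n] this exceeds [n + 1]. *)
pose Kn (n : nat) : R := 3 * n.+1%:R / r n.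
have Kn0 n : 0 < Kn n by rewrite divr_gt0// mulr_gt0.
have /choice[tN htN] : forall n : nat, exists tN : R * R,
    [/\ 0 < tN.1, tN.1 <= n.+1%:R^-1, Kn n <= tN.2,
      forall U, inH U -> normH a (S tN.1 U) <= tN.2 * normH a U &
      forall x, inH x -> exists y, [/\ inH y, normH a (y - x) <= r n &
        3 / 4 * tN.2 * r n <= normH a (S tN.1 y)]].
  move=> n; apply: contrapT => no2; apply: no; exists n.+1%:R^-1, (Kn n); split => //.
    exact: ltW.
  move=> t U t0 td hU; rewrite leNgt; apply/negP => h; apply: no2.
  have [N [KN bN near]] := near_opnorm (ltW t0) (ltW (Kn0 n)) (ex_intro2 _ _ U hU h).
  exists (t, N); split => //= x hx.
  by apply: hump_step near bN => //; [exact: ltW|exact: lt_le_trans KN].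
have /choice[step hstep] : forall nx : nat * state R, exists y, inH nx.2 -> [/\ inH y,
    normH a (y - nx.2) <= r nx.1 & 3 / 4 * (tN nx.1).2 * r nx.1 <= normH a (S (tN nx.1).1 y)].
  move=> [n x]/=; have [hx|hx] := pselect (inH x); last by exists x.
  by have [_ _ _ _ /(_ x hx)[y hy]] := htN n; exists y.
pose x := fix x n := if n is m.+1 then step (m, x m) else (0 : state R).
have hx n : inH (x n).
  by elim: n => [|n IH]; [exact: inH0|have [] := hstep (n, x n) IH].
have xx n : normH a (x n.+1 - x n) <= r n by have [] := hstep (n, x n) (hx n).
have xS n : 3 / 4 * (tN n).2 * r n <= normH a (S (tN n).1 (x n.+1)).
  by have [] := hstep (n, x n) (hx n).
have [X hX limX] := normH_complete hx xx.
have tail n m : normH a (x (m + n)%N - x n) <= 4 / 3 * r n.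
  suff : normH a (x (m + n)%N - x n) <= 4 / 3 * (r n - r (m + n)%N).
    move/le_trans; apply; apply: ler_wpM2l; first by rewrite divr_ge0.
    by rewrite gerBl ltW.
  elim: m => [|m IH]; first by rewrite add0n !subrr mulr0 normH00.
  rewrite addSn; apply: le_trans (normHB_le (hx _) (hx (m + n)%N) (hx n)) _.
  have E : r (m + n).+1 = r (m + n)%N / 4 by rewrite /r exprSr.
  by rewrite E; move: (xx (m + n)%N) IH; lra.
(* All later moves sum to at most [4/3 * r (n + 1)], that is [r n / 3]. *)
have tailX n : normH a (x n.+1 - X) <= 3^-1 * r n.
  apply/ler_addgt0Pr => e e0; have [n0 hn0] := limX e e0.
  apply: le_trans (normHB_le (hx _) (hx (n0 + n.+1)%N) hX) _.
  apply: lerD; last by apply: hn0; rewrite leq_addr.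
  rewrite normHB_sym//; apply: le_trans (tail _ _) _.
  by rewrite /r exprSr; lra.
have big n : n.+1%:R <= normH a (S (tN n).1 X).
  have [t0 _ KN bN _] := htN n; have t0' := ltW t0.
  have := normH_le_add (S_inH t0' (hx n.+1)) (S_inH t0' hX).
  rewrite -normH_SB//.
  have := bN _ (inHB (hx n.+1) hX); have := tailX n; have := xS n.
  have N0 : 0 < (tN n).2 by exact: lt_le_trans KN.
  move: KN; rewrite /Kn ler_pdivrMr//; have := r0 n.
  move: N0; move: (tN n).2 (r n) => N rn N0 rn0 KN h1 h2 h3 h4.
  have : N * normH a (x n.+1 - X) <= N * (3^-1 * rn) by rewrite ler_pM2l.
  have n0 : 0 <= n.+1%:R :> R by [].
  by lra.
(* The times tend to 0 while the images of [X] are unbounded, against right continuity of the orbit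
   of [X] at 0. *)
have [d d0 hd] := S_cont hX ltr01.
have [n hn] : exists n : nat, n.+1%:R^-1 < d /\ normH a X + 1 < n.+1%:R.
  pose y := Num.max d^-1 (normH a X + 1).
  have y0 : 0 <= y by rewrite le_max invr_ge0 (ltW d0).
  have := lt_le_trans (archi_boundP y0) (_ : _ <= (Num.bound y).+1%:R).
  rewrite ler_nat => /(_ (leqnSn _)); rewrite gt_max => /andP[h1 h2].
  by exists (Num.bound y); split=> //; rewrite invf_plt ?posrE.
have [t0 td _ _ _] := htN n.
have := normH_le_add (S_inH (ltW t0) hX) hX.
have := hd _ t0 (le_lt_trans td hn.1); have := big n; move: hn.2.
by lra.
Qed.

End UniformBoundedness.
End EnergySpace.

(** * Limits in epsilon-delta form *)

Section EpsilonDelta.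
Local Open Scope classical_set_scope.
Context {R : realType}.
Implicit Types (f : R -> R) (t e d h s : R).

Lemma cvg0_rightP f : (forall h, 0 <= f h) -> (f h @[h --> 0^'+] --> (0 : R)) <->
  forall e, 0 < e -> exists2 d, 0 < d & forall h, 0 < h -> h < d -> f h <= e.
Proof.
move=> f0; split=> [/cvgrPdist_le cf e e0|cf].
  have /nbhs_ballP[d /= d0 hd] := cf e e0; exists d => // h h0 hd'.
  have := hd h; rewrite /ball/= sub0r normrN gtr0_norm// => /(_ hd' h0).
  by rewrite sub0r normrN ger0_norm.
apply/cvgrPdist_le => e e0; have [d d0 hd] := cf e e0.
apply/nbhs_ballP; exists d => //= h; rewrite /ball/= sub0r normrN => hd' h0.
rewrite sub0r normrN ger0_norm//; apply: hd => //; exact: le_lt_trans (ler_norm _) hd'.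
Qed.

Lemma cvg0_punctured f : (forall h, 0 <= f h) -> f h @[h --> 0^'] --> (0 : R) ->
  forall e, 0 < e -> exists2 d, 0 < d & forall h, 0 < h -> h < d -> f h <= e.
Proof.
move=> f0 /cvgrPdist_le cf e e0.
have /nbhs_ballP[d /= d0 hd] := cf e e0; exists d => // h h0 hd'.
have := hd h; rewrite /ball/= sub0r normrN gtr0_norm// => /(_ hd').
by rewrite gt_eqF// sub0r normrN ger0_norm//; apply.
Qed.

Lemma cvg0_within f t : (forall h, 0 <= f h) ->
  f s @[s --> within `[0, +oo[ (nbhs t)] --> (0 : R) ->
  forall e, 0 < e -> exists2 d, 0 < d & forall s, 0 <= s -> `|s - t| < d -> f s <= e.
Proof.
move=> f0 /cvgrPdist_le cf e e0.
have /nbhs_ballP[d /= d0 hd] := cf e e0; exists d => // s s0 sd.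
have := hd s; rewrite /ball/= distrC in_itv/= andbT => /(_ sd s0).
by rewrite sub0r normrN ger0_norm.
Qed.

End EpsilonDelta.

(** * Trajectories in the domain; semigroup orbits *)

Section Trajectories.
Local Open Scope classical_set_scope.
Local Open Scope complex_scope.
Context {R : realType}.
Implicit Types (U W X Y : state R) (V : R -> state R) (t s h e d : R).

(** What semigroup orbits from [D(A)] and classical solutions have in common and the decay argument
    uses: continuity from time 0, and right derivatives at positive times. *)
Definition trajectory a b alpha xi V := [/\ forall t, 0 <= t -> inH (V t),
  forall t, 0 < t -> domA a alpha xi (V t), econtH a V &
  forall t, 0 < t -> forall e, 0 < e -> exists2 d, 0 < d & forall h, 0 < h -> h < d ->
    normH a ((h^-1)%:C *: (V (t + h) - V t) - opA a b alpha xi (V t)) <= e].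

(** [c] is the part of [a |u_xx|^2] reserved for the trace term, and [C] the product of the two
    constants comparing the form with the energy; it does not depend on the trajectory. *)
Lemma trajectory_decay (a b alpha xi beta c : R) : 0 < a -> 0 < xi -> xi < 1 -> 0 < alpha ->
  0 <= beta -> 2 * beta <= b -> 0 < c -> c <= a ->
  - ((a - c) * pi ^+ 4) <= beta ^+ 2 - b * beta ->
  exists2 C, 0 < C & forall V, trajectory a b alpha xi V -> forall t, 0 <= t ->
    normH a (V t) ^+ 2 <=
      C * expR (- (2 * (beta - alpha * beta ^+ 2 / (4 * c * pi ^+ 2)) * t)) * normH a (V 0) ^+ 2.
Proof.
move=> a0 xi0 xi1 al0 be0 beb c0 ca sc.
have p4 : 0 < pi ^+ 4 :> R by rewrite exprn_gt0// pi_gt0.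
have [k kE] : exists k, k = 2 * beta ^+ 2 - b * beta by eexists.
have sck : - ((a - c) * pi ^+ 4) <= k - beta ^+ 2.
  by rewrite kE; move: sc; move: ((a - c) * _) => z; lra.
have kb : k <= 2 * beta ^+ 2.
  by rewrite kE gerBl mulr_ge0//; apply: le_trans beb; rewrite mulr_ge0.
pose m : R := 2 + (2 * beta ^+ 2 / pi ^+ 4 + a) / c.
pose M : R := 2 + 3 * beta ^+ 2 / (a * pi ^+ 4).
have m0 : 0 < m.
  rewrite ltr_wpDr// divr_ge0 ?(ltW c0)// addr_ge0 ?(ltW a0)// divr_ge0 ?(ltW p4)//.
  by rewrite mulr_ge0// sqr_ge0.
have M0 : 0 < M.
  apply: ltr_wpDr => //; apply: divr_ge0; first by rewrite mulr_ge0 ?sqr_ge0.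
  by rewrite mulr_ge0 ?(ltW a0) ?(ltW p4).
have Pge U : inH U -> 0 <= bf a beta k U U.
  move=> hU; apply: le_trans (bf_ge_cd hU sck (ltW c0) ca).
  by rewrite mulr_ge0 ?(ltW c0)// addr_ge0// ipxx_ge0.
have Ple U : inH U -> bf a beta k U U <= M * normH a U ^+ 2.
  by move=> hU; rewrite normH_sq ?(ltW a0)//; exact: bf_upper.
exists (m * M); first by rewrite mulr_gt0.
move=> V [hV dV cV rV] t t0.
have hA s : 0 < s -> inH (opA a b alpha xi (V s)) by move=> /dV dVs; exact: opA_inH.
have diss s : 0 < s -> bf a beta k (V s) (opA a b alpha xi (V s)) <=
    - (beta - alpha * beta ^+ 2 / (4 * c * pi ^+ 2)) * bf a beta k (V s) (V s).
  by move=> /dV dVs; exact: (dissipation a0 xi0 xi1 al0 be0 beb c0 ca kE sck dVs).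
have := form_decay M0 Pge Ple hV hA cV rV diss t0.
set E := expR _ => D.
rewrite normH_sq ?(ltW a0)//; last exact: hV.
apply: le_trans (bf_lower (hV t t0) (ltW a0) c0 ca sck) _.
rewrite -/m -2!mulrA ler_pM2l//; apply: le_trans D _.
by rewrite mulrCA ler_pM2l ?expR_gt0//; apply/Ple/hV.
Qed.

Lemma eqH_refl U : eqH U U.
Proof. by split; exact: ae_eq_refl. Qed.

Lemma eqH_sym U W : eqH U W -> eqH W U.
Proof. by case=> h1 h2; split; exact: ae_eq_sym. Qed.

Lemma eqH_trans U W X : eqH U W -> eqH W X -> eqH U X.
Proof. by move=> [h1 h2] [h3 h4]; split; [exact: ae_eq_trans h1 h3|exact: ae_eq_trans h2 h4]. Qed.

Lemma eqH_lin (c : R[i]) U U' W W' : eqH U U' -> eqH W W' -> eqH (c *: U + W) (c *: U' + W').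
Proof.
move=> [h1 h2] [h3 h4]; split.
  by apply: filterS2 h1 h3 => x e1 e2 hx; rewrite /= !fctE e1// e2.
by apply: filterS2 h2 h4 => x e1 e2 hx; rewrite /= !fctE e1// e2.
Qed.

Lemma eqHB U U' W W' : eqH U U' -> eqH W W' -> eqH (U - W) (U' - W').
Proof. by move=> h h'; have := eqH_lin (-1) h' h; rewrite !scaleN1r ![- _ + _]addrC. Qed.

Lemma normHB_eqH a U U' W W' : inH U -> inH U' -> inH W -> inH W' -> eqH U U' -> eqH W W' ->
  normH a (U - W) = normH a (U' - W').
Proof. by move=> *; apply: normH_eqH; [exact: inHB|exact: inHB|exact: eqHB]. Qed.

Section Semigroup.
Variables (a b alpha xi : R) (S : R -> state R -> state R).
Hypotheses (a0 : 0 < a) (xi0 : 0 < xi) (xi1 : xi < 1).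
Hypotheses (SG : C0_semigroup a S) (gen : generated_by a b alpha xi S).

Let S_inH t U : 0 <= t -> inH U -> inH (S t U). Proof. by case: SG => + _ _ _ _; apply. Qed.
Let S_lin t (c : R[i]) U W : 0 <= t -> inH U -> inH W ->
  eqH (S t (c *: U + W)) (c *: S t U + S t W).
Proof. by case: SG => _ + _ _ _; apply. Qed.
Let S_bounded t : 0 <= t -> exists M : R, forall U, inH U -> normH a (S t U) <= M * normH a U.
Proof. by case: SG => _ _ + _ _; apply. Qed.
Let S0 U : inH U -> eqH (S 0 U) U. Proof. by case: SG => _ _ _ [+ _] _; apply. Qed.
Let SD s t U : 0 <= s -> 0 <= t -> inH U -> eqH (S (s + t) U) (S s (S t U)).
Proof. by case: SG => _ _ _ [_ +] _; apply. Qed.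
Let S_cont U : inH U -> forall e, 0 < e -> exists2 d, 0 < d &
  forall h, 0 < h -> h < d -> normH a (S h U - U) <= e.
Proof.
case: SG => _ _ _ _ + hU; move/(_ U hU).
by move/(cvg0_rightP (fun h => normH_ge0 a (S h U - U))).
Qed.

Lemma S_bound_pos t : 0 <= t -> exists2 M : R, 0 < M &
  forall U, inH U -> normH a (S t U) <= M * normH a U.
Proof.
move=> t0; have [M hM] := S_bounded t0; exists (`|M| + 1); first by rewrite ltr_wpDl.
move=> U hU; apply: le_trans (hM U hU) _; apply: ler_wpM2r; first exact: normH_ge0.
by apply: le_trans (ler_norm M) _; rewrite lerDl.
Qed.

(** Right continuity follows from boundedness of the single operator [S t]; left continuity involves
    [S (t - h)] for varying [h] and needs a bound uniform in [h]. *)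
Lemma S_econtH U : inH U -> econtH a (fun t => S t U).
Proof.
move=> hU t t0 e e0.
have [M M0 hM] := S_bound_pos t0.
have [dr dr0 hdr] := S_cont hU (divr_gt0 e0 M0).
have right h : 0 < h -> h < dr -> normH a (S (t + h) U - S t U) <= e.
  move=> h0 hd; have hh := S_inH (ltW h0) hU; have th0 := addr_ge0 t0 (ltW h0).
  rewrite (normHB_eqH _ (S_inH th0 hU) (S_inH t0 hh) (S_inH t0 hU) (S_inH t0 hU) (SD t0 (ltW h0) hU)
    (eqH_refl _)).
  rewrite -(normH_SB a S_inH S_lin)//.
  apply: le_trans (hM _ (inHB hh hU)) _; rewrite mulrC -ler_pdivlMr//; exact: hdr.
(* [S (t - h)] is factored as [S (t - d')] after [S (d' - h)]: the first is fixed, the second acts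
   for a short time and is covered by [uniform_bound]. *)
have [dl dl0 hdl] : exists2 d, 0 < d & forall h, 0 < h -> h < d -> h <= t ->
    normH a (S (t - h) U - S t U) <= e.
  have [d [K [d0 K0 hK]]] := uniform_bound a0 S_inH S_lin S_bounded S_cont.
  move: t0; rewrite le_eqVlt => /orP[/eqP<-|t0].
    by exists 1 => // h h0 _; rewrite leNgt h0.
  pose d' := Num.min d t; have d'0 : 0 < d' by rewrite lt_min d0 t0.
  have d't : d' <= t by rewrite ge_min lexx orbT.
  have d'd : d' <= d by rewrite ge_min lexx.
  have td0 : 0 <= t - d' by rewrite subr_ge0.
  have [M' M'0 hM'] := S_bound_pos td0.
  have K1 : 0 < K + 1 by rewrite ltr_wpDl.
  have [dc dc0 hdc] := S_cont hU (divr_gt0 (divr_gt0 e0 M'0) K1).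
  exists (Num.min dc d'); first by rewrite lt_min dc0 d'0.
  move=> h h0; rewrite lt_min => /andP[hdc' hd'] ht.
  have hh := S_inH (ltW h0) hU; have th0 : 0 <= t - h by rewrite subr_ge0.
  have E1 : eqH (S t U) (S (t - h) (S h U)).
    by rewrite -{1}(subrK h t); apply: SD => //; exact: ltW.
  rewrite (normHB_eqH _ (S_inH th0 hU) (S_inH th0 hU) (S_inH (ltW t0) hU) (S_inH th0 hh)
    (eqH_refl _) E1) -(normH_SB a S_inH S_lin)//.
  have hB := inHB hU hh.
  have dh0 : 0 < d' - h by rewrite subr_gt0.
  have E2 : eqH (S (t - h) (U - S h U)) (S (t - d') (S (d' - h) (U - S h U))).
    by have := SD td0 (ltW dh0) hB; rewrite addrA subrK.
  have hS2 := S_inH (ltW dh0) hB.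
  rewrite (normH_eqH a (S_inH th0 hB) (S_inH td0 hS2) E2).
  apply: le_trans (hM' _ hS2) _; rewrite mulrC -ler_pdivlMr//.
  apply: le_trans (hK _ _ dh0 _ hB) _; first by rewrite lerBlDr (le_trans d'd)// lerDl ltW.
  apply: (@le_trans _ _ ((K + 1) * normH a (U - S h U))).
    by rewrite ler_wpM2r ?normH_ge0// lerDl.
  by rewrite mulrC -ler_pdivlMr// (normHB_sym a)//; exact: hdc.
exists (Num.min dr dl); first by rewrite lt_min dr0 dl0.
move=> s s0; rewrite lt_min => /andP[sdr sdl].
have [st|st|<-] := ltgtP s t.
- have := hdl (t - s); rewrite subr_gt0 opprB addrCA subrr addr0; apply => //.
    by rewrite -(gtr0_norm (_ : 0 < t - s)) ?subr_gt0// distrC.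
  by rewrite gerBl.
- have := right (s - t); rewrite subr_gt0 addrCA subrr addr0; apply => //.
  by rewrite -(gtr0_norm (_ : 0 < s - t)) ?subr_gt0.
- by rewrite subrr normH00// ltW.
Qed.

Lemma S_eq0 t : 0 <= t -> eqH (S t 0) 0.
Proof.
move=> t0; have := S_lin (-1) t0 (@inH0 R) (@inH0 R).
by rewrite scaler0 addr0 scaleN1r addNr.
Qed.

Lemma S_comb t (c : R) X Y W : 0 <= t -> inH X -> inH Y -> inH W ->
  eqH (S t (c%:C *: (X - Y) - W)) (c%:C *: (S t X - S t Y) - S t W).
Proof.
move=> t0 hX hY hW; have hB := inHB hX hY.
have EB : eqH (S t (X - Y)) (S t X - S t Y).
  by have := S_lin (-1) t0 hY hX; rewrite !scaleN1r ![- _ + _]addrC.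
have EZ : eqH (S t (c%:C *: (X - Y))) (c%:C *: (S t X - S t Y)).
  have := S_lin c%:C t0 hB (@inH0 R); rewrite addr0 => h; apply: eqH_trans h _.
  by rewrite -[X in eqH _ X]addr0; apply: eqH_lin => //; exact: S_eq0.
have := S_lin (-1) t0 hW (inHZ c hB); rewrite !scaleN1r ![- _ + _]addrC => h.
by apply: eqH_trans h _; apply: eqHB => //; exact: eqH_refl.
Qed.

(** The difference quotient at [S t U] is [S t] applied to that at [U], so it converges to
    [S t (A U)]; the generator hypothesis read from right derivative to domain concludes. *)
Lemma S_domA t U : 0 <= t -> domA a alpha xi U -> domA a alpha xi (S t U).
Proof.
move=> t0 dU; have hU := domA_inH xi0 xi1 dU; have hA := opA_inH b a0 xi0 xi1 dU.
set W := opA a b alpha xi U in hA.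
have hS := S_inH t0 hU; have hSA := S_inH t0 hA.
have /(cvg0_rightP (fun h => normH_ge0 a _)) cU := (gen hU hA).2 (conj dU (eqH_refl _)).
suff : normH a ((h^-1)%:C *: (S h (S t U) - S t U) - S t W) @[h --> 0^'+] --> (0 : R).
  by move=> /(gen hS hSA)[].
apply/(cvg0_rightP (fun h => normH_ge0 a _)) => e e0.
have [M M0 hM] := S_bound_pos t0.
have [d d0 hd] := cU _ (divr_gt0 e0 M0); exists d => [//|h h0 hd'].
have hh := S_inH (ltW h0) hU; have hB := inHB hh hU.
have hX : inH ((h^-1)%:C *: (S h U - U) - W) by exact: inHB (inHZ _ hB) hA.
have E : eqH ((h^-1)%:C *: (S h (S t U) - S t U) - S t W) (S t ((h^-1)%:C *: (S h U - U) - W)).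
  apply: eqH_sym; apply: eqH_trans (S_comb _ t0 hh hU hA) _.
  apply: eqHB; last exact: eqH_refl.
  rewrite -[X in eqH X]addr0 -[X in eqH _ X]addr0; apply: eqH_lin; last exact: eqH_refl.
  apply: eqHB; last exact: eqH_refl.
  by apply: eqH_trans (eqH_sym (SD t0 (ltW h0) hU)) _; rewrite addrC; apply: SD => //; exact: ltW.
have hhS := S_inH (ltW h0) hS.
rewrite (normH_eqH _ _ _ E).
- by apply: le_trans (hM _ hX) _; rewrite mulrC -ler_pdivlMr//; exact: hd.
- exact: inHB (inHZ _ (inHB hhS hS)) hSA.
- exact: S_inH.
Qed.

Lemma S_trajectory U : domA a alpha xi U -> trajectory a b alpha xi (fun t => S t U).
Proof.
move=> dU; have hU := domA_inH xi0 xi1 dU; split.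
- by move=> t t0; exact: S_inH.
- by move=> t t0; apply: S_domA => //; exact: ltW.
- exact: S_econtH.
move=> t /ltW t0 e e0.
have dS := S_domA t0 dU; have hS := S_inH t0 hU; have hA := opA_inH b a0 xi0 xi1 dS.
have /(cvg0_rightP (fun h => normH_ge0 a _)) /(_ e e0)[d d0 hd] := (gen hS hA).2 (conj dS (eqH_refl _)).
exists d => [//|h h0 hd']; have th0 := addr_ge0 t0 (ltW h0).
have hhS := S_inH (ltW h0) hS; have hth := S_inH th0 hU.
have E : eqH (S (t + h) U) (S h (S t U)) by rewrite addrC; apply: SD => //; exact: ltW.
apply: le_trans (hd h h0 hd'); rewrite le_eqVlt; apply/orP; left; apply/eqP.
apply: (normHB_eqH _ (inHZ _ (inHB hth hS)) (inHZ _ (inHB hhS hS)) hA hA); last exact: eqH_refl.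
rewrite -[X in eqH X]addr0 -[X in eqH _ X]addr0; apply: eqH_lin; last exact: eqH_refl.
by apply: eqHB => //; exact: eqH_refl.
Qed.

End Semigroup.
End Trajectories.

(** * Integrals of functions equal almost everywhere, without measurability *)

Section AlmostEverywhereIntegral.
Local Open Scope classical_set_scope.
Import HBNNSimple.
Context d (T : measurableType d) (R : realType) (mu : {measure set T -> \bar R}).

(** The integral is a supremum over simple functions below [f]. Setting such a function to 0 on the
    exceptional null set puts it below [g] and keeps its integral. *)
Lemma ge0_ae_le_integral (f g : T -> \bar R) : (forall x, 0 <= f x)%E -> (forall x, 0 <= g x)%E ->
  (\forall x \ae mu, f x = g x) -> (\int[mu]_x f x <= \int[mu]_x g x)%E.
Proof.
move=> f0 g0 [N [mN N0 fgN]]; rewrite !ge0_integralTE//.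
apply: ge_ereal_sup => _ [h hf <-].
pose h' := proj_nnsfun h (measurableC mN).
have hh' : sintegral mu h = sintegral mu h'.
  have E (k : {nnsfun T >-> R}) : sintegral mu k = (\int[mu]_x (k x)%:E)%E.
    by rewrite integralT_nnsfun.
  rewrite !E; apply: ae_eq_integral => //; [exact/measurable_EFinP|exact/measurable_EFinP|].
  exists N; split => // x /=; apply: contra_notP => xN _.
  by rewrite /= mindicE in_setC (_ : (x \in N) = false) ?mulr1//; apply/negbTE; rewrite notin_setE.
apply: ereal_sup_ubound; exists h' => //= x.
rewrite mindicE in_setC; case: (boolP (x \in N)) => xN; rewrite /= ?mulr0 ?mulr1 ?g0//.
have <- : f x = g x by apply: contrapT => fg; move: xN; rewrite notin_setE; apply; exact: fgN.
exact: hf.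
Qed.

End AlmostEverywhereIntegral.

(** * Invariance of weak derivatives and of the norm *)

Section AlmostEverywhereInvariance.
Local Open Scope classical_set_scope.
Local Open Scope complex_scope.
Context {R : realType}.
Local Notation mu := (@lebesgue_measure R).
Implicit Types (l r : R) (U V : state R).

Lemma ae_rint l r (f g : R -> R) : aeq l r f g -> rint l r f = rint l r g.
Proof.
move=> fg; congr fine; rewrite integral_mkcond [RHS]integral_mkcond integralE [RHS]integralE.
have E : \forall x \ae mu, ((EFin \o f) \_ `]l, r[) x = ((EFin \o g) \_ `]l, r[) x.
  by apply: filterS fg => x h; rewrite !patchE; case: ifPn => //; rewrite inE => /h /= ->.
have E' : \forall x \ae mu, ((EFin \o g) \_ `]l, r[) x = ((EFin \o f) \_ `]l, r[) x.
  by apply: filterS E => x ->.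
congr (_ - _)%E; apply/eqP; rewrite eq_le; apply/andP; split; apply: ge0_ae_le_integral => //.
- by apply: filterS E => x h; rewrite !funeposE h.
- by apply: filterS E' => x h; rewrite !funeposE h.
- by apply: filterS E => x h; rewrite !funenegE h.
- by apply: filterS E' => x h; rewrite !funenegE h.
Qed.

(* Measurability is not assumed, because [is_solution] only makes [U 0] almost everywhere equal
   to an element of [H]. *)
Lemma ae_weakD l r k (f g : cfun R) : f = g %[ae mu in `]l, r[%classic] ->
  weakD l r k f = weakD l r k g.
Proof.
move=> fg; rewrite /weakD; congr (xget _ _); apply/seteqP.
have wd (f' g' h : cfun R) : f' = g' %[ae mu in `]l, r[%classic] ->
    is_weak_derivative l r k f' h -> is_weak_derivative l r k g' h.
  move=> /ae_cf E /weakP w; apply/weakP => p phi tphi; rewrite -(w p phi tphi).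
  by apply: ae_rint; apply: aeq_imp (E p) => x _ ->.
by split=> h /= [Lh wh]; split=> //; [exact: wd fg wh|apply: wd wh; exact: ae_eq_sym].
Qed.

Lemma ae_normH a U V : eqH U V -> normH a U = normH a V.
Proof.
move=> [h1 h2]; rewrite /normH /innerH (ae_weakD 2 h1) /cintegral/=; congr Num.sqrt.
by apply: ae_rint; apply: filterS h2 => x h xlr; rewrite h.
Qed.

End AlmostEverywhereInvariance.

(** * Density of the domain *)

Section Density.
Local Open Scope classical_set_scope.
Local Open Scope complex_scope.
Context {R : realType}.
Variables (a alpha xi : R).
Hypotheses (a0 : 0 < a) (xi0 : 0 < xi) (xi1 : xi < 1).
Implicit Types (U V : state R) (e : R) (p : bool).

(** Approximating separately on the two sides of [xi] gives supports that avoid [xi]. *)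
Lemma test_dense_punctured (f : R -> R) e : rL2 0 1 f -> 0 < e ->
  exists psi, [/\ test_function 0 1 psi, psi xi = 0 &
    rint 0 1 (fun x => (f x - psi x) ^+ 2) <= e].
Proof.
move=> hf e0; have e2 : 0 < e / 2 by rewrite divr_gt0.
have le0 := ltW xi0; have le1 := ltW xi1.
have [p1 [t1 h1]] := test_dense xi0 (rL2_sub (lexx 0) le1 hf) e2.
have [p2 [t2 h2]] := test_dense xi1 (rL2_sub le0 (lexx 1) hf) e2.
have T1 := test_sub (lexx 0) le1 t1; have T2 := test_sub le0 (lexx 1) t2.
exists (fun x => p1 x + p2 x); split.
- exact: testD.
- by rewrite (test_ge t1)// (test_le t2)// addr0.
have I : rintegrable 0 1 (fun x => (f x - (p1 x + p2 x)) ^+ 2).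
  by apply: rL2_sq; apply: rL2B => //; apply: rL2D; [exact: test_rL2 T1|exact: test_rL2 T2].
rewrite (rint_split le0 le1 I) [leRHS]splitr; apply: lerD.
  apply: le_trans h1; rewrite le_eqVlt; apply/orP; left; apply/eqP.
  by apply: eq_rint => x /andP[_ xx]; rewrite (test_le t2) ?addr0// ltW.
apply: le_trans h2; rewrite le_eqVlt; apply/orP; left; apply/eqP.
by apply: eq_rint => x /andP[xx _]; rewrite (test_ge t1) ?add0r// ltW.
Qed.

(** [u_xx] is replaced by a test function and [v] by one vanishing at [xi]. Then [u_xxx] has no
    jump, as the interface condition requires, and one chain serves on both sides. *)
Lemma domA_dense U e : inH U -> 0 < e -> exists2 V, domA a alpha xi V & normH a (U - V) <= e.
Proof.
move=> hU e0; have [F hF] := (inHP U).1 hU.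
(* The squared distance is a sum of two terms at most [d] and two at most [a d]. *)
have d0 : 0 < e ^+ 2 / (2 * (1 + a)) by rewrite divr_gt0 ?exprn_gt0// mulr_gt0// addr_gt0.
set d := e ^+ 2 / _ in d0.
have rF p : rL2 0 1 (F p 2%N).
  have [_ _ /(_ p)[Fc _ _ _]] := hF.
  exact: (chain_rL2 (k := 2%N) (j := 2%N) ler01 isT Fc isT).
have /choice[phi hphi] : forall p, exists phi, test_function 0 1 phi /\
    rint 0 1 (fun x => (F p 2%N x - phi x) ^+ 2) <= d.
  by move=> p; exact: test_dense.
have /choice[psi hpsi] : forall p, exists psi, [/\ test_function 0 1 psi, psi xi = 0 &
    rint 0 1 (fun x => (cv p U x - psi x) ^+ 2) <= d].
  by move=> p; apply: test_dense_punctured => //; exact: inH_cv.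
have tphi p := (hphi p).1.
have tpsi p : test_function 0 1 (psi p) by have [] := hpsi p.
pose c p := - rint 0 1 (fun y => rint 0 y (phi p)).
pose u1 p y := c p + rint 0 y (phi p); pose u0 p y := 0 + rint 0 y (u1 p).
pose X p j := match j with 0%N => u0 p | 1%N => u1 p | 2%N => phi p
  | 3%N => derive1 (phi p) | _ => derive1 (derive1 (phi p)) end.
have A1 p : AC 0 1 (u1 p) (phi p) by apply: AC_prim; exact: test_rL2.
have r1 p : rL2 0 1 (u1 p) by exact: AC_rL2 ler01 (A1 p).
have A0 p : AC 0 1 (u0 p) (u1 p) by exact: AC_prim.
have A2 p : AC 0 1 (phi p) (derive1 (phi p)) by exact/smooth_AC/test_smooth.
have A3 p : AC 0 1 (derive1 (phi p)) (derive1 (derive1 (phi p))).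
  by apply: smooth_AC; apply: smooth_derive; exact: test_smooth.
have cX p : chain 0 1 4 (X p) by case=> [|[|[|[|j]]]] // _; [exact: A0|exact: A1|exact: A2|exact: A3].
pose G p j := match j with 0%N => psi p | 1%N => derive1 (psi p) | _ => derive1 (derive1 (psi p)) end.
have cG p : chain 0 1 2 (G p).
  have sp := test_smooth (tpsi p).
  by case=> [|[|j]] // _; [exact: smooth_AC sp|exact: smooth_AC (smooth_derive sp)].
pose V : state R := (cpair u0, cpair psi).
have aV p : cf p V.1 = X p 0%N by exact: cf_cpair.
have aV2 p : cf p V.2 = psi p by exact: cf_cpair.
have hV : Hrep V X.
  split; [by apply/L2P => p; rewrite aV; exact: AC_rL2 ler01 (A0 p)|
    by apply/L2P => p; rewrite aV2; exact: test_rL2 (tpsi p)|move=> p; split].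
  - exact: chain_le (cX p).
  - by rewrite aV; exact: aeq_refl.
  - by rewrite /X /u0 rint_empty// addr0.
  - rewrite /X /u0 add0r /u1 rintD; [|exact: rintegrable_cst|].
      by rewrite rint_cst// subr0 mulr1 /c addNr.
    have := rL2_int (rL2B (r1 p) (rL2_cst 0 1 (c p))).
    by apply: eq_rintegrable => y _; rewrite /u1 addrC addKr.
have le0 := ltW xi0; have le1 := ltW xi1.
have iV : inH V by apply/inHP; exists X.
exists V.
  apply/(domAP a alpha xi0 xi1); exists X, X, X, G; split=> [//||p].
    by case: iV.
  split; rewrite ?aV ?aV2.
  - by split; [exact: chain_sub (lexx 0) le1 (cX p)|exact: aeq_refl].
  - by split; [exact: chain_sub le0 (lexx 1) (cX p)|exact: aeq_refl].
  - split; [exact: cG|exact: aeq_refl|exact: test_le (tpsi p) _|exact: test_ge (tpsi p) _].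
  - have [_ psi0 _] := hpsi p.
    by split; [exact: test_le (tphi p) _|exact: test_ge (tphi p) _|by []|rewrite subrr /G psi0 mulr0].
have : normH a (U - V) ^+ 2 <= e ^+ 2.
  rewrite (normHB_sq a0)//.
  have Ev p : rint 0 1 (fun x => (cv p U x - cv p V x) ^+ 2) <= d.
    have -> : cv p V = psi p by exact: aV2.
    by have [] := hpsi p.
  have Ed p : a * rint 0 1 (fun x => (cd p U x - cd p V x) ^+ 2) <= a * d.
    rewrite ler_pM2l//; have [_ hd] := hphi p; apply: le_trans hd.
    rewrite le_eqVlt; apply/orP; left; apply/eqP; apply: aeq_rint.
    - exact: rintegrable_meas (rL2_sq (rL2B (inH_cd p hU) (inH_cd p iV))).
    - exact: rintegrable_meas (rL2_sq (rL2B (rF p) (test_rL2 0 1 (tphi p)))).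
    - have := aeq_fun2 (fun y z => (y - z) ^+ 2) ((Hrep_weakD hF).2 p) ((Hrep_weakD hV).2 p).
      exact.
  apply: le_trans (lerD (lerD (Ev true) (Ed true)) (lerD (Ev false) (Ed false))) _.
  rewrite (_ : _ + _ = d * (2 * (1 + a))); last by ring.
  by rewrite /d divfK// gt_eqF// mulr_gt0// addr_gt0.
by rewrite ler_sqr ?nnegrE ?normH_ge0// ltW.
Qed.

End Density.

(** * Exponential stability and the explicit rate *)

Section Stability.
Local Open Scope classical_set_scope.
Local Open Scope complex_scope.
Context {R : realType}.
Implicit Types (a b alpha xi beta c eps t e : R) (U : state R).

Lemma semigroup_decay a b alpha xi (S : R -> state R -> state R) (C gamma : R) :
  0 < a -> 0 < xi -> xi < 1 -> C0_semigroup a S -> generated_by a b alpha xi S -> 0 < C ->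
  (forall V, trajectory a b alpha xi V -> forall t, 0 <= t ->
    normH a (V t) ^+ 2 <= C * expR (- (2 * gamma * t)) * normH a (V 0) ^+ 2) ->
  forall U t, inH U -> 0 <= t -> normH a (S t U) <= Num.sqrt C * expR (- gamma * t) * normH a U.
Proof.
move=> a0 xi0 xi1 SG gen C0 decay.
have [S_inH S_lin _ [S0 _] _] := SG.
have dom U t : domA a alpha xi U -> 0 <= t ->
    normH a (S t U) <= Num.sqrt C * expR (- gamma * t) * normH a U.
  move=> dU t0; have hU := domA_inH xi0 xi1 dU.
  have := decay _ (S_trajectory a0 xi0 xi1 SG gen dU) t t0.
  rewrite (ae_normH a (S0 U hU)) (_ : C * _ = (Num.sqrt C * expR (- gamma * t)) ^+ 2).
    by rewrite -exprMn ler_sqr ?nnegrE ?normH_ge0// !mulr_ge0 ?normH_ge0 ?sqrtr_ge0 ?expR_ge0.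
  rewrite exprMn sqr_sqrtr ?(ltW C0)// expr2 -expRD; congr (_ * expR _); ring.
move=> U t hU t0; apply/ler_addgt0Pr => e e0.
have [M M0 hM] := S_bound_pos SG t0.
set K := Num.sqrt C * expR (- gamma * t).
have K0 : 0 <= K by rewrite mulr_ge0 ?sqrtr_ge0 ?expR_ge0.
have KM : 0 < K + M by rewrite ltr_wpDl.
(* Replacing [U] by [V] costs [M |U - V|] in the image and [K |U - V|] in the bound. *)
have [V dV UV] := domA_dense alpha a0 xi0 xi1 hU (divr_gt0 e0 KM).
have hV := domA_inH xi0 xi1 dV; have hB := inHB hU hV.
have hSU := S_inH t U t0 hU; have hSV := S_inH t V t0 hV.
apply: le_trans (normH_le_add a0 hSU hSV) _.
rewrite -(normH_SB a S_inH S_lin)//.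
have h1 := dom V t dV t0; have h2 := hM _ hB.
have h3 := normH_le_add a0 hV hU; rewrite (normHB_sym a hV hU) in h3.
have h4 : K * normH a V <= K * (normH a U + normH a (U - V)) by rewrite ler_wpM2l.
have h5 : (K + M) * normH a (U - V) <= e by rewrite mulrC -ler_pdivlMr.
by move: h1 h2 h4 h5; rewrite -/K; move: (normH _ _) (normH _ _) (normH _ _) (normH _ _) (normH _ _)
  => *; lra.
Qed.

Lemma beam_exponentially_stable a b alpha xi : 0 < a -> 0 < b -> 0 < xi -> xi < 1 -> 0 < alpha ->
  exponentially_stable a b alpha xi.
Proof.
move=> a0 b0 xi0 xi1 al0 S SG gen.
have pi2 : 0 < pi ^+ 2 :> R by rewrite exprn_gt0// pi_gt0.
have pi4 : 0 < pi ^+ 4 :> R by rewrite exprn_gt0// pi_gt0.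
(* The three bounds give [2 beta <= b], then [b beta <= a pi^4 / 2] (coercivity with [c = a / 2]),
   and a trace correction of at most [beta / 2], which leaves a positive rate. *)
pose beta := Num.min (b / 2) (Num.min (a * pi ^+ 4 / (2 * b)) (a * pi ^+ 2 / alpha)).
have be0 : 0 < beta.
  by rewrite !lt_min; apply/and3P; split; apply: divr_gt0 => //; exact: mulr_gt0.
have : beta <= beta by [].
rewrite {2}/beta !le_min => /and3P[be1 be2 be3].
have h1 : 2 * beta <= b by move: be1; rewrite ler_pdivlMr// mulrC.
have h2 : - ((a - a / 2) * pi ^+ 4) <= beta ^+ 2 - b * beta.
  move: be2; rewrite ler_pdivlMr ?mulr_gt0// => be2.
  have : 0 <= beta ^+ 2 by exact: sqr_ge0.
  by move: be2; move: (pi ^+ 4) => P be2 be20; lra.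
have c0 : 0 < a / 2 by rewrite divr_gt0.
have ca : a / 2 <= a by move: a0; lra.
have [C C0 decay] := trajectory_decay (b := b) a0 xi0 xi1 al0 (ltW be0) h1 c0 ca h2.
exists (Num.sqrt C), (beta - alpha * beta ^+ 2 / (4 * (a / 2) * pi ^+ 2)); split.
- by rewrite sqrtr_gt0.
- move: be3; rewrite ler_pdivlMr// => be3.
  rewrite subr_gt0 ltr_pdivrMr; last by do 2![apply: mulr_gt0 => //].
  have : beta * (beta * alpha) <= beta * (a * pi ^+ 2) by rewrite ler_pM2l.
  have : 0 < beta * (a * pi ^+ 2) by exact: mulr_gt0 be0 (mulr_gt0 a0 pi2).
  by move: (pi ^+ 2) => P; lra.
by move=> U t; exact: (semigroup_decay a0 xi0 xi1 SG gen C0 decay).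
Qed.

(** Both cases of [omega0] in one formula: [D] is 0 in the first and the square root of the
    discriminant in the second. *)
Lemma omega0_discriminant a b eps : 0 < a -> 0 < b -> exists D, [/\ 0 <= D,
  b ^+ 2 - 4 * a * pi ^+ 4 <= D ^+ 2 & omega0 a b eps = (- b + D) / 2 + eps].
Proof.
move=> a0 b0; rewrite /omega0; case: ifPn => hb.
  exists 0; split=> //; last by rewrite addr0 mulNr.
  rewrite expr0n/= subr_le0.
  have : b ^+ 2 <= (2 * Num.sqrt a * pi ^+ 2) ^+ 2.
    by rewrite ler_sqr ?nnegrE ?(ltW b0)// (le_trans (ltW b0) hb).
  move/le_trans; apply; rewrite -[in leRHS](sqr_sqrtr (ltW a0)).
  by move: (Num.sqrt a) (pi : R) => s P; rewrite le_eqVlt; apply/orP; left; apply/eqP; ring.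
exists (Num.sqrt (b ^+ 2 - 4 * a * pi ^+ 4)); split; first exact: sqrtr_ge0.
  have [h|h] := leP 0 (b ^+ 2 - 4 * a * pi ^+ 4); first by rewrite sqr_sqrtr.
  by apply: le_trans (ltW h) _; exact: sqr_ge0.
by rewrite mulrC.
Qed.

(** A solution meets its initial datum only up to null sets, so [U 0] need not lie in [H]; it is
    replaced by [U0], which changes no norm. *)
Lemma solution_trajectory a b alpha xi U0 (U : R -> state R) : 0 < xi -> xi < 1 ->
  domA a alpha xi U0 -> is_solution a b alpha xi U0 U ->
  trajectory a b alpha xi (fun t => if t <= 0 then U0 else U t).
Proof.
move=> xi0 xi1 dU0 [U00 cU dU rU _].
have E t : 0 <= t -> eqH (U t) (if t <= 0 then U0 else U t).
  move=> t0; case: leP => t1; last exact: eqH_refl.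
  by have -> : t = 0 by apply/eqP; rewrite eq_le t1 t0.
split.
- by move=> t t0; case: leP => t1; [exact: domA_inH dU0|exact: domA_inH (dU t t1)].
- by move=> t t0; rewrite leNgt t0; exact: dU.
- move=> t t0 e e0.
  have [d d0 hd] := cvg0_within (fun s => normH_ge0 a (U s - U t)) (cU t t0) e0.
  exists d; [exact: d0|move=> s s0 sd]; rewrite -(ae_normH a (eqHB (E s s0) (E t t0))).
  exact: hd.
- move=> t t0 e e0.
  have [d d0 hd] := cvg0_punctured (fun h => normH_ge0 a _) (rU t t0) e0.
  exists d; [exact: d0|move=> h h0 hd'].
  by rewrite (lt_geF t0) (lt_geF (addr_gt0 t0 h0)); exact: hd.
Qed.

End Stability.

Theorem theorem6p3 (R : realType) (a b xi : R)
    (a_gt0 : 0 < a) (b_gt0 : 0 < b) (xi_gt0 : 0 < xi) (xi_lt1 : xi < 1) :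
  (forall alpha : R, 0 < alpha -> exponentially_stable a b alpha xi) /\
  (forall eps : R, 0 < eps -> omega0 a b eps < 0 ->
    exists alpha0 : R, 0 < alpha0 /\
      forall alpha : R, 0 < alpha -> alpha < alpha0 ->
        exists C : R, 0 < C /\
          forall (U0 : state R) (U : R -> state R),
            domA a alpha xi U0 -> is_solution a b alpha xi U0 U ->
            forall t : R, 0 < t ->
              energy a (U t) <=
                C * expR (2 * omega0 a b eps * t)
                  * graph_norm a b alpha xi U0 ^+ 2).
Proof.
split=> [alpha al0|eps eps0 om0]; first exact: beam_exponentially_stable.
have pi2 : 0 < pi ^+ 2 :> R by rewrite exprn_gt0// pi_gt0.
have pi4 : 0 < pi ^+ 4 :> R by rewrite exprn_gt0// pi_gt0.
have [D [D0 hD omE]] := omega0_discriminant eps a_gt0 b_gt0.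
(* This is [(b - D) / 2 - eps / 2]: half of [eps] separates [beta] from the critical value, the
   other half is left for the trace correction. *)
pose beta := eps / 2 - omega0 a b eps.
have be0 : 0 < beta by rewrite subr_gt0 (lt_trans om0)// divr_gt0.
have h1 : 2 * beta <= b by rewrite /beta omE; lra.
(* [q] is the coercivity margin at [beta]; it is positive as it is at least
   [((D + eps)^2 - D^2) / 4]. *)
pose q := beta ^+ 2 - b * beta + a * pi ^+ 4.
have q0 : 0 < q.
  have : q = ((D + eps) / 2) ^+ 2 - (b ^+ 2 - 4 * a * pi ^+ 4) / 4.
    by rewrite /q /beta omE; move: (pi ^+ 4) => P; field.
  have : 0 <= D * eps by rewrite mulr_ge0// ltW.
  have : 0 < eps ^+ 2 by rewrite exprn_gt0.
  by move: hD; move: (pi ^+ 4) q => P q' ? ? ? ->; nra.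
pose c := Num.min a (q / pi ^+ 4).
have c0 : 0 < c by rewrite lt_min a_gt0 divr_gt0.
have ca : c <= a by rewrite ge_min lexx.
have h2 : - ((a - c) * pi ^+ 4) <= beta ^+ 2 - b * beta.
  have : c <= q / pi ^+ 4 by rewrite ge_min lexx orbT.
  rewrite ler_pdivlMr// /q mulrBl; move: (pi ^+ 4) (c * _) => P cP; lra.
(* Below this threshold the correction [alpha beta^2 / (4 c pi^2)] is at most [eps / 2], so the rate
   is still at least [- omega0]. *)
exists (eps * (2 * c * pi ^+ 2) / beta ^+ 2); split.
  apply: divr_gt0; last by rewrite exprn_gt0.
  by do 2![apply: mulr_gt0 => //]; exact: mulr_gt0.
move=> alpha al0; rewrite ltr_pdivlMr ?exprn_gt0// => al1.
have [C C0 decay] := trajectory_decay (b := b) a_gt0 xi_gt0 xi_lt1 al0 (ltW be0) h1 c0 ca h2.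
exists C; split=> // U0 U dU0 sol t t0.
have hU0 := domA_inH xi_gt0 xi_lt1 dU0.
have hUt : inH (U t) by case: sol => _ _ /(_ t t0) dUt _ _; exact: domA_inH dUt.
have := decay _ (solution_trajectory xi_gt0 xi_lt1 dU0 sol) t (ltW t0).
rewrite (lt_geF t0) lexx => dec.
rewrite energyE// -normH_sq ?(ltW a_gt0)//.
have G : normH a U0 ^+ 2 <= graph_norm a b alpha xi U0 ^+ 2.
  by rewrite ler_sqr ?nnegrE ?normH_ge0 ?addr_ge0 ?normH_ge0// lerDl normH_ge0.
set gam := beta - _ in dec.
have gam_le : - omega0 a b eps <= gam.
  suff : alpha * beta ^+ 2 / (4 * c * pi ^+ 2) <= eps / 2 by rewrite /gam /beta; lra.
  rewrite ler_pdivrMr; last by do 2![apply: mulr_gt0 => //].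
  by move: al1; move: (pi ^+ 2) (beta ^+ 2) => P b2; lra.
have N0 := sqr_ge0 (normH a (U t)).
apply: (@le_trans _ _ (normH a (U t) ^+ 2)); first by lra.
apply: le_trans dec _; apply: ler_pM; [|exact: sqr_ge0| |exact: G].
  by rewrite mulr_ge0 ?expR_ge0// ltW.
by rewrite ler_pM2l// ler_expR; move: gam_le t0; move: gam (omega0 _ _ _) => g o; nra.
Qed.
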